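(* Let $R$ be an indecomposable tame hereditary artin algebra. The following statements are equivalent for a right $R$-module $M$. (1) $M$ is a torsion reduced (strict) Mittag-Leffler module. (2) $M$ is a locally split epimorphic image of a direct sum of indecomposable finitely generated regular modules. Here ''(strict) Mittag-Leffler'' means that the statement holds both with ''Mittag-Leffler'' and with ''strict Mittag-Leffler''.
   Context: Modules are right $R$-modules unless stated otherwise. $\mathbf{t}$ is a representative set of all indecomposable finitely generated regular modules. A module is torsion if it belongs to $\mathrm{Gen}\,\mathbf{t}$, i.e. is an epimorphic image of a direct sum of modules from $\mathbf{t}$. A module $M$ is divisible if $\mathrm{Ext}^1_R(X,M)=0$ for all $X\in\mathbf{t}$ (equivalently, $\mathrm{Hom}_R(M,X)=0$ for all $X\in\mathbf{t}$), and reduced if it has no non-zero divisible submodule. ''Torsion reduced'' means torsion and reduced. A module $M$ is Mittag-Leffler if for every family $\{Q_i\}_{i\in I}$ of left $R$-modules the canonical map $M\otimes_R\prod_{i\in I}Q_i\to\prod_{i\in I}(M\otimes_R Q_i)$ is injective. A homomorphism $\pi:X\to M$ is a locally split epimorphism if for each finite subset $F\subseteq M$ there is a homomorphism $\varphi:M\to X$ with $\pi\varphi(m)=m$ for all $m\in F$; $M$ is then called a locally split epimorphic image of $X$. A module $M$ is strict Mittag-Leffler if every pure epimorphism $X\to M$ is locally split. *)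

(* Defs.v *)
From HB Require Import structures.
From mathcomp Require Import all_boot all_order all_algebra.
From mathcomp Require Import boolp classical_sets functions cardinality.

Set Implicit Arguments.
Unset Strict Implicit.
Unset Printing Implicit Defensive.

Import GRing.Theory.

Local Open Scope classical_set_scope.
Local Open Scope ring_scope.

(* A left A-module is an [lmodType A]; a right R-module is a left module over
   the converse ring, that is an [lmodType R^c]. *)

Section Modules.
Variable A : nzRingType.
Implicit Types X Y P K : lmodType A.

Definition onto (T U : Type) (f : T -> U) : Prop := forall y, exists x, f x = y.

Definition submodule X (U : set X) : Prop :=
  U 0 /\ forall a u v, U u -> U v -> U (a *: u + v).

Definition nonzero X : Prop := exists x : X, x <> 0.

Definition isomorphic X Y : Prop := exists f : {linear X -> Y}, bijective f.

Definition finitely_generated X : Prop :=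
  exists n (f : {linear 'rV[A]_n -> X}), onto f.

Definition finitely_presented X : Prop :=
  exists m n (g : {linear 'rV[A]_m -> 'rV[A]_n}) (f : {linear 'rV[A]_n -> X}),
    onto f /\ forall x, f x = 0 <-> exists y, g y = x.

Definition projective_module P : Prop :=
  forall X Y (f : {linear X -> Y}) (h : {linear P -> Y}),
    onto f -> exists g : {linear P -> X}, forall x, f (g x) = h x.

Definition injective_module (E : lmodType A) : Prop :=
  forall X Y (f : {linear X -> Y}) (h : {linear X -> E}),
    injective f -> exists g : {linear Y -> E}, forall x, g (f x) = h x.

Definition simple_module X : Prop :=
  nonzero X /\
  forall U : set X, submodule U -> U = [set 0] \/ U = setT.

Definition indecomposable_module X : Prop :=
  nonzero X /\
  forall U V : set X, submodule U -> submodule V ->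
    U `&` V = [set 0] -> (forall x, exists u v, [/\ U u, V v & x = u + v]) ->
    U = [set 0] \/ V = [set 0].

Definition superfluous X (S : set X) : Prop :=
  forall U : set X, submodule U ->
    (forall x, exists u s, [/\ U u, S s & x = u + s]) -> U = setT.

Definition essential X (S : set X) : Prop :=
  forall U : set X, submodule U -> U `&` S = [set 0] -> U = [set 0].

Definition short_exact K P X (i : {linear K -> P}) (p : {linear P -> X}) : Prop :=
  [/\ injective i, onto p & forall x, p x = 0 <-> exists y, i y = x].

(* P1 -> P0 -> X -> 0 is exact, and both P0 -> X and P1 -> ker (P0 -> X) are
   projective covers. *)
Definition minimal_projective_presentation (P1 P0 X : lmodType A)
    (p1 : {linear P1 -> P0}) (p0 : {linear P0 -> X}) : Prop :=
  [/\ projective_module P1, projective_module P0, onto p0,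
      forall x, p0 x = 0 <-> exists y, p1 y = x &
      superfluous [set x | p0 x = 0] /\ superfluous [set x | p1 x = 0]].

Definition pure_epi X Y (f : {linear X -> Y}) : Prop :=
  onto f /\
  forall (F : lmodType A) (h : {linear F -> Y}), finitely_presented F ->
    exists g : {linear F -> X}, forall x, f (g x) = h x.

Definition locally_split_epi X Y (f : {linear X -> Y}) : Prop :=
  forall s : seq Y, exists g : {linear Y -> X}, {in s, forall y, f (g y) = y}.

Definition strict_mittag_leffler Y : Prop :=
  forall X (f : {linear X -> Y}), pure_epi f -> locally_split_epi f.

(* Submodules of the regular module A^o are the left ideals of A; for A = R^c
   they are the right ideals of R. *)
Definition ideals_projective : Prop :=
  forall (U : lmodType A) (i : {linear U -> A^o}),
    injective i -> projective_module U.

Definition artinian_ring : Prop :=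
  forall U : nat -> set A^o, (forall n, submodule (U n)) ->
    (forall n, U n.+1 `<=` U n) ->
    exists n, forall m, (n <= m)%N -> U m = U n.

End Modules.

Section ProductsAndSums.
Variables (A : nzRingType) (I : Type) (Q : I -> lmodType A).

Definition dprod : Type := forall i, Q i.

HB.instance Definition _ := gen_eqMixin dprod.
HB.instance Definition _ := gen_choiceMixin dprod.

Let add (f g : dprod) : dprod := fun i => f i + g i.
Let opp (f : dprod) : dprod := fun i => - f i.
Let zero : dprod := fun=> 0.
Let scale (a : A) (f : dprod) : dprod := fun i => a *: f i.

Fact dprod_addA : associative add.
Proof. by move=> f g h; apply: functional_extensionality_dep => i; exact: addrA. Qed.
Fact dprod_addC : commutative add.
Proof. by move=> f g; apply: functional_extensionality_dep => i; exact: addrC. Qed.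
Fact dprod_add0 : left_id zero add.
Proof. by move=> f; apply: functional_extensionality_dep => i; exact: add0r. Qed.
Fact dprod_addN : left_inverse zero opp add.
Proof. by move=> f; apply: functional_extensionality_dep => i; exact: addNr. Qed.

HB.instance Definition _ :=
  GRing.isZmodule.Build dprod dprod_addA dprod_addC dprod_add0 dprod_addN.

Fact dprod_scaleA a b (f : dprod) : scale a (scale b f) = scale (a * b) f.
Proof. by apply: functional_extensionality_dep => i; exact: scalerA. Qed.
Fact dprod_scale1 : left_id 1 scale.
Proof. by move=> f; apply: functional_extensionality_dep => i; exact: scale1r. Qed.
Fact dprod_scaleDr : right_distributive scale +%R.
Proof. by move=> a f g; apply: functional_extensionality_dep => i; exact: scalerDr. Qed.
Fact dprod_scaleDl (f : dprod) : {morph scale^~ f : a b / a + b}.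
Proof. by move=> a b; apply: functional_extensionality_dep => i; exact: scalerDl. Qed.

HB.instance Definition _ := GRing.Zmodule_isLmodule.Build A dprod
  dprod_scaleA dprod_scale1 dprod_scaleDr dprod_scaleDl.

Definition finsupp : {pred dprod} :=
  fun f => `[< finite_set [set i | f i <> 0] >].

Fact finsupp_submod : submod_closed finsupp.
Proof.
split.
  apply/asboolP; rewrite (_ : [set _ | _] = set0); first exact: finite_set0.
  by apply/seteqP; split => // i /=; apply.
move=> a f g /asboolP Ff /asboolP Fg; apply/asboolP.
have /sub_finite_set : [set i | (a *: f + g : dprod) i <> 0] `<=`
    [set i | f i <> 0] `|` [set i | g i <> 0].
  move=> i /= N0; apply: contrapT => /not_orP[/contrapT f0 /contrapT g0].
  by apply: N0; rewrite /GRing.add /= /add /GRing.scale /= /scale f0 g0 scaler0 addr0.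
by apply; rewrite finite_setU.
Qed.

HB.instance Definition _ := GRing.isSubmodClosed.Build A dprod finsupp finsupp_submod.

Record dsum : Type := DSum { dsum_val : dprod; dsum_valP : dsum_val \in finsupp }.

HB.instance Definition _ := [isSub for dsum_val].
HB.instance Definition _ := [Choice of dsum by <:].
HB.instance Definition _ := [SubChoice_isSubLmodule of dsum by <:].

End ProductsAndSums.

Section Tensor.
Variable R : nzRingType.

(* M (x)_R Q is presented as formal sums of pure tensors (lists of pairs) modulo
   the congruence below.  No integer coefficients are needed, since
   - (m (x) q) is (- m) (x) q. *)
Inductive tensor_eq (M : lmodType R^c) (Q : lmodType R) :
    seq (M * Q) -> seq (M * Q) -> Prop :=
| tensor_refl s : tensor_eq s s
| tensor_sym s t : tensor_eq s t -> tensor_eq t s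
| tensor_trans s t u : tensor_eq s t -> tensor_eq t u -> tensor_eq s u
| tensor_cat s s' t t' :
    tensor_eq s s' -> tensor_eq t t' -> tensor_eq (s ++ t) (s' ++ t')
| tensor_comm s t : tensor_eq (s ++ t) (t ++ s)
| tensor_zero q : tensor_eq [:: (0, q)] [::]
| tensor_addl m m' q : tensor_eq [:: (m + m', q)] [:: (m, q); (m', q)]
| tensor_addr m q q' : tensor_eq [:: (m, q + q')] [:: (m, q); (m, q')]
| tensor_bal m (r : R) q : tensor_eq [:: ((r : R^c) *: m, q)] [:: (m, r *: q)].

Definition mittag_leffler (M : lmodType R^c) : Prop :=
  forall (I : Type) (Q : I -> lmodType R) (s t : seq (M * dprod Q)),
    (forall i, tensor_eq [seq (x.1, x.2 i) | x <- s] [seq (x.1, x.2 i) | x <- t]) ->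
    tensor_eq s t.

End Tensor.

Section ArtinAlgebra.
Variables (k : comNzRingType) (R : algType k).

Definition artin_algebra : Prop :=
  artinian_ring k /\
  exists n (g : 'I_n -> R), forall r, exists c : 'I_n -> k, r = \sum_i c i *: g i.

Definition hereditary : Prop := ideals_projective R^c /\ ideals_projective R.

Definition indecomposable_ring : Prop :=
  forall e : R, e * e = e -> (forall r, e * r = r * e) -> e = 0 \/ e = 1.

Implicit Types X Y : lmodType R^c.

(* The ring k acts on a right R-module through k -> R; in particular on the
   R^c-module of all functions X -> Y, pointwise. *)
Definition ksubmodule Y (U : set Y) : Prop :=
  U 0 /\ forall (c : k) u v, U u -> U v -> U (((c%:A : R) : R^c) *: u + v).

(* The k-length of the subquotient C / B is n. *)
Definition klength Y (B C : set Y) (n : nat) : Prop :=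
  let chain m := exists U : nat -> set Y,
    [/\ forall j, (j <= m)%N -> ksubmodule (U j), U 0 = B, U m = C &
        forall j, (j < m)%N -> U j `<` U j.+1] in
  chain n /\ forall m, chain m -> (m <= n)%N.

Definition homs X Y : set (X -> Y) :=
  [set f | exists g : {linear X -> Y}, f = (g : X -> Y)].

Definition pullbacks (K P Y : lmodType R^c) (i : K -> P) : set (K -> Y) :=
  [set f | exists g : {linear P -> Y}, f = g \o i].

Definition hom_length X Y (n : nat) : Prop := klength [set 0] (@homs X Y) n.

(* For 0 -> K -> P -> X -> 0 exact with P projective, Ext^1(X, Y) is the
   cokernel of Hom(P, Y) -> Hom(K, Y). *)
Definition ext1_length X Y (n : nat) : Prop :=
  exists (K P : lmodType R^c) (i : {linear K -> P}) (p : {linear P -> X}),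
    [/\ projective_module P, short_exact i p &
        klength (pullbacks i) (@homs K Y) n].

Definition ext1_zero X Y : Prop :=
  exists (K P : lmodType R^c) (i : {linear K -> P}) (p : {linear P -> X}),
    [/\ projective_module P, short_exact i p & pullbacks i = @homs K Y].

Definition simple_representatives n (S : 'I_n -> lmodType R^c) : Prop :=
  [/\ forall i, simple_module (S i),
      forall X, simple_module X -> exists i, isomorphic X (S i) &
      forall i j, isomorphic (S i) (S j) -> i = j].

(* Tameness in the sense of Dlab and Ringel: the homological quadratic form
   q(x) = sum_(i, j) (l Hom(S_i, S_j) - l Ext^1(S_i, S_j)) x_i x_j on the
   Grothendieck group is positive semidefinite but not positive definite. *)
Definition tame : Prop :=
  exists n (S : 'I_n -> lmodType R^c) (h e : 'I_n -> 'I_n -> nat),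
    [/\ simple_representatives S,
        forall i j, hom_length (S i) (S j) (h i j),
        forall i j, ext1_length (S i) (S j) (e i j) &
        let q (x : 'I_n -> int) :=
          \sum_i \sum_j ((h i j)%:Z - (e i j)%:Z) * x i * x j in
        (forall x, 0 <= q x) /\ exists2 x, (exists i, x i <> 0) & q x = 0].

Definition maximal_ideal (m : set k^o) : Prop :=
  [/\ submodule m, m <> setT &
      forall U : set k^o, submodule U -> m `<=` U -> U = m \/ U = setT].

(* J is an injective envelope of k / rad k, embedded in J through e. *)
Definition injective_envelope_top (J : lmodType k) (e : {linear k^o -> J}) : Prop :=
  [/\ injective_module J, essential (range e) &
      forall c, e c = 0 <-> forall m, maximal_ideal m -> m c].

(* T is isomorphic to Tr X, the cokernel of Hom(P0, R) -> Hom(P1, R) for a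
   minimal projective presentation P1 -> P0 -> X -> 0; tr is the projection of
   the left R-module Hom(P1, R) onto T. *)
Definition is_transpose X (T : lmodType R) : Prop :=
  exists (P1 P0 : lmodType R^c) (p1 : {linear P1 -> P0}) (p0 : {linear P0 -> X})
         (tr : {linear P1 -> R^c^o} -> T),
    [/\ minimal_projective_presentation p1 p0,
        forall (r : R) (f g h : {linear P1 -> R^c^o}),
          (forall x, (h x : R) = r * (f x : R) + (g x : R)) ->
          tr h = r *: tr f + tr g,
        onto tr &
        forall f, tr f = 0 <->
          exists g : {linear P0 -> R^c^o}, forall x, f x = g (p1 x)].

(* Y is isomorphic to the right R-module D T = Hom_k(T, J), where
   (f r)(t) = f (r t), through d. *)
Definition is_dual (T : lmodType R) Y : Prop :=
  exists (J : lmodType k) (e : {linear k^o -> J}) (d : Y -> T -> J),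
    [/\ injective_envelope_top e,
        forall y (c : k) t t', d y ((c%:A : R) *: t + t') = c *: d y t + d y t',
        forall (r : R) y y' t, d ((r : R^c) *: y + y') t = d y (r *: t) + d y' t,
        injective d &
        forall f : T -> J,
          (forall (c : k) t t', f ((c%:A : R) *: t + t') = c *: f t + f t') ->
          exists y, d y = f].

Definition is_DTr X Y : Prop := exists2 T : lmodType R, is_transpose X T & is_dual T Y.

Fixpoint is_DTr_iter (n : nat) X Y : Prop :=
  if n is m.+1 then exists2 Z, is_DTr X Z & is_DTr_iter m Z Y else isomorphic X Y.

Definition indecomposable_fg X : Prop :=
  indecomposable_module X /\ finitely_generated X.

Definition preprojective X : Prop :=
  exists n P, [/\ indecomposable_fg P, projective_module P & is_DTr_iter n X P].

Definition preinjective X : Prop :=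
  exists n E, [/\ indecomposable_fg E, injective_module E & is_DTr_iter n E X].

(* The isomorphism-closed class of the indecomposable finitely generated regular
   modules, in place of a representative set of it. *)
Definition indecomposable_regular X : Prop :=
  [/\ indecomposable_fg X, ~ preprojective X & ~ preinjective X].

Definition torsion (M : lmodType R^c) : Prop :=
  exists (I : Type) (X : I -> lmodType R^c) (f : {linear dsum X -> M}),
    (forall i, indecomposable_regular (X i)) /\ onto f.

Definition divisible (M : lmodType R^c) : Prop :=
  forall X, indecomposable_regular X -> ext1_zero X M.

Definition reduced (M : lmodType R^c) : Prop :=
  forall (D : lmodType R^c) (i : {linear D -> M}),
    injective i -> divisible D -> ~ nonzero D.

End ArtinAlgebra.

(* Main.v *)
Require Import Defs.
From HB Require Import structures.
From mathcomp Require Import all_boot all_order all_algebra.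
From mathcomp Require Import boolp classical_sets functions cardinality.

Set Implicit Arguments.
Unset Strict Implicit.
Unset Printing Implicit Defensive.

Import Order.TTheory GRing.Theory Num.Theory.
Local Open Scope ring_scope.
Local Open Scope classical_set_scope.

(** Every module is studied through the finitely generated ones, which over an
artin algebra have finite length over k and are isomorphic to their double
duals for D = Hom_k(-, J).

From (2) to (1).  A local splitting M -> \bigoplus X_i sends a finite set into
a finite subsum, so near every finite set the identity of M factors through a
finitely generated module W ([locally_split_fg]).  As W is finitely presented,
maps out of it lift along pure epimorphisms, and tensoring with it commutes
with products; hence M is strict Mittag-Leffler and Mittag-Leffler.  M is
reduced because a divisible module has no non-zero map to a regular one
([divisible_hom_zero]).

From (1) to (2).  A finite subset of a torsion module lies in a finitely
generated image of regular modules; decompose that image into indecomposables.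
A preprojective summand would receive a non-zero map from a regular module,
which is excluded by [preprojective_hom_zero]; a preinjective summand would be
a divisible submodule by [preinjective_divisible].  So every finite subset of a
torsion reduced M lies in a finite direct sum of regular submodules
([regular_cover]), and the sum of all regular submodules maps onto M by a pure
epimorphism.  If M is strict Mittag-Leffler, this epimorphism is locally split.
If M is Mittag-Leffler, apply the defining property to the family of all DV,
for V in the directed system of these finitely generated submodules: it gives,
for a finite set F in M, one V such that the evaluation on F (x) DV vanishes on
all relations that hold in M (x) DV.  The evaluation therefore extends to a
functional on M (x) DV, that is, to a homomorphism from M to DDV = V that fixes
F ([mittag_leffler_splits]).

The three facts on regular modules come from the Auslander-Reiten formulas for
the translate tau = DTr over a hereditary algebra: Ext^1(Y, M) is dual to
Hom(M, tau Y), and Ext^1(X, tau Y) is dual to Hom(Y, X) when Y has no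
projective summand.  Only the resulting equivalences between vanishing
statements are used; they move such a statement along tau-orbits, down to
projective or injective modules.  For this one needs that tau and its inverse
send indecomposables to indecomposables ([DTr_exists], [TrD_exists]).

What precedes rests on commutative algebra over k: artinian implies noetherian,
the injective envelope J of k / rad k exists, and modules of finite length are
reflexive. *)

(** * Modules from setoids, submodules and linear relations *)

Definition mklin (A : nzRingType) (V W : lmodType A) (f : V -> W)
  (H : linear f) : {linear V -> W} :=
  HB.pack_for {linear V -> W} f (GRing.isLinear.Build A V W *:%R f H).

Section Setoid.
Variables (A : nzRingType) (S : Type) (E : S -> S -> Prop).
Variables (zero : S) (add : S -> S -> S) (opp : S -> S) (scale : A -> S -> S).
Hypotheses (Er : forall s, E s s) (Es : forall s t, E s t -> E t s)
  (Et : forall s t u, E s t -> E t u -> E s u)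
  (Eadd : forall s s' t t', E s s' -> E t t' -> E (add s t) (add s' t'))
  (Escale : forall a s s', E s s' -> E (scale a s) (scale a s'))
  (addA : forall s t u, E (add s (add t u)) (add (add s t) u))
  (addC : forall s t, E (add s t) (add t s))
  (add0 : forall s, E (add zero s) s)
  (addN : forall s, E (add (opp s) s) zero)
  (scA : forall a b s, E (scale a (scale b s)) (scale (a * b) s))
  (sc1 : forall s, E (scale 1 s) s)
  (scDr : forall a s t, E (scale a (add s t)) (add (scale a s) (scale a t)))
  (scDl : forall a b s, E (scale (a + b) s) (add (scale a s) (scale b s))).

(** Quotients, submodules, dual modules and tensor products are all obtained
from this lemma: the laws are required only up to the congruence E. *)
Lemma module_of_setoid : exists (W : lmodType A) (p : S -> W),
  [/\ onto p, forall s t, p s = p t <-> E s t,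
      forall s t, p (add s t) = p s + p t & forall a s, p (scale a s) = a *: p s].
Proof.
pose Q := {C : set S | exists s, C = E s}.
pose pr s : Q := exist _ (E s) (ex_intro _ s erefl).
pose rp (q : Q) := projT1 (cid (proj2_sig q)).
have prE s t : E s t -> pr s = pr t.
  move=> st; apply: eq_exist; apply/seteqP; split=> u /= h; first exact: Et (Es st) h.
  exact: Et st h.
have prE' s t : pr s = pr t -> E s t.
  by move=> /(congr1 (fun q : Q => sval q t)) /= ->.
have rpK q : pr (rp q) = q.
  rewrite /rp; case: cid => s /=; case: q => C /= ex CE.
  by apply: eq_exist.
have Erp s : E (rp (pr s)) s by apply: prE'; rewrite rpK.
pose add' p q := pr (add (rp p) (rp q)).
pose opp' p := pr (opp (rp p)).
pose sc' a p := pr (scale a (rp p)).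
have addE s t : pr (add s t) = add' (pr s) (pr t).
  by apply: prE; apply: Eadd; apply: Es.
have scE a s : pr (scale a s) = sc' a (pr s).
  by apply: prE; apply: Escale; apply: Es.
have aA : associative add'.
  move=> p q r; rewrite -(rpK p) -(rpK q) -(rpK r) -!addE; exact: prE.
have aC : commutative add'.
  move=> p q; rewrite -(rpK p) -(rpK q) -!addE; exact: prE.
have a0 : left_id (pr zero) add'.
  move=> p; rewrite -(rpK p) -!addE; exact: prE.
have aN : left_inverse (pr zero) opp' add'.
  move=> p; rewrite -{2}(rpK p) -!addE; exact: prE.
pose QC : choiceType := HB.pack Q (gen_eqMixin Q) (gen_choiceMixin Q).
pose Z : zmodType := HB.pack Q QC (GRing.isZmodule.Build QC aA aC a0 aN).
have sA a b (p : Z) : sc' a (sc' b p) = sc' (a * b) p.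
  rewrite -(rpK p) -!scE; exact: prE.
have s1 : left_id 1 (sc' : A -> Z -> Z).
  move=> p; rewrite -(rpK p) -!scE; exact: prE.
have sDr : right_distributive (sc' : A -> Z -> Z) +%R.
  move=> a p q; rewrite -(rpK p) -(rpK q).
  rewrite -[(pr _ : Z) + _]addE -!scE -[RHS]addE; exact: prE.
have sDl (p : Z) : {morph (sc' : A -> Z -> Z)^~ p : a b / a + b}.
  move=> a b; rewrite -(rpK p) -!scE -[RHS]addE; exact: prE.
pose W : lmodType A := HB.pack Q Z (GRing.Zmodule_isLmodule.Build A Z sA s1 sDr sDl).
exists W, pr; split.
- by move=> q; exists (rp q); exact: rpK.
- by move=> s t; split; [exact: prE' | exact: prE].
- exact: addE.
- exact: scE.
Qed.
End Setoid.

(** Homomorphisms over one ring as a module over another: the common form of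
coinduced modules, of duals Hom_k(T, J) and of Hom(P, A). *)
Lemma module_of_homs (A B : nzRingType) (V W : lmodType B)
    (act : A -> {linear V -> W} -> {linear V -> W}) :
  (forall a (f g : {linear V -> W}), f =1 g -> act a f =1 act a g) ->
  (forall a (f g : {linear V -> W}), act a (f \+ g : {linear V -> W}) =1 act a f \+ act a g) ->
  (forall a b f, act (a + b) f =1 act a f \+ act b f) ->
  (forall a b f, act a (act b f) =1 act (a * b) f) ->
  (forall f, act 1 f =1 f) ->
  exists (E : lmodType A) (ev : E -> {linear V -> W}),
  [/\ forall a e e' x, ev (a *: e + e') x = act a (ev e) x + ev e' x,
      forall e e', ev e =1 ev e' -> e = e' & forall f : {linear V -> W}, exists e, ev e =1 f].
Proof.
move=> actE actDr actDl actM act1.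
have [||||||||||||| E [p [po pE pD pZ]]] := @module_of_setoid A {linear V -> W}
  (fun f g => f =1 g) (\0 : {linear V -> W})
  (fun f g => f \+ g : {linear V -> W}) (fun f => \- f : {linear V -> W}) act => //=.
- by move=> f g fg x; rewrite fg.
- by move=> f g h fg gh x; rewrite fg gh.
- by move=> f f' g g' ff' gg' x; rewrite /= ff' gg'.
- by move=> f g h x; rewrite /= addrA.
- by move=> f g x; rewrite /= addrC.
- by move=> f x; rewrite /= add0r.
- by move=> f x; rewrite /= addNr.
pose ev e := projT1 (cid (po e)).
have evK e : p (ev e) = e by rewrite /ev; case: cid.
have pK f : ev (p f) =1 f by apply/pE; rewrite evK.
exists E, ev; split=> [a e e' x|e e' ee'|f].
- by rewrite -{1}(evK e) -{1}(evK e') -pZ -pD pK.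
- by rewrite -(evK e) -(evK e'); apply/pE.
- by exists (p f); exact: pK.
Qed.

Section Basics.
Variable A : nzRingType.
Implicit Types V W : lmodType A.

Lemma submod0 V (U : set V) : submodule U -> U 0. Proof. by case. Qed.
Lemma submodD V (U : set V) u v : submodule U -> U u -> U v -> U (u + v).
Proof. by case=> _ H Uu Uv; rewrite -[u]scale1r; apply: H. Qed.
Lemma submodZ V (U : set V) a u : submodule U -> U u -> U (a *: u).
Proof. by case=> U0 H Uu; rewrite -[_ *: _]addr0; apply: H. Qed.
Lemma submodN V (U : set V) u : submodule U -> U u -> U (- u).
Proof. by move=> sU Uu; rewrite -scaleN1r; apply: submodZ. Qed.
Lemma submodB V (U : set V) u v : submodule U -> U u -> U v -> U (u - v).
Proof. by move=> sU Uu Uv; apply: submodD => //; apply: submodN. Qed.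
Lemma submod_sum V (U : set V) (I : Type) (r : seq I) (P : pred I) (F : I -> V) :
  submodule U -> (forall i, P i -> U (F i)) -> U (\sum_(i <- r | P i) F i).
Proof. by move=> sU h; elim/big_ind: _ => //; [exact: submod0 | move=> *; apply: submodD]. Qed.

Lemma submodule_setT V : submodule [set: V]. Proof. by []. Qed.
Lemma submodule_set0 V : submodule [set (0 : V)].
Proof. by split=> // a u v -> ->; rewrite scaler0 addr0. Qed.
Lemma submodule_setI V (U U' : set V) :
  submodule U -> submodule U' -> submodule (U `&` U').
Proof.
move=> [? hU] [? hU']; split=> // a u v [? ?] [? ?].
by split; [apply: hU | apply: hU'].
Qed.
Definition sumset V (U U' : set V) : set V :=
  [set x | exists u u', [/\ U u, U' u' & x = u + u']].
Lemma submodule_sum V (U U' : set V) :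
  submodule U -> submodule U' -> submodule (sumset U U').
Proof.
move=> [? hU] [? hU']; split; first by exists 0, 0; rewrite addr0.
move=> a _ _ [u [u' [? ? ->]]] [v [v' [? ? ->]]].
exists (a *: u + v), (a *: u' + v'); split; [exact: hU | exact: hU' |].
by rewrite scalerDr addrACA.
Qed.
Lemma submodule_preim V W (f : {linear V -> W}) (U : set W) :
  submodule U -> submodule [set x | U (f x)].
Proof.
move=> [? hU]; split=> [|a u v] /=; rewrite ?linear0 ?linearP //; exact: hU.
Qed.
Lemma submodule_ker V W (f : {linear V -> W}) : submodule [set x | f x = 0].
Proof. exact: (submodule_preim f (submodule_set0 W)). Qed.
Lemma submodule_im V W (f : {linear V -> W}) (U : set V) :
  submodule U -> submodule [set y | exists2 x, U x & f x = y].
Proof.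
move=> [? hU]; split=> [|a _ _ [u Uu <-] [v Uv <-]] /=.
  by exists 0; rewrite ?linear0.
by exists (a *: u + v); [exact: hU | rewrite linearP].
Qed.
Definition line V (v : V) : set V := [set x | exists c, x = c *: v].
Lemma submodule_line V (v : V) : submodule (line v).
Proof.
split; first by exists 0; rewrite scale0r.
by move=> a _ _ [c ->] [d ->]; exists (a * c + d); rewrite scalerDl scalerA.
Qed.

Lemma line_mem V (v : V) : line v v.
Proof. by exists 1; rewrite scale1r. Qed.
Lemma sumset_l V (U U' : set V) : submodule U' -> U `<=` sumset U U'.
Proof. by move=> sU' x Ux; exists x, 0; rewrite addr0; split=> //; apply: submod0. Qed.
Lemma sumset_r V (U U' : set V) : submodule U -> U' `<=` sumset U U'.
Proof. by move=> sU x Ux; exists 0, x; rewrite add0r; split=> //; apply: submod0. Qed.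
Lemma submodule_sum_line V (U : set V) v : submodule U -> submodule (sumset U (line v)).
Proof. by move=> sU; apply: submodule_sum => //; apply: submodule_line. Qed.

(** Most homomorphisms below are built from a linear relation, because their
values are only characterised up to a choice that turns out not to matter. *)
Lemma lin_of_graph V W (G : V -> W -> Prop) :
  (forall v, exists w, G v w) -> (forall w, G 0 w -> w = 0) ->
  (forall a v v' w w', G v w -> G v' w' -> G (a *: v + v') (a *: w + w')) ->
  exists f : {linear V -> W}, forall v, G v (f v).
Proof.
move=> /choice[f fP] G0 GP.
have fl : linear f.
  move=> a u v; apply/eqP; rewrite -subr_eq0; apply/eqP; apply: G0.
  have := GP (-1) _ _ _ _ (GP a _ _ _ _ (fP u) (fP v)) (fP (a *: u + v)).
  by rewrite !scaleN1r addNr [- _ + _]addrC.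
by exists (mklin fl) => v; exact: fP.
Qed.

Lemma quotient_module V (U : set V) : submodule U ->
  exists W (p : {linear V -> W}), onto p /\ forall v, p v = 0 <-> U v.
Proof.
move=> sU.
have [] := @module_of_setoid A V (fun u v => U (u - v)) 0 +%R -%R *:%R.
- by move=> s; rewrite subrr; apply: submod0.
- by move=> s t; rewrite -opprB => /(submodN sU); rewrite opprK.
- by move=> s t u h1 h2; have := submodD sU h1 h2; rewrite addrA subrK.
- by move=> s s' t t' h1 h2; have := submodD sU h1 h2; rewrite addrACA -opprD.
- by move=> a s s' h; have := submodZ a sU h; rewrite scalerBr.
- by move=> s t u; rewrite addrA subrr; apply: submod0.
- by move=> s t; rewrite [t + s]addrC subrr; apply: submod0.
- by move=> s; rewrite add0r subrr; apply: submod0.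
- by move=> s; rewrite addNr subrr; apply: submod0.
- by move=> a b s; rewrite scalerA subrr; apply: submod0.
- by move=> s; rewrite scale1r subrr; apply: submod0.
- by move=> a s t; rewrite scalerDr subrr; apply: submod0.
- by move=> a b s; rewrite scalerDl subrr; apply: submod0.
move=> W [p [po pE pD pZ]].
have pl : linear p by move=> a u v; rewrite pD pZ.
exists W, (mklin pl); split=> // v /=.
rewrite -[v in U v]subr0 -pE -(linear0 (mklin pl)) /=; split=> //.
Qed.

Lemma submodule_module V (U : set V) : submodule U ->
  exists W (i : {linear W -> V}), injective i /\ forall v, U v <-> exists w, i w = v.
Proof.
move=> sU.
pose S := {v | U v}; pose mk v (h : U v) : S := exist _ v h.
have [|||||||||||||] := @module_of_setoid A S (fun u v => sval u = sval v)
  (mk _ (submod0 sU)) (fun s t => mk _ (submodD sU (svalP s) (svalP t)))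
  (fun s => mk _ (submodN sU (svalP s))) (fun a s => mk _ (submodZ a sU (svalP s))) => //=.
- by move=> s t u -> ->.
- by move=> s s' t t' -> ->.
- by move=> a s s' ->.
- by move=> *; rewrite addrA.
- by move=> *; rewrite addrC.
- by move=> *; rewrite add0r.
- by move=> *; rewrite addNr.
- by move=> *; rewrite scalerA.
- by move=> *; rewrite scale1r.
- by move=> *; rewrite scalerDr.
- by move=> *; rewrite scalerDl.
move=> W [p [po pE pD pZ]].
have p0 : p (mk _ (submod0 sU)) = 0.
  apply: (addrI (p (mk _ (submod0 sU)))); rewrite [RHS]addr0 -pD.
  by apply/pE => /=; rewrite addr0.
have [] := @lin_of_graph W V (fun w v => exists2 s, p s = w & sval s = v).
- by move=> w; have [s <-] := po w; exists (sval s), s.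
- by move=> _ [s ps <-]; rewrite -p0 in ps; move/pE: ps.
- move=> a _ _ _ _ [s <- <-] [t <- <-].
  by exists (mk _ (submodD sU (svalP (mk _ (submodZ a sU (svalP s)))) (svalP t))); rewrite // -pZ -pD.
move=> i iP; exists W, i; split.
  move=> w w'; have [s <- <-] := iP w; have [t <- <-] := iP w'.
  by move=> h; apply/pE.
move=> v; split=> [Uv|[w <-]]; last by have [s _ <-] := iP w; exact: svalP.
by exists (p (mk v Uv)); have [s /pE /= sv <-] := iP (p (mk v Uv)).
Qed.

(** * Generators and chain conditions *)

Definition lincomb V n (v : 'I_n -> V) (c : 'I_n -> A) : V := \sum_i c i *: v i.

Definition spans V (U : set V) n (v : 'I_n -> V) :=
  forall x, U x <-> exists c, x = lincomb v c.

Lemma linear_comb_lincomb V n (v : 'I_n -> V) a c d :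
  a *: lincomb v c + lincomb v d = lincomb v (fun i => a * c i + d i).
Proof.
rewrite /lincomb scaler_sumr -big_split /=; apply: eq_bigr => i _.
by rewrite scalerDl scalerA.
Qed.

Lemma lincomb_delta V n (v : 'I_n -> V) i : lincomb v (fun j => (j == i)%:R) = v i.
Proof.
rewrite /lincomb (bigD1 i) //= eqxx scale1r big1 ?addr0 // => j /negbTE ->.
by rewrite scale0r.
Qed.

Lemma submodule_spans V (U : set V) n (v : 'I_n -> V) : spans U v -> submodule U.
Proof.
move=> sp; split.
  by apply/sp; exists (fun=> 0); rewrite /lincomb big1 // => i _; rewrite scale0r.
move=> a u w /sp[c ->] /sp[d ->]; apply/sp.
by exists (fun i => a * c i + d i); rewrite linear_comb_lincomb.
Qed.

Lemma spans_mem V (U : set V) n (v : 'I_n -> V) i : spans U v -> U (v i).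
Proof. by move=> sp; apply/sp; exists (fun j => (j == i)%:R); rewrite lincomb_delta. Qed.

Lemma comb_linear V n (v : 'I_n -> V) :
  linear (fun x : 'rV[A]_n => lincomb v (x 0)).
Proof.
by move=> a x y; rewrite linear_comb_lincomb; apply: eq_bigr => i _; rewrite !mxE.
Qed.
Definition comb V n (v : 'I_n -> V) := mklin (comb_linear v).

Lemma combE V n (v : 'I_n -> V) (c : 'I_n -> A) : comb v (\row_i c i) = lincomb v c.
Proof. by rewrite /= /lincomb; apply: eq_bigr => i _; rewrite mxE. Qed.

Lemma row_comb n (x : 'rV[A]_n) : x = lincomb (fun i => delta_mx 0 i) (x 0).
Proof. by rewrite /lincomb -row_sum_delta. Qed.

Lemma linear_lincomb V W (f : {linear V -> W}) n (v : 'I_n -> V) c :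
  f (lincomb v c) = lincomb (f \o v) c.
Proof. by rewrite /lincomb linear_sum; apply: eq_bigr => i _; rewrite linearZ. Qed.

Lemma fgP V : finitely_generated V <-> exists n (v : 'I_n -> V), spans setT v.
Proof.
split=> [[n [f fo]]|[n [v sp]]].
  exists n, (fun i => f (delta_mx 0 i)) => x; split=> // _.
  have [y <-] := fo x; exists (y 0).
  by rewrite {1}(row_comb y) linear_lincomb.
exists n, (comb v) => y; have /sp[c ->] : setT y by [].
by exists (\row_i c i); rewrite combE.
Qed.

Lemma spans_onto V W (f : {linear V -> W}) (U : set V) n (v : 'I_n -> V) :
  spans U v -> spans [set y | exists2 x, U x & f x = y] (f \o v).
Proof.
move=> sp y; split=> [[x /sp[c ->] <-]|[c ->]]; first by exists c; rewrite linear_lincomb.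
by exists (lincomb v c); [apply/sp; exists c | rewrite linear_lincomb].
Qed.

Lemma fg_onto V W (f : {linear V -> W}) :
  onto f -> finitely_generated V -> finitely_generated W.
Proof.
move=> fo /fgP[n [v sp]]; apply/fgP; exists n, (f \o v) => y.
rewrite -(spans_onto f sp); split=> // _; have [x <-] := fo y; by exists x.
Qed.

(** The flag selects the order, so that ascending (true) and descending (false)
chain conditions are proved together. *)
Definition sub_le (up : bool) V (U W : set V) := if up then U `<=` W else W `<=` U.

(** The chain condition for the submodules contained in K, as the existence of
extremal elements; relative to K in order to be proved along a filtration of V
without forming subquotients. *)
Definition chain_cond (up : bool) V (K : set V) :=
  forall F : set (set V), (exists U, F U) ->
    (forall U, F U -> submodule U /\ U `<=` K) ->
    exists U, F U /\ forall X, F X -> sub_le up U X -> X = U.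

Lemma chain_condS up V (K K' : set V) : K `<=` K' -> chain_cond up K' -> chain_cond up K.
Proof.
move=> KK' h F F0 FP; apply: h => // U FU.
by have [? UK] := FP U FU; split=> // x /UK /KK'.
Qed.

Lemma chain_cond0 up V : chain_cond up [set (0 : V)].
Proof.
have E (U : set V) : submodule U /\ U `<=` [set 0] -> U = [set 0].
  by case=> sU U0; apply/seteqP; split=> // _ ->; apply: submod0.
move=> F [U FU] FP; exists U; split=> // W FW _.
by rewrite (E _ (FP _ FU)) (E _ (FP _ FW)).
Qed.

Lemma sub_le_mono up V W (phi : set V -> set W) (X Y : set V) :
  (forall X Y, X `<=` Y -> phi X `<=` phi Y) -> sub_le up X Y -> sub_le up (phi X) (phi Y).
Proof. by case: up => phiS; apply: phiS. Qed.

(** Comparable submodules of K agree when their images under f and their traces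
on the kernel of f agree; so extremise the image first and then the trace. *)
Lemma chain_cond_ext up V W (f : {linear V -> W}) (K : set V) :
  chain_cond up (K `&` [set x | f x = 0]) ->
  chain_cond up [set y | exists2 x, K x & f x = y] -> chain_cond up K.
Proof.
move=> hK hI F [U FU] FP.
pose im (X : set V) : set W := [set y | exists2 x, X x & f x = y].
pose ke (X : set V) := X `&` [set x | f x = 0].
have [||I0 [[U0 FU0 <-] maxI]] := hI [set im X | X in F].
- by exists (im U), U.
- move=> _ [X FX <-]; have [sX XK] := FP _ FX; split; first exact: submodule_im.
  by move=> _ [x Xx <-]; exists x => //; apply: XK.
have [||K0 [[U1 [FU1 I1 <-]] maxK]] := hK [set X | exists Y, [/\ F Y, im Y = im U0 & ke Y = X]].
- by exists (ke U0), U0.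
- move=> _ [Y [FY _ <-]]; have [sY YK] := FP _ FY; split.
    exact: submodule_setI sY (submodule_ker f).
  by move=> x [/YK].
have modular (X Y : set V) : F X -> F Y -> X `<=` Y -> im X = im Y ->
    ke X = ke Y -> X = Y.
  move=> FX FY XY IE KE; apply/seteqP; split=> // y Yy.
  have [sX _] := FP _ FX; have [sY _] := FP _ FY.
  have : im Y (f y) by exists y.
  rewrite -IE => -[x Xx fxy].
  have : ke Y (y - x).
    by split; [apply: submodB => //; apply: XY | rewrite /= linearB fxy subrr].
  by rewrite -KE => -[h _]; rewrite -[y](subrK x); apply: submodD.
exists U1; split=> // X FX leX.
have IX : im X = im U0.
  apply: maxI; first by exists X.
  by rewrite -I1; apply: sub_le_mono leX => X' Y' s y [x /s]; exists x.
have KX : ke X = ke U1.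
  by apply: maxK; [exists X | apply: sub_le_mono leX => X' Y' s y [/s]].
by case: up leX {hI hK maxI maxK} => /= leX; [apply/esym |]; apply: modular; rewrite // IX.
Qed.

Lemma chain_cond_line up V (v : V) :
  (forall F : set (set A^o), (exists I, F I) ->
    (forall I, F I -> submodule I /\ forall c, c *: v = 0 -> I c) ->
    exists I, F I /\ forall J, F J -> sub_le up I J -> J = I) ->
  chain_cond up (line v).
Proof.
move=> hI F [U FU] FP; pose I (U : set V) : set A^o := [set c | U (c *: v)].
have [||I0 [[U0 FU0 <-] maxI]] := hI [set I X | X in F].
- by exists (I U), U.
- move=> _ [X FX <-]; have [sX _] := FP _ FX; split; last first.
    by move=> c cv; rewrite /I /= cv; apply: submod0.
  split; first by rewrite /I /= scale0r; apply: submod0.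
  by move=> a x y h h'; rewrite /I /= scalerDl -scalerA; apply: (proj2 sX).
exists U0; split=> // X FX leX.
have IE : I X = I U0.
  by apply: maxI; [exists X | apply: sub_le_mono leX => X' Y' s c; apply: s].
have XE Y Z : F Y -> I Y = I Z -> Y `<=` Z.
  move=> FY YZ y Yy; have [c yE] := (FP _ FY).2 _ Yy.
  by rewrite yE; have : I Y c; [rewrite /I /= -yE | rewrite YZ].
by apply/seteqP; split; apply: XE.
Qed.

(** K + A v is an extension of a cyclic module by K, and the submodules of A v
modulo K correspond to the ideals containing the c with c v in K. *)
Lemma chain_cond_step up V (K K' : set V) v :
  submodule K ->
  (forall x, K' x -> exists c y, K y /\ x = y + c *: v) ->
  (forall F : set (set A^o), (exists I, F I) ->
    (forall I, F I -> submodule I /\ forall c, K (c *: v) -> I c) ->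
    exists I, F I /\ forall J, F J -> sub_le up I J -> J = I) ->
  chain_cond up K -> chain_cond up K'.
Proof.
move=> sK K'E hI hK; have [W [p [_ pK]]] := quotient_module sK.
apply: (chain_cond_ext (f := p)).
  by apply: chain_condS hK => x [_ /pK].
apply: (@chain_condS _ _ _ (line (p v))).
  move=> _ [x /K'E[c [y [/pK py ->]]] <-].
  by exists c; rewrite linearD py add0r linearZ.
apply: chain_cond_line => F F0 FP; apply: hI => // I /FP[sI hI]; split=> // c Kc.
by apply: hI; rewrite -linearZ; apply/pK.
Qed.

(** Only ideals containing the annihilator of K are tested, which makes the
lemma applicable to a vector space over a residue field of A. *)
Lemma spans_chain up V (K : set V) n (v : 'I_n -> V) :
  (forall F : set (set A^o), (exists I, F I) ->
    (forall I, F I -> submodule I /\ forall c, (forall x, K x -> c *: x = 0) -> I c) ->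
    exists I, F I /\ forall J, F J -> sub_le up I J -> J = I) ->
  spans K v -> chain_cond up K.
Proof.
elim: n v K => [|n IH] v K hA sp.
  apply: chain_condS (@chain_cond0 up V) => x /sp[c ->].
  by rewrite /lincomb big_ord0.
pose v' := v \o widen_ord (leqnSn n).
pose K0 : set V := [set x | exists c, x = lincomb v' c].
have sp0 : spans K0 v' by [].
have K0K x : K0 x -> K x.
  case=> c ->; apply: submod_sum (submodule_spans sp) _ => i _.
  by apply: submodZ (submodule_spans sp) _; exact: (spans_mem (widen_ord (leqnSn n) i) sp).
apply: (@chain_cond_step up V K0 K (v ord_max) (submodule_spans sp0)).
- move=> x /sp[c ->]; exists (c ord_max), (lincomb v' (c \o widen_ord (leqnSn n))).
  by split; [exists (c \o widen_ord (leqnSn n)) | rewrite /lincomb big_ord_recr].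
- move=> F F0 FP; apply: hA => // I /FP[sI hI]; split=> // c cK.
  by apply: hI; rewrite (cK _ (spans_mem ord_max sp)); apply: submod0 (submodule_spans sp0).
apply: IH sp0 => F F0 FP; apply: hA => // I /FP[sI hI]; split=> // c cK.
by apply: hI => x /K0K; apply: cK.
Qed.

Lemma fg_chain up V : chain_cond up [set: A^o] -> finitely_generated V ->
  chain_cond up [set: V].
Proof.
move=> hA /fgP[n [v sp]]; apply: spans_chain sp => F F0 FP.
by apply: hA => // I /FP[].
Qed.

Lemma lincomb_extend V n (v : 'I_n -> V) u : exists v' : 'I_(n + 1) -> V,
  (forall c d, exists c', lincomb v' c' = lincomb v c + d *: u) /\
  (forall c', exists c d, lincomb v' c' = lincomb v c + d *: u).
Proof.
pose v' (i : 'I_(n + 1)) := match fintype.split i with inl j => v j | inr _ => u end.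
have lE c : lincomb v' c = lincomb v (c \o lshift 1) + c (rshift n ord0) *: u.
  rewrite /lincomb big_split_ord /= big_ord1; congr (_ + _).
    by apply: eq_bigr => i _; rewrite /v' (unsplitK (inl i)).
  by rewrite /v' (unsplitK (inr ord0)).
exists v'; split=> [c d|c']; last by rewrite lE; do 2!eexists.
exists (fun i => match fintype.split i with inl j => c j | inr _ => d end).
rewrite lE; congr (_ + _ *: _); last by rewrite (unsplitK (inr ord0)).
by apply: eq_bigr => i _; rewrite /= (unsplitK (inl i)).
Qed.

Lemma acc_finite_span V (U : set V) : chain_cond true U -> submodule U ->
  exists n (v : 'I_n -> V), spans U v.
Proof.
move=> acc sU.
have [||K [[[n [v sp]] KU] maxK]] := acc [set K | (exists n (v : 'I_n -> V), spans K v) /\ K `<=` U].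
- exists [set 0]; split; last by move=> _ ->; apply: submod0.
  exists 0%N, (fun=> 0) => x; rewrite /lincomb; split=> [->|[c ->]].
    by exists (fun=> 0); rewrite big_ord0.
  by rewrite big_ord0.
- by move=> K [[n [v sp]] KU]; split=> //; apply: submodule_spans sp.
exists n, v; suff -> : U = K by [].
apply/seteqP; split=> // u Uu.
have [v' [v'1 v'2]] := lincomb_extend v u.
pose K' : set V := [set x | exists c, x = lincomb v' c].
have <- : K' = K.
  apply: maxK; last first.
    move=> x /sp[c ->]; have [c' E] := v'1 c 0.
    by exists c'; rewrite E scale0r addr0.
  split; first by exists (n + 1)%N, v'.
  move=> _ [c' ->]; have [c [d ->]] := v'2 c'; apply: submodD => //; last exact: submodZ.
  by apply: KU; apply/sp; exists c.
have [c' E] := v'1 (fun=> 0) 1; exists c'.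
by rewrite E scale1r /lincomb big1 ?add0r // => i _; rewrite scale0r.
Qed.

(** Zorn's lemma for submodules subject to an elementwise condition: such a
condition passes to unions of chains. *)
Lemma zorn_submodule V (U0 : set V) (p : V -> Prop) :
  submodule U0 -> U0 `<=` p ->
  exists U, [/\ submodule U, U0 `<=` U, U `<=` p &
    forall X, submodule X -> U `<=` X -> X `<=` p -> X = U].
Proof.
move=> sU0 U0p.
pose Q (X : set V) := [/\ submodule X, U0 `<=` X & X `<=` p].
have [|U [[-> | [sU U0U Up]] maxU]] := @Zorn_bigcup V (fun X => X = set0 \/ Q X).
- move=> F FQ Ft; have [[X [FX QX]]|noQ] := pselect (exists X, F X /\ Q X); last first.
    left; apply/seteqP; split=> // x [X FX Xx].
    by case: (FQ _ FX) => [X0|QX]; [rewrite X0 in Xx | case: noQ; exists X].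
  have FQ' Y y : F Y -> Y y -> Q Y by move=> /FQ[->|].
  right; split; last by move=> x [Y FY Yx]; have [_ _] := FQ' _ _ FY Yx; exact.
  + split; first by exists X => //; case: QX => -[].
    move=> a u v [Y FY Yu] [Z FZ Zv].
    have [sY _ _] := FQ' _ _ FY Yu; have [sZ _ _] := FQ' _ _ FZ Zv.
    case: (Ft _ _ FY FZ) => [YZ|ZY].
      by exists Z => //; apply: (proj2 sZ) => //; apply: YZ.
    by exists Y => //; apply: (proj2 sY) => //; apply: ZY.
  + by move=> x U0x; exists X => //; case: QX => _ + _; apply.
- have U00 : U0 0 by apply: submod0.
  have : set0 `<` U0 by split=> // /(_ 0 U00).
  by move=> /maxU[]; right; split.
exists U; split=> // X sX UX Xp; apply: contrapT => XU; apply: (maxU X).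
  by split=> // XU'; apply: XU; apply/seteqP.
by right; split=> // x /U0U /UX.
Qed.

End Basics.

(** * Artinian commutative rings are noetherian *)

Lemma artinian_dcc (A : nzRingType) : artinian_ring A -> chain_cond false [set: A^o].
Proof.
move=> art F [U0 FU0] FP; apply: contrapT => noMin.
have /choice[g gP] (U : set A^o) : exists W, F U -> [/\ F W, W `<=` U & W <> U].
  apply: contrapT => noW; apply: noMin; exists U.
  split=> [|W FW WU]; first by apply: contrapT => nFU; apply: noW; exists U.
  by apply: contrapT => WnU; apply: noW; exists W.
pose s n := iter n g U0.
have Fs n : F (s n) by elim: n => //= n /gP[].
have [|n|n /(_ n.+1 (leqnSn n))] := art s; first by move=> n; case: (FP _ (Fs n)).
  by case: (gP _ (Fs n)).
by case: (gP _ (Fs n)).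
Qed.

Section Hopkins.
Variable k : comNzRingType.
Hypothesis dcc : chain_cond false [set: k^o].

Let mul (a : k) : {linear k^o -> k^o} :=
  @mklin k k^o k^o (fun x => a * x) (fun c x y => etrans (mulrDr _ _ _)
   (congr1 (fun z => z + a * y) (mulrCA _ _ _))).

(** Take an ideal K minimal among those without the ascending chain condition.
Each a acts on K either as 0 or surjectively, otherwise K would be an extension
of two smaller ideals.  So the annihilator p of K is maximal, K is a vector
space over k / p, and the descending chain condition bounds its dimension. *)
Lemma artinian_noetherian : chain_cond true [set: k^o].
Proof.
apply: contrapT => nacc.
have [||K [[sK nK] minK]] := dcc (F := [set K | submodule K /\ ~ chain_cond true K]).
- by exists setT.
- by move=> K [].
have accS (U : set k^o) : submodule U -> U `<=` K -> U <> K -> chain_cond true U.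
  by move=> sU UK UnK; apply: contrapT => nU; apply: UnK; apply: minK.
(* by minimality of K: if a K and the kernel of a are both proper, both are noetherian *)
have act (a : k) : (forall x, K x -> a * x = 0) \/
    (forall y, K y -> exists2 x, K x & a * x = y).
  pose im := [set y | exists2 x, K x & mul a x = y].
  have imK : im `<=` K.
    by move=> _ [x Kx <-]; apply: (@submodZ _ _ K a x).
  have [imE|imE] := pselect (im = K); first by right=> y; rewrite -[in K y]imE.
  have [keE|keE] := pselect (K `&` [set x | mul a x = 0] = K).
    by left=> x; rewrite -{1}keE => -[].
  case: nK; apply: (chain_cond_ext (f := mul a)).
    by apply: (accS _ (submodule_setI sK (submodule_ker _)) _ keE) => x [].
  by apply: accS => //; exact: (submodule_im (mul a) sK).
pose p : set k := [set a | forall x, K x -> a * x = 0].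
(* a descending chain of powers of a, none of which kills K, inverts a modulo p *)
have pinv (a : k) : ~ p a -> exists b, p (1 - b * a).
  move=> npa; have aK : forall y, K y -> exists2 x, K x & a * x = y by case: (act a).
  have [||I [[n _ <-] minI]] := dcc (F := [set line (a ^+ n : k^o) | n in [set: nat]]).
  - by exists (line (a ^+ 0 : k^o)), 0%N.
  - by move=> _ [n _ <-]; split=> //; apply: submodule_line.
  have [b ab] : line (a ^+ n.+1 : k^o) (a ^+ n).
    rewrite (minI (line (a ^+ n.+1 : k^o))); first by exists 1; rewrite scale1r.
      by exists n.+1.
    by move=> _ [c ->]; exists (c * a); rewrite /GRing.scale /= exprS mulrA.
  have anK m y : K y -> exists2 x, K x & a ^+ m * x = y.
    elim: m y => [|m IH] y Ky; first by exists y; rewrite ?expr0 ?mul1r.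
    have [x Kx <-] := aK y Ky; have [z Kz <-] := IH x Kx.
    by exists z => //; rewrite exprS mulrA.
  exists b => y /(anK n)[x Kx <-]; rewrite mulrA mulrBl mul1r.
  move: ab; rewrite /GRing.scale /= exprS mulrA => <-; by rewrite subrr mul0r.
(* a minimal U of finite codimension in K must be 0: a non-zero u in U has a complement X in U *)
pose cof (U : set k^o) := exists n (v : 'I_n -> k^o), (forall i, K (v i)) /\
  forall x, K x -> exists u c, U u /\ x = u + lincomb v c.
have [||U [[sU UK [n [v [Kv Uv]]]] minU]] := dcc (F := [set U | [/\ submodule U, U `<=` K & cof U]]).
- exists K; split=> //; exists 0%N, (fun=> 0); split=> [[]//|x Kx]; exists x, (fun=> 0).
  by rewrite /lincomb big_ord0 addr0.
- by move=> U [].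
have [[u Uu un0]|Un0] := pselect (exists2 u, U u & u <> 0); last first.
  have {}Un0 u : U u -> u = 0 by move=> Uu; apply: contrapT => un0; apply: Un0; exists u.
  apply: nK; apply: (@spans_chain _ _ _ _ _ v).
    move=> F [I0 FI0] FP.
    have FpT I : F I -> I = p \/ I = setT.
      move=> FI; have [sI pI] := FP _ FI.
      have [Ip|/existsNP[c /not_implyP[Ic npc]]] := pselect (I `<=` p).
        by left; apply/seteqP.
      right; apply/seteqP; split=> // x _.
      have [b pb] := pinv c npc.
      have I1 : I (1 : k).
        by rewrite -[X in I X](subrK (b * c)); apply: (@submodD _ _ I _ _ sI); [apply: pI | apply: (submodZ b sI)].
      by rewrite -[x]mulr1; apply: (submodZ x sI I1).
    have [FT|FnT] := pselect (F setT); last first.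
      exists I0; split=> // J FJ _.
      have nT I : F I -> I = p by move=> FI; case: (FpT _ FI) => // E; case: FnT; rewrite -E.
      by rewrite (nT _ FI0) (nT _ FJ).
    by exists setT; split=> // J FJ TJ; apply/seteqP; split=> // x _; apply: TJ.
  move=> x; split=> [/Uv[y [c [/Un0-> ->]]]|[c ->]]; first by exists c; rewrite add0r.
  by apply: submod_sum => // i _; apply: submodZ.
have [|X [sX _ Xu maxX]] := zorn_submodule (p := fun x => U x /\ x <> u) (submodule_set0 _).
  by move=> _ ->; split; [apply: submod0 | apply/nesym].
have XU : X `<=` U by move=> x /Xu[].
have UX w : U w -> exists c, X (w - c *: u).
  move=> Uw; have [Xw|nXw] := pselect (X w); first by exists 0; rewrite scale0r subr0.
  have [x [_ [Xx [c ->] xcw]]] : (sumset X (line w)) u.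
    apply: contrapT => nu; apply: nXw; rewrite -(maxX (sumset X (line w))).
    - exact: sumset_r (line_mem w).
    - exact: submodule_sum_line.
    - exact: sumset_l (submodule_line w).
    - move=> y Xwy; split; last by move=> yu; rewrite yu in Xwy.
      by case: Xwy => x [_ [Xx [c ->] ->]]; apply: submodD => //; [apply: XU | apply: submodZ].
  have npc : ~ p c.
    by move=> pc; have [] := Xu _ Xx; rewrite xcw /GRing.scale /= (pc w (UK _ Uw)) addr0.
  have [b pb] := pinv c npc; exists b.
  have -> : w - b *: u = - (b *: x).
    rewrite xcw scalerDr opprD addrCA scalerA /GRing.scale /=.
    by rewrite -{1}[w in w - _]mul1r -mulrBl (pb _ (UK _ Uw)) addr0.
  by apply: submodN => //; apply: submodZ.
have [Xu' _] : X `<=` U /\ ~ X u by split=> // /Xu[].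
have XE : X = U; last by rewrite -XE in Uu; case: (Xu _ Uu).
apply: minU => //; split=> //; first by move=> x /XU /UK.
have [v' [v'1 v'2]] := lincomb_extend v u.
exists (n + 1)%N, v'; split.
  move=> i; rewrite -(lincomb_delta v' i); have [c [d ->]] := v'2 (fun j => (j == i)%:R).
  apply: submodD => //; last by apply: submodZ => //; apply: UK.
  by apply: submod_sum => // j _; apply: submodZ.
move=> x /Uv[w [c [Uw ->]]]; have [d Xd] := UX _ Uw.
have [c' E] := v'1 c d; exists (w - d *: u), c'; split=> //.
by rewrite E [lincomb v c + _]addrC addrA subrK.
Qed.

End Hopkins.

(** * Restriction of scalars and chain conditions over algebras *)

(** An alias, so that a module and its restriction along [io] share their
elements. *)
Definition kmod (k A : nzRingType) (io : {rmorphism k -> A}) (V : lmodType A) : Type := V.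

Section Kmod.
Variables (k A : nzRingType) (io : {rmorphism k -> A}) (V : lmodType A).
HB.instance Definition _ := GRing.Zmodule.on (kmod io V).
Let sc (c : k) (v : kmod io V) : kmod io V := io c *: (v : V).
Fact kmod_scaleA a b v : sc a (sc b v) = sc (a * b) v.
Proof. by rewrite /sc scalerA rmorphM. Qed.
Fact kmod_scale1 : left_id 1 sc.
Proof. by move=> v; rewrite /sc rmorph1 scale1r. Qed.
Fact kmod_scaleDr : right_distributive sc +%R.
Proof. by move=> c u v; rewrite /sc scalerDr. Qed.
Fact kmod_scaleDl v : {morph sc^~ v : a b / a + b}.
Proof. by move=> a b; rewrite /sc rmorphD scalerDl. Qed.
HB.instance Definition _ := GRing.Zmodule_isLmodule.Build k (kmod io V)
  kmod_scaleA kmod_scale1 kmod_scaleDr kmod_scaleDl.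
Lemma kmodE (c : k) (v : kmod io V) : c *: v = io c *: (v : V). Proof. by []. Qed.
End Kmod.

Definition chain_ring (A : nzRingType) :=
  forall up (V : lmodType A), finitely_generated V -> chain_cond up [set: V].

Definition fg_algebra (k A : nzRingType) (io : {rmorphism k -> A}) :=
  exists n (g : 'I_n -> A), forall a, exists c : 'I_n -> k, a = \sum_i io (c i) * g i.

Section ChainAlgebras.
Variables (k A : nzRingType) (io : {rmorphism k -> A}).

Lemma submodule_kmod (V : lmodType A) (U : set V) :
  submodule U -> @submodule k (kmod io V) U.
Proof. by move=> [U0 UP]; split=> // c u v Uu Uv; apply: UP. Qed.

Lemma chain_cond_kmod up (V : lmodType A) :
  @chain_cond k up (kmod io V) setT -> chain_cond up [set: V].
Proof.
by move=> h F F0 FP; apply: h => // U /FP[sU _]; split=> //; apply: submodule_kmod.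
Qed.

Lemma fg_kmod (V : lmodType A) : fg_algebra io -> finitely_generated V ->
  finitely_generated (kmod io V).
Proof.
move=> [m [g gP]] /fgP[n [v sp]].
pose w (e : 'I_(#|{: 'I_n * 'I_m}|)) : kmod io V :=
  let ij := enum_val e in g ij.2 *: v ij.1.
pose W : set (kmod io V) := [set x | exists c, x = lincomb w c].
have sW : submodule W by apply: (@submodule_spans _ _ _ _ w).
apply/fgP; exists #|{: 'I_n * 'I_m}|, w => x; split=> // _.
have /sp[c ->] : [set: V] x by [].
apply: (@submod_sum _ _ _ _ _ _ (fun i => c i *: v i : kmod io V) sW) => i _.
have [d ->] := gP (c i); rewrite scaler_suml.
apply: (@submod_sum _ _ _ _ _ _ (fun j => (io (d j) * g j) *: v i : kmod io V) sW) => j _.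
rewrite -scalerA; apply: (@submodZ _ _ _ (d j) (g j *: v i : kmod io V) sW).
have -> : g j *: v i = w (enum_rank (i, j)) by rewrite /w enum_rankK.
exact: (@spans_mem _ _ _ _ w).
Qed.

End ChainAlgebras.

Lemma chain_ring_k (k : comNzRingType) : artinian_ring k -> chain_ring k.
Proof.
move=> /artinian_dcc dcc [] V; apply: fg_chain => //.
exact: artinian_noetherian.
Qed.

Lemma chain_ring_alg (k : comNzRingType) (A : nzRingType) (io : {rmorphism k -> A}) :
  artinian_ring k -> fg_algebra io -> chain_ring A.
Proof.
move=> ak fA up V fgV; apply: (chain_cond_kmod (io := io)).
by apply: chain_ring_k => //; apply: fg_kmod.
Qed.

(** * Projective modules and presentations over hereditary rings *)

Section Presentations.
Variable A : nzRingType.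
Implicit Types (V W X Y Z P Q K L : lmodType A).

Lemma factor_mono V W X (i : {linear W -> V}) (f : {linear X -> V}) :
  injective i -> (forall x, exists w, i w = f x) ->
  exists g : {linear X -> W}, forall x, i (g x) = f x.
Proof.
move=> ii fi; have [] // := @lin_of_graph A X W (fun x w => i w = f x).
- by move=> w; rewrite linear0 -(linear0 i) => /ii.
- by move=> a u v w w' E E'; rewrite !linearP E E'.
by move=> g gP; exists g.
Qed.

Lemma factor_epi V W X (p : {linear V -> W}) (f : {linear V -> X}) :
  onto p -> (forall v, p v = 0 -> f v = 0) ->
  exists g : {linear W -> X}, forall v, g (p v) = f v.
Proof.
move=> po pf; have [] := @lin_of_graph A W X (fun w x => exists2 v, p v = w & f v = x).
- by move=> w; have [v <-] := po w; exists (f v), v.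
- by move=> x [v /pf + <-].
- by move=> a _ _ _ _ [v <- <-] [v' <- <-]; exists (a *: v + v'); rewrite linearP.
move=> g gP; exists g => v; have [v' pv <-] := gP (p v).
by apply/eqP; rewrite -subr_eq0 -linearB; apply/eqP/pf; rewrite linearB pv subrr.
Qed.

Lemma inj_ker V W (f : {linear V -> W}) : (forall v, f v = 0 -> v = 0) -> injective f.
Proof.
move=> h u v E; apply/eqP; rewrite -subr_eq0; apply/eqP/h.
by rewrite linearB E subrr.
Qed.

Lemma dual_basis P : projective_module P -> finitely_generated P ->
  exists n (x : 'I_n -> P) (phi : 'I_n -> {linear P -> A^o}),
    forall y, y = \sum_i (phi i y : A) *: x i.
Proof.
move=> prP [n [f fo]].
have [g gP] := prP _ _ f (idfun : {linear P -> P}) fo.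
have pl (i : 'I_n) : linear (fun y => g y 0 i : A^o).
  by move=> a u v; rewrite linearP !mxE.
exists n, (fun i => f (delta_mx 0 i)), (fun i => mklin (pl i)) => y.
by rewrite -{1}[y]gP {1}(row_comb (g y)) linear_lincomb.
Qed.

Lemma dual_basis_projective P n (x : 'I_n -> P) (phi : 'I_n -> {linear P -> A^o}) :
  (forall y, y = \sum_i (phi i y : A) *: x i) ->
  projective_module P /\ finitely_generated P.
Proof.
move=> xP; split.
  move=> X Y f h fo; have /choice[v vP] (i : 'I_n) := fo (h (x i)).
  have gl : linear (fun y => lincomb v (fun i => phi i y : A)).
    by move=> a u w; rewrite linear_comb_lincomb; apply: eq_bigr => i _; rewrite linearP.
  exists (mklin gl) => y; rewrite {2}(xP y) /= linear_lincomb linear_sum.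
  by apply: eq_bigr => i _; rewrite /= vP linearZ.
by apply/fgP; exists n, x => y; split=> // _; exists (fun i => phi i y : A); exact: xP.
Qed.

Lemma retract_projective P Q (f : {linear P -> Q}) (g : {linear Q -> P}) :
  (forall x, g (f x) = x) -> projective_module Q -> projective_module P.
Proof.
move=> gf prQ X Y h u ho; have [w wP] := prQ _ _ h (u \o g : {linear Q -> Y}) ho.
by exists (w \o f : {linear P -> X}) => x /=; rewrite wP /= gf.
Qed.

Lemma projective_split P X (f : {linear X -> P}) :
  projective_module P -> onto f -> exists s : {linear P -> X}, forall x, f (s x) = x.
Proof. by move=> prP fo; apply: (prP _ _ f (idfun : {linear P -> P})). Qed.

Hypothesis her : ideals_projective A.

(** The last form maps X onto an ideal, which is projective; so X splits as that
ideal plus a kernel on which one form fewer separates points. *)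
Lemma torsionless_projective n X (f : 'I_n -> {linear X -> A^o}) :
  (forall x, (forall i, f i x = 0) -> x = 0) -> projective_module X.
Proof.
elim: n X f => [|n IH] X f f0.
  have X0 (x : X) : x = 0 by apply: f0 => -[].
  move=> Y Z g h go; exists (\0 : {linear X -> Y}) => x /=.
  by rewrite linear0 (X0 x) linear0.
have [W [i [ii iP]]] := submodule_module (submodule_im (f ord_max) (submodule_setT X)).
have [|q qP] := factor_mono (f := f ord_max) ii; first by move=> x; apply/iP; exists x.
have qo : onto q.
  by move=> w; have /iP[x _ E] : exists w', i w' = i w; [exists w | exists x; apply: ii; rewrite qP].
have [s sP] := projective_split (her ii) qo.
have [K [j [ji jP]]] := submodule_module (submodule_ker q).
have prK : projective_module K.
  apply: (IH _ (fun l => f (widen_ord (leqnSn n) l) \o j : {linear K -> A^o})) => x xP.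
  apply: ji; rewrite linear0; apply: f0 => l.
  have [->|ln] := eqVneq l ord_max; first by rewrite -qP (_ : q _ = 0) ?linear0 //; apply/jP; exists x.
  have l_lt : (l < n)%N.
    by have := ltn_ord l; rewrite ltnS leq_eqVlt => /orP[/eqP E|//]; case/eqP: ln; apply: val_inj.
  by rewrite -(xP (Ordinal l_lt)) /=; congr (f _ _); apply: val_inj.
have rl : linear (fun x => x - s (q x)).
  by move=> a u v /=; rewrite (linearP q) (linearP s) opprD addrACA scalerBr.
have [|r rP] := factor_mono (f := mklin rl) ji.
  by move=> x; apply/jP; rewrite /= linearB sP subrr.
move=> Y Z g h go.
have [a aP] := (her ii : projective_module W) _ _ g (h \o s : {linear W -> Z}) go.
have [b bP] := prK _ _ g (h \o j : {linear K -> Z}) go.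
exists ((a \o q) \+ (b \o r) : {linear X -> Y}) => x /=.
by rewrite linearD aP bP /= rP -linearD /= addrC subrK.
Qed.

Lemma sub_free_projective n X (i : {linear X -> 'rV[A]_n}) :
  injective i -> projective_module X.
Proof.
move=> ii; have pl (j : 'I_n) : linear (fun y => i y 0 j : A^o).
  by move=> a u v; rewrite linearP !mxE.
apply: (torsionless_projective (f := fun j => mklin (pl j))) => x xP.
by apply: ii; rewrite linear0; apply/rowP => j; rewrite mxE; apply: xP.
Qed.

Lemma projective_sub P X (i : {linear X -> P}) :
  projective_module P -> finitely_generated P -> injective i -> projective_module X.
Proof.
move=> prP [n [f fo]] ii; have [s sP] := projective_split prP fo.
apply: (sub_free_projective (i := s \o i : {linear X -> 'rV[A]_n})) => x y /= E.
by apply: ii; rewrite -(sP (i x)) E sP.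
Qed.

Hypothesis cA : chain_ring A.

Lemma fg_sub V W (i : {linear W -> V}) : injective i ->
  finitely_generated V -> finitely_generated W.
Proof.
move=> ii fgV.
have sI := submodule_im i (submodule_setT W).
have [] := @acc_finite_span _ V _ _ sI; first exact: (chain_condS (K' := setT) _ (cA true fgV)).
move=> n [v sp]; have /choice[w wP] (l : 'I_n) : exists w, i w = v l.
  by have [w _ <-] := spans_mem l sp; exists w.
apply/fgP; exists n, w => x; split=> // _.
have /sp[c E] : [set y | exists2 x, setT x & i x = y] (i x) by exists x.
exists c; apply: ii; rewrite linear_lincomb E; apply: eq_bigr => l _ /=.
by rewrite wP.
Qed.

Lemma fg_presented X : finitely_generated X -> finitely_presented X.
Proof.
move=> [n [f fo]].
have [K [j [ji jP]]] := submodule_module (submodule_ker f).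
have fgV : finitely_generated 'rV[A]_n by exists n, idfun => x; exists x.
have [m [g go]] := fg_sub ji fgV.
exists m, n, (j \o g : {linear _ -> _}), f; split=> // x; split.
  by move=> /jP[w <-]; have [y <-] := go w; exists y.
by move=> [y <-] /=; apply/jP; exists (g y).
Qed.

Definition presentation X P1 P0 (p1 : {linear P1 -> P0}) (p0 : {linear P0 -> X}) :=
  [/\ projective_module P1, projective_module P0, finitely_generated P1,
      finitely_generated P0 & short_exact p1 p0].

(** A submodule of a free module is projective, so a submodule minimal among
those still mapping onto X is a projective cover of X. *)
Lemma min_presentation X : finitely_generated X ->
  exists P1 P0 (p1 : {linear P1 -> P0}) (p0 : {linear P0 -> X}),
    presentation p1 p0 /\ superfluous [set x | p0 x = 0].
Proof.
move=> [n [f fo]].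
have fgV : finitely_generated 'rV[A]_n by exists n, idfun => x; exists x.
have [||U [[sU Uo] minU]] := cA false fgV
  (F := [set U | submodule U /\ forall x, exists2 u, U u & f u = x]).
- by exists setT; split=> // x; have [u] := fo x; exists u.
- by move=> U [].
have [P0 [i [ii iP]]] := submodule_module sU.
pose p0 : {linear P0 -> X} := f \o i.
have [P1 [j [ji jP]]] := submodule_module (submodule_ker p0).
have fg0 := fg_sub ii fgV.
have pr0 := sub_free_projective ii.
exists P1, P0, j, p0; split.
  split=> //; first exact: projective_sub ji.
    exact: fg_sub ji fg0.
  split=> // x; have [_ /iP[w <-] <-] := Uo x; by exists w.
move=> U' sU' U'o; pose iU' := [set y | exists2 x, U' x & i x = y].
have iU'E : iU' = U.
  apply: minU; last by move=> _ [x _ <-]; apply/iP; exists x.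
  split; first exact: submodule_im.
  move=> x; have [_ /iP[w <-] <-] := Uo x.
  have [u [s [U'u s0 ->]]] := U'o w.
  by exists (i u); [exists u | rewrite !linearD -[f (i s)]/(p0 s) s0 addr0].
apply/seteqP; split=> // x _.
have : U (i x) by apply/iP; exists x.
by rewrite -iU'E => -[y U'y /ii <-].
Qed.

(** The kernel of P1 -> P0 is a direct summand, because the image is projective;
being superfluous, it vanishes.  Superfluous kernels also transfer finite
generation from X to P0 and P1. *)
Lemma presentation_fg X P1 P0 (p1 : {linear P1 -> P0}) (p0 : {linear P0 -> X}) :
  finitely_generated X -> minimal_projective_presentation p1 p0 -> presentation p1 p0.
Proof.
move=> fgX [pr1 pr0 p0o ex [sup0 sup1]].
(* generators of W lift to a submodule that, with the kernel, spans V *)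
have lift V W (f : {linear V -> W}) : onto f -> finitely_generated W ->
    superfluous [set x | f x = 0] -> finitely_generated V.
  move=> fo /fgP[n [w spw]] sup; have /choice[v vP] i := fo (w i).
  apply/fgP; exists n, v => x; split=> // _.
  suff ST : [set x | exists c, x = lincomb v c] = setT.
    by have : [set: V] x by []; rewrite -ST.
  apply: sup => [|y]; first exact: (@submodule_spans _ _ _ _ v).
  have /spw[c E] : [set: W] (f y) by [].
  exists (lincomb v c), (y - lincomb v c); split.
  - by exists c.
  - rewrite /= linearB linear_lincomb E; apply/eqP; rewrite subr_eq0; apply/eqP.
    by apply: eq_bigr => i _; rewrite /= vP.
  - by rewrite addrC subrK.
have fg0 := lift _ _ _ p0o fgX sup0.
have [L [j [ji jP]]] := submodule_module (submodule_ker p0).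
have prL := projective_sub pr0 fg0 ji.
have [|q qP] := factor_mono (f := p1) ji; first by move=> x; apply/jP/ex; exists x.
have qo : onto q.
  by move=> l; have /jP/ex[y E] : exists w, j w = j l; [exists l | exists y; apply: ji; rewrite qP].
have kerE : [set x | p1 x = 0] = [set x | q x = 0].
  by apply/seteqP; split=> x /= h; [apply: ji; rewrite qP linear0 | rewrite -qP h linear0].
have fg1 : finitely_generated P1.
  by apply: (lift _ _ q) => //; [exact: fg_sub ji fg0 | rewrite -kerE].
split=> //; split=> //; apply: inj_ker => x px0.
have [s sP] := projective_split prL qo.
have sT : [set y | exists2 l, setT l & s l = y] = setT.
  apply: sup1; first exact: submodule_im.
  move=> y; exists (s (q y)), (y - s (q y)); split; first by exists (q y).
    by rewrite /= -qP linearB sP subrr linear0.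
  by rewrite addrC subrK.
have [l _ E] : [set y | exists2 l, setT l & s l = y] x by rewrite sT.
have q0 : q x = 0 by apply: ji; rewrite qP linear0.
by rewrite -E; rewrite -E sP in q0; rewrite q0 linear0.
Qed.

End Presentations.

(** * Vanishing of Hom and Ext *)

Section Ext.
Variable A : nzRingType.
Implicit Types (K P X Y : lmodType A).

Definition hom_vanishes X Y := forall (f : {linear X -> Y}) x, f x = 0.

(** Ext^1(X, Y) = 0, tested on all extensions of X; [ext_vanishesP] shows that
a single projective presentation suffices. *)
Definition ext_vanishes X Y := forall K P (i : {linear K -> P}) (p : {linear P -> X}),
  short_exact i p -> forall f : {linear K -> Y}, exists g : {linear P -> Y}, forall x, g (i x) = f x.

(** Given P' -> X, a lift c of P -> X presents P' as the pushout of P along the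
induced map K -> K'; an extension over P of the composite K -> K' -> Y glues
with f. *)
Lemma ext_vanishesP X Y K P (i : {linear K -> P}) (p : {linear P -> X}) :
  projective_module P -> short_exact i p ->
  (forall f : {linear K -> Y}, exists g : {linear P -> Y}, forall x, g (i x) = f x) ->
  ext_vanishes X Y.
Proof.
move=> prP [ii po ex] h K' P' i' p' [ii' po' ex'] f.
have [c cP] := prP _ _ p' p po'.
have [|c0 c0P] := factor_mono (f := c \o i : {linear K -> P'}) ii'.
  by move=> x; apply/ex'; rewrite /= cP; apply/ex; exists x.
have [g gP] := h (f \o c0 : {linear K -> Y}).
have [] := @lin_of_graph A P' Y (fun x y => exists kz : K' * P,
    x = i' kz.1 + c kz.2 /\ y = f kz.1 + g kz.2).
- move=> x; have [z pz] := po (p' x).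
  have [w E] : exists w, i' w = x - c z by apply/ex'; rewrite linearB cP pz subrr.
  by exists (f w + g z), (w, z); rewrite /= E subrK.
- move=> y [[w z] /= [E ->]].
  have pz : p z = 0.
    have iw0 : p' (i' w) = 0 by apply/ex'; exists w.
    by have := congr1 p' E; rewrite linear0 linearD cP iw0 add0r.
  have [w0 zE] := (ex z).1 pz; rewrite -zE in E *.
  rewrite -[c (i w0)]/((c \o i) w0) -c0P -linearD in E.
  have {}E : w + c0 w0 = 0 by apply: ii'; rewrite linear0.
  by rewrite gP /= -linearD E linear0.
- move=> a _ _ _ _ [[w z] /= [-> ->]] [[w' z'] /= [-> ->]].
  exists (a *: w + w', a *: z + z'); rewrite /= !linearP.
  by rewrite !scalerDr !addrA; split; congr (_ + _); rewrite addrAC.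
move=> G GP; exists G => x; have [[w z] /= [E ->]] := GP (i' x).
have pz : p z = 0.
  have i0 y : p' (i' y) = 0 by apply/ex'; exists y.
  by have := congr1 p' E; rewrite linearD cP !i0 add0r.
have [w0 zE] := (ex z).1 pz; rewrite -zE in E *.
rewrite -[c (i w0)]/((c \o i) w0) -c0P -linearD in E.
by move/ii': E => ->; rewrite gP linearD.
Qed.
End Ext.

(** * Existence of the injective envelope of k / rad k *)

Section GraphExtension.
Variables (A : nzRingType) (V E : lmodType A).
Implicit Types (G H : set (V * E)%type).

(** Partial homomorphisms are handled as graphs, whose unions and extensions by one
vector need no bookkeeping of domains. *)
Definition functional_graph G := submodule G /\ forall e, G (0, e) -> e = 0.

(** A maximal extension is total as soon as partial homomorphisms extend to one
more vector. *)
Lemma zorn_graph G :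
  functional_graph G ->
  (forall H, functional_graph H -> forall v, exists e,
     forall c e', H (c *: v, e') -> e' = c *: e) ->
  exists f : {linear V -> E}, forall v e, G (v, e) -> f v = e.
Proof.
move=> [sG G0] step.
have [|H [sH GH H0 maxH]] := zorn_submodule (p := fun x : V * E => x.1 = 0 -> x.2 = 0) sG.
  by move=> [v e] /= + v0; rewrite v0; apply: G0.
have fH : functional_graph H by split=> // e /H0; apply.
have tot v : exists e, H (v, e).
  have [e eP] := step H fH v; exists e.
  rewrite -(maxH (sumset H (line (v, e)))).
  - exact: sumset_r (line_mem _).
  - exact: submodule_sum_line.
  - exact: sumset_l (submodule_line _).
  - move=> _ [[v' e'] [_ [Hx [c ->] ->]]] /= v0.
    have v'E : v' = - c *: v by rewrite scaleNr; apply/eqP; rewrite -addr_eq0 v0.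
    by rewrite v'E in Hx; rewrite (eP _ _ Hx) scaleNr addNr.
have [||f fP] := @lin_of_graph A V E (fun v e => H (v, e)) tot.
- by move=> e /H0; apply.
- move=> a v v' e e' Hv Hv'; have := proj2 sH a _ _ Hv Hv'.
  by [].
exists f => v e Gve; apply/eqP; rewrite -subr_eq0; apply/eqP.
have : H (v - v, f v - e) by apply: (submodB sH (fP v) (GH _ Gve)).
by rewrite subrr; apply: (proj2 fH).
Qed.
End GraphExtension.

Notation zmod V := (kmod (intr : {rmorphism int -> _}) V).

Lemma int_subgroup (I : set int^o) : submodule I ->
  exists n : nat, I n%:Z /\ forall c, I c -> exists q, c = q * n%:Z.
Proof.
move=> sI; pose P := fun n : nat => `[< (0 < n)%N /\ I n%:Z >].
have absI c : I c -> I `|c|%N.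
  by case: (leP 0 c) => hc Ic; [rewrite gez0_abs | rewrite ltz0_abs //; exact: (submodN sI)].
have [exP|noP] := pselect (exists n, P n); last first.
  exists 0%N; split=> [|c Ic]; first exact: (submod0 sI).
  exists 0; rewrite mul0r; apply: contrapT => /eqP c0; apply: noP; exists `|c|%N.
  by apply/asboolP; rewrite absz_gt0; split=> //; apply: absI.
have [n /asboolP[n0 In] minn] := ex_minnP exP; exists n; split=> // c Ic.
exists (c %/ n%:Z)%Z; have cE := divz_eq c n%:Z.
have nz : (n%:Z : int) != 0 by rewrite -lt0n.
have rge : (0 <= (c %% n%:Z)%Z)%R by apply: modz_ge0.
have rlt : ((c %% n%:Z)%Z < n%:Z)%R by apply: ltz_pmod.
have Ir : I (c %% n%:Z)%Z.
  have -> : (c %% n%:Z)%Z = c - (c %/ n%:Z)%Z * n%:Z by rewrite {2}cE addrAC subrr add0r.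
  by apply: (submodB sI Ic); apply: (submodZ _ sI In).
rewrite {1}cE; suff -> : (c %% n%:Z)%Z = 0 by rewrite addr0.
apply: contrapT => /eqP r0; move: rlt; rewrite ltNge => /negP; apply.
rewrite -(gez0_abs rge) lez_nat; apply: minn; apply/asboolP.
by rewrite absz_gt0; split=> //; apply: absI.
Qed.

Section Divisible.
Variable D : lmodType int.
Definition divisible_group := forall n : nat, (0 < n)%N -> forall d : D, exists d', n%:Z *: d' = d.
Hypothesis divD : divisible_group.

(** The case of Baer's criterion over the integers, where every ideal is principal. *)
Lemma int_extension (V : lmodType int) (G : set (V * D)%type) :
  functional_graph G -> exists f : {linear V -> D}, forall v e, G (v, e) -> f v = e.
Proof.
move=> fG; apply: zorn_graph => // H [sH H0] v.
have sI : submodule ([set c | exists d, H (c *: v, d)] : set int^o).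
  split; first by exists 0; rewrite scale0r; apply: submod0 sH.
  move=> a c c' [d Hd] [d' Hd']; exists (a *: d + d').
  by have := proj2 sH a _ _ Hd Hd'; rewrite -[a *: _ + _]/(a *: (c *: v) + c' *: v, a *: d + d')
    scalerDl scalerA.
(* the c with c v in the domain of H are the multiples of n; an n-th part of the value at n v will do as value at v *)
have [[|n] [[d Hd] nP]] := int_subgroup sI.
  exists 0 => c e' Hc; have [|q cE] := nP c; first by exists e'.
  by rewrite cE mulr0 !scale0r in Hc *; apply: H0.
have [e eP] := divD (ltn0Sn n) d; exists e => c e' Hc.
have [|q cE] := nP c; first by exists e'.
have := submodB sH Hc (submodZ q sH Hd); rewrite -[_ - _]/(c *: v - q *: (n.+1%:Z *: v), e' - q *: d).
rewrite scalerA -cE subrr => /H0/eqP; rewrite subr_eq0 => /eqP ->.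
by rewrite cE -scalerA eP.
Qed.
End Divisible.

(** Q / Z supplies characters: it is divisible and has torsion of every order. *)
Lemma rat_mod_int : exists QZ : lmodType int, divisible_group QZ /\
  forall n, (1 < n)%N -> exists q : QZ, q <> 0 /\ n%:Z *: q = 0.
Proof.
pose V : lmodType int := zmod rat^o.
pose U : set V := [set q | exists z : int, q = z%:~R :> rat].
have sU : submodule U.
  split; first by exists 0.
  by move=> a _ _ [z ->] [w ->]; exists (a * z + w); rewrite rmorphD rmorphM.
have [QZ [p [po pP]]] := quotient_module sU; exists QZ; split.
  move=> n n0 d; have [x <-] := po d; exists (p ((x : rat) / n%:R)).
  rewrite -linearZ; congr (p _); rewrite kmodE /GRing.scale /= mulrC divfK //.
  by rewrite pnatr_eq0 -lt0n.
move=> n n1; have nz : (n%:R : rat) != 0 by rewrite pnatr_eq0 -lt0n ltnW.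
exists (p (n%:R^-1 : rat)); split.
  move=> /pP[z E]; have : (1 : rat) = (z * n%:Z)%:~R by rewrite rmorphM /= -E mulVf.
  rewrite -[1 in LHS]/(1%:~R) => /eqP; rewrite eqr_int => /eqP zn.
  have : `|(z * n%:Z)%R|%N = 1%N by rewrite -zn.
  by rewrite abszM /= => /eqP; rewrite muln_eq1 => /andP[_ /eqP n_1]; rewrite n_1 in n1.
rewrite -linearZ; apply/pP; exists 1.
by rewrite kmodE /GRing.scale /= mulfV.
Qed.

Lemma dprod_divisible (I : Type) (D : I -> lmodType int) :
  (forall i, divisible_group (D i)) -> divisible_group (dprod D).
Proof.
move=> divD n n0 d; have h i : exists d' : D i, n%:Z *: d' = d i by apply: divD.
exists (fun i => projT1 (cid (h i))); apply: functional_extensionality_dep => i.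
exact: (projT2 (cid (h i))).
Qed.

Section Envelope.
Variable k : comNzRingType.
Implicit Types (m : set k^o) (E : lmodType k).

Lemma maximal_ideal_exists (I : set k^o) : submodule I -> ~ I 1 ->
  exists m, maximal_ideal m /\ I `<=` m.
Proof.
move=> sI I1; have [|m [sm Im m1 maxm]] := zorn_submodule (p := fun x => x <> 1) sI.
  by move=> x Ix x1; rewrite -x1 in I1.
exists m; split=> //; split=> // [mT|U sU mU].
  by have : m 1 by [rewrite mT]; move=> /m1.
have [U1|U1] := pselect (U 1); last by left; apply: maxm => // x Ux x1; rewrite -x1 in U1.
right; apply/seteqP; split=> // x _.
by rewrite -[x]mulr1; apply: (submodZ x sU U1).
Qed.

Lemma maximal_inv m (c : k) : maximal_ideal m -> ~ m c -> exists b, m (1 - b * c).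
Proof.
move=> [sm mT maxm] nmc.
case: (maxm (sumset m (line (c : k^o)))).
- exact: submodule_sum_line.
- exact: sumset_l (submodule_line (c : k^o)).
- by move=> E; case: nmc; rewrite -E; apply: sumset_r (line_mem _).
move=> E; have : (sumset m (line (c : k^o))) 1 by rewrite E.
by move=> [x [_ [mx [b ->] ->]]]; exists b; rewrite addrK.
Qed.

Lemma maximal_1 m : maximal_ideal m -> ~ m 1.
Proof.
move=> [sm mT _] m1; apply: mT; apply/seteqP; split=> // x _.
by rewrite -[x]mulr1; apply: (submodZ x sm m1).
Qed.

Lemma maximal_mul m (a c : k) : maximal_ideal m -> m (a * c) -> ~ m c -> m a.
Proof.
move=> mm mac nmc; have [b mb] := maximal_inv mm nmc; have [sm _ _] := mm.
have -> : a = a * (1 - b * c) + b * (a * c).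
  by rewrite mulrBr mulr1 mulrCA subrK.
by apply: (submodD sm); [apply: (submodZ a sm mb) | apply: (submodZ b sm mac)].
Qed.

(** Send 1 to a torsion element of Q / Z whose order divides the characteristic
of k / m, then extend from the prime field by injectivity. *)
Lemma residue_character (QZ : lmodType int) m : divisible_group QZ ->
  (forall n, (1 < n)%N -> exists q : QZ, q <> 0 /\ n%:Z *: q = 0) ->
  maximal_ideal m ->
  exists chi : {linear zmod k^o -> QZ}, (forall x, m x -> chi x = 0) /\ chi 1 <> 0.
Proof.
move=> divQ tors mm; have [sm _ _] := mm.
(* n is the residue characteristic; in characteristic 0 any non-zero q will do *)
have [q [q0 qP]] : exists q : QZ, q <> 0 /\ forall n : int, m (n%:~R) -> n *: q = 0.
  have sI : submodule ([set c | m c%:~R] : set int^o).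
    split=> [|a c c' mc mc']; first exact: (submod0 sm).
    by rewrite /= intrD intrM; apply: (submodD sm) => //; apply: (submodZ _ sm mc).
  have [[|[|n]] [mn nP]] := int_subgroup sI.
  - have [q [q0 _]] := tors 2%N isT; exists q; split=> // c /nP[d ->].
    by rewrite mulr0 scale0r.
  - by case: (maximal_1 mm).
  - have [q [q0 nq]] := tors n.+2 isT; exists q; split=> // c /nP[d ->].
    by rewrite -scalerA nq scaler0.
pose G : set (zmod k^o * QZ) := [set v | exists n : int, m ((v.1 : k) - n%:~R) /\ v.2 = n *: q].
have [|chi chiP] := @int_extension QZ divQ (zmod k^o) G.
  split; [split|].
  - by exists 0; rewrite /= subrr scale0r; split=> //; exact: (submod0 sm).
  - move=> a [x e] [y f] [n /= [mn ->]] [n' /= [mn' ->]]; exists (a * n + n'); split; last first.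
      by rewrite /= scalerDl scalerA.
    rewrite /= kmodE /= [in X in m X]/GRing.scale /= intrD intrM opprD addrACA -mulrBr.
    by apply: (submodD sm) => //; apply: (submodZ _ sm mn).
  - by move=> e [n /= [mn ->]]; apply: qP; have := submodN sm mn; rewrite sub0r opprK.
exists chi; split=> [x mx|].
  by apply: chiP; exists 0; rewrite subr0 scale0r.
rewrite (chiP _ q) //; exists 1; rewrite subrr scale1r; split=> //; exact: (submod0 sm).
Qed.

(** E = Hom_Z(k, D), with D divisible: homomorphisms of k-modules X -> E
correspond to additive maps X -> D, which extend.  [ev] is the evaluation of a
map at a scalar. *)
Lemma coinduced_module (D : lmodType int) : divisible_group D ->
  exists (E : lmodType k) (ev : E -> k -> D),
  [/\ injective_module E,
      forall c e e' a, ev (c *: e + e') a = ev e (a * c) + ev e' a,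
      forall e e', (forall a, ev e a = ev e' a) -> e = e' &
      forall f : {linear zmod k^o -> D}, exists e, forall a, ev e a = f a].
Proof.
move=> divD.
have mul_lin c : linear (fun a : zmod k^o => (a : k) * c : zmod k^o).
  by move=> n a b; rewrite !kmodE /GRing.scale /= mulrDl mulrA.
have [||||| E [ev0 [evP0 evI0 evS0]]] := @module_of_homs k int (zmod k^o) D
  (fun c f => f \o mklin (mul_lin c)).
- by move=> c f g fg a; rewrite /= fg.
- by [].
- by move=> c d f a; rewrite /= mulrDr linearD.
- by move=> c d f a; rewrite /= mulrA.
- by move=> f a; rewrite /= mulr1.
pose ev e : k -> D := ev0 e.
have evP c e e' a : ev (c *: e + e') a = ev e (a * c) + ev e' a by exact: evP0.
have evI e e' : (forall a, ev e a = ev e' a) -> e = e' by exact: evI0.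
have evS (f : {linear zmod k^o -> D}) : exists e, forall a, ev e a = f a by exact: evS0.
have ev0E a : ev 0 a = 0.
  by apply: (addrI (ev 0 a)); rewrite -{1}(mulr1 a) -evP scale1r !addr0.
have evZ c e a : ev (c *: e) a = ev e (a * c).
  by rewrite -[c *: e]addr0 evP ev0E addr0.
exists E, ev; split=> //.
move=> X Y f h fi.
pose G : set (zmod Y * D) := [set z | exists x, z = (f x, ev (h x) 1)].
have [|g gP] := @int_extension D divD (zmod Y) G.
  split; [split|].
  - exists 0; rewrite !linear0; congr (_, _).
    by rewrite ev0E.
  - move=> n _ _ [x ->] [y ->]; exists (n%:~R *: x + y).
    rewrite !linearP evP; congr (_, _); congr (_ + _).
    rewrite mul1r -[n%:~R]mulr1 -[LHS]/(n *: ev0 (h x) 1) -linearZ.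
    by rewrite kmodE /GRing.scale /=.
  - move=> e [x [fx ->]]; have -> : x = 0 by apply: fi; rewrite -fx linear0.
    by rewrite linear0 ev0E.
have gl (y : Y) : linear (fun a : zmod k^o => g ((a : k) *: y)).
  move=> n a b; rewrite -linearP; congr (g _).
  by rewrite -[LHS]/((n%:~R * (a : k) + (b : k)) *: y) scalerDl -scalerA.
have /choice[F FP] (y : Y) := evS (mklin (gl y)).
have Fl : linear F.
  by move=> c u v; apply: evI => a; rewrite evP !FP /= scalerDr scalerA linearD.
exists (mklin Fl) => x; apply: evI => a; rewrite FP /= -linearZ.
have -> : g (f (a *: x)) = ev (h (a *: x)) 1 by apply: gP; exists (a *: x).
by rewrite [h _]linearZ evZ mul1r.
Qed.

(** The characters of all residue fields together: c goes to the map that sends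
a to the family of the chi_m (a c). *)
Lemma injective_top_embedding : exists (E : lmodType k) (e : {linear k^o -> E}),
  injective_module E /\ forall c, e c = 0 <-> forall m, maximal_ideal m -> m c.
Proof.
have [QZ [divQ tors]] := rat_mod_int.
have [E [ev [injE evP evI evS]]] := coinduced_module (dprod_divisible (fun=> divQ) : divisible_group (dprod (fun _ : set k^o => QZ))).
have ev0 a : ev 0 a = 0.
  have := evP (-1) 0 0 (- a); rewrite scaler0 addr0 mulrNN mulr1 => /eqP.
  by rewrite -{1}[ev 0 (- a)]add0r (inj_eq (addIr _)) => /eqP.
have /choice[chi chiP] m : exists chi : {linear zmod k^o -> QZ},
    maximal_ideal m -> (forall x, m x -> chi x = 0) /\ chi 1 <> 0.
  have [mm|nm] := pselect (maximal_ideal m); last by exists \0.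
  by have [chi chiP] := residue_character divQ tors mm; exists chi.
pose f c : k -> dprod (fun _ : set k^o => QZ) := fun a m => if `[< maximal_ideal m >] then chi m (a * c) else 0.
have fl c : linear (f c : zmod k^o -> _).
  move=> n a b; apply: functional_extensionality_dep => m.
  rewrite /f -[RHS]/(n *: (if _ then _ else _) + (if _ then _ else _)).
  case: asboolP => _; last by rewrite scaler0 addr0.
  by rewrite -linearP; congr (chi m _); rewrite !kmodE /GRing.scale /= mulrDl mulrA.
have /choice[e eP] c := evS (mklin (fl c)).
have el : linear (e : k^o -> E).
  move=> c a b; apply: evI => d; rewrite evP !eP.
  apply: functional_extensionality_dep => m /=.
  rewrite /f -[RHS]/((if _ then _ else _) + (if _ then _ else _)).
  case: asboolP => _; last by rewrite addr0.
  by rewrite -linearD; congr (chi m _); rewrite /GRing.scale /= mulrDr mulrA.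
exists E, (mklin el); split=> // c; split=> /= [ec0 m mm|cm].
  apply: contrapT => nmc; have [b mb] := maximal_inv mm nmc.
  have [chim chi1] := chiP m mm; apply: chi1.
  have := eP c b; rewrite ec0 ev0 => /(congr1 (fun h => h m)).
  rewrite /= /f; case: asboolP => // _ E0.
  by have := chim _ mb; rewrite [chi m (1 - _)]linearB -E0 subr0.
apply: evI => a; rewrite ev0 eP /=; apply: functional_extensionality_dep => m.
rewrite /f; case: asboolP => // mm; have [chim _] := chiP m mm.
by apply: chim; have [sm _ _] := mm; apply: (submodZ a sm); apply: cm.
Qed.

(** J is a maximal essential extension N of the image S of k inside an injective
E.  With C maximal such that C meets N in 0, the projection of N + C to N
extends to an endomorphism pi of E; its image is still essential over S, so it
equals N and N is a retract of E. *)
Lemma injective_envelope_exists : exists (J : lmodType k) (e : {linear k^o -> J}),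
  injective_envelope_top e.
Proof.
have [E [e0 [injE e0P]]] := injective_top_embedding.
pose S : set E := range e0.
have sS : submodule S.
  have := submodule_im e0 (submodule_setT k^o); congr submodule.
have [|N [sN SN Ness maxN]] := zorn_submodule (p := fun x => x <> 0 -> exists a, S (a *: x) /\ a *: x <> 0) sS.
  by move=> x Sx x0; exists 1; rewrite scale1r.
have [|C [sC _ CN maxC]] := zorn_submodule (p := fun x => N x -> x = 0) (submodule_set0 E).
  by move=> x ->.
have [pi piP] : exists pi : {linear E -> E}, (forall n, N n -> pi n = n) /\ forall c, C c -> pi c = 0.
  have [W [i [ii iP]]] := submodule_module (submodule_sum sN sC).
  have [] := @lin_of_graph k W E (fun w n => N n /\ C (i w - n)).
  - move=> w; have /iP[n [c [Nn Cc ->]]] : exists w', i w' = i w by exists w.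
    by exists n; rewrite addrAC subrr add0r.
  - move=> n [Nn]; rewrite linear0 sub0r => /(submodN sC); rewrite opprK => /CN; exact.
  - move=> a w w' n n' [Nn Cn] [Nn' Cn']; split; first exact: (proj2 sN).
    by have := proj2 sC a _ _ Cn Cn'; rewrite (linearP i) scalerBr addrACA -opprD.
  move=> q qP; have [g gP] := injE _ _ i q ii; exists g; split.
    move=> n Nn; have [w wE] : exists w, i w = n.
      by apply/iP; apply: sumset_l.
    rewrite -wE gP; have [Nq Cq] := qP w; apply/eqP; rewrite eq_sym -subr_eq0; apply/eqP.
    by apply: (CN _ Cq); apply: submodB => //; rewrite wE.
  move=> c Cc; have [w wE] : exists w, i w = c.
    by apply/iP; apply: sumset_r.
  rewrite -wE gP; have [Nq Cq] := qP w; apply: CN => //.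
  by have := submodB sC Cc Cq; rewrite wE opprB addrCA subrr addr0.
have [piN piC] := piP.
have kerC x : pi x = 0 -> C x.
  move=> px; rewrite -(maxC [set x | pi x = 0]) //; first exact: submodule_ker.
  by move=> y /= py Ny; rewrite -py piN.
have imN : [set y | exists2 x, setT x & pi x = y] = N.
  apply: maxN; first exact: submodule_im.
    by move=> n Nn; exists n => //; apply: piN.
  move=> _ [x _ <-] px0.
  have [n [c [Nn n0 [a nE]]]] : exists n c, [/\ N n, n <> 0 & exists a, n = c + a *: x /\ C c].
    apply: contrapT => no; apply: px0; rewrite (_ : pi x = 0) //; apply: piC.
    rewrite -(maxC (sumset C (line x))).
    - exact: sumset_r (line_mem x).
    - exact: submodule_sum_line.
    - exact: sumset_l (submodule_line x).
    - move=> y [c [_ [Cc [a ->] yE]]] Ny; apply: contrapT => y0; apply: no.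
      by exists y, c; split=> //; exists a.
  have [b [Sb b0]] := Ness n Nn n0; exists (b * a).
  have {}nE : a *: pi x = n.
    by case: nE => nE Cc; rewrite -(piN n Nn) nE linearD (piC c Cc) add0r linearZ.
  by rewrite -scalerA nE.
have [J [i [ii iP]]] := submodule_module sN.
have [|q qP] := factor_mono (f := pi) ii.
  by move=> x; apply/iP; rewrite -imN; exists x.
have qi w : q (i w) = w by apply: ii; rewrite qP piN //; apply/iP; exists w.
have [|e eP] := factor_mono (f := e0) ii; first by move=> c; apply/iP; apply: SN; exists c.
exists J, e; split.
- move=> X Y f h fi; have [g gP] := injE _ _ f (i \o h : {linear X -> E}) fi.
  by exists (q \o g : {linear Y -> J}) => x /=; rewrite gP /= qi.
- move=> U sU Ue; apply/seteqP; split=> [u Uu|_ ->]; last exact: submod0.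
  apply: contrapT => /= u0; have Niu : N (i u) by apply/iP; exists u.
  have [|a [[c _ cE] a0]] := Ness _ Niu; first by rewrite -(linear0 i) => /ii.
  have : (U `&` range e) (a *: u).
    by split; [apply: submodZ | exists c => //; apply: ii; rewrite eP cE linearZ].
  by rewrite Ue => /= au; rewrite -linearZ au linear0 in a0.
- by move=> c; rewrite -e0P -eP; split=> [->|]; rewrite ?linear0 // -{1}(linear0 i) => /ii.
Qed.
End Envelope.

(** * Matlis duality for modules of finite length *)

Section Matlis.
Variable k : comNzRingType.
Hypothesis ck : chain_ring k.
Variables (J : lmodType k) (e : {linear k^o -> J}).
Hypothesis envJ : injective_envelope_top e.
Implicit Types (m : set k^o) (V : lmodType k).

Let fgk : finitely_generated k^o.
Proof.
apply/fgP; exists 1%N, (fun=> 1) => x; split=> // _; exists (fun=> x).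
by rewrite /lincomb big_ord1 /GRing.scale /= mulr1.
Qed.

Lemma extend_functional V (G : set (V * J)%type) : functional_graph G ->
  exists f : {linear V -> J}, forall v j, G (v, j) -> f v = j.
Proof.
move=> [sG G0]; have [injJ _ _] := envJ.
pose V1 := [set v | exists j, G (v, j)].
have sV1 : submodule V1.
  split; first by exists 0; apply: submod0 sG.
  by move=> a u v [j Gj] [j' Gj']; exists (a *: j + j'); apply: (proj2 sG a _ _ Gj Gj').
have [W [i [ii iP]]] := submodule_module sV1.
have [] := @lin_of_graph k W J (fun w j => G (i w, j)).
- by move=> w; have /iP[j Gj] : exists w', i w' = i w by [exists w]; exists j.
- by move=> j; rewrite linear0; apply: G0.
- by move=> a w w' j j' Gj Gj'; rewrite linearP; apply: (proj2 sG a _ _ Gj Gj').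
move=> h hP; have [f fP] := injJ _ _ i h ii; exists f => v j Gvj.
have [w wE] : exists w, i w = v by apply/iP; exists j.
rewrite -wE fP; apply/eqP; rewrite -subr_eq0; apply/eqP/G0.
by have := submodB sG (hP w) Gvj; rewrite -wE -[_ - _]/(i w - i w, h w - j) subrr.
Qed.

Lemma socle_in_range m (j : J) : maximal_ideal m -> (forall c, m c -> c *: j = 0) ->
  exists c, e c = j.
Proof.
move=> mm mj; have [j0|j0] := pselect (j = 0); first by exists 0; rewrite linear0.
have [_ ess _] := envJ.
have [x [[c xc] [b _ eb]] x0] : exists2 x, (line j `&` range e) x & x <> 0.
  apply: contrapT => no; apply: j0.
  suff : line j j by rewrite (ess _ (submodule_line j)) //; apply/seteqP; split=> [x jx|_ ->];
    [by apply: contrapT => x0; apply: no; exists x | by split; [exists 0; rewrite scale0r | exists 0; rewrite ?linear0]].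
  by exists 1; rewrite scale1r.
have nmc : ~ m c by move=> mc; apply: x0; rewrite xc mj.
have [a ma] := maximal_inv mm nmc; exists (a *: b).
rewrite linearZ /= eb xc scalerA; apply/eqP.
by have /eqP := mj _ ma; rewrite scalerBl scale1r subr_eq0 eq_sym.
Qed.

(** The elements of J killed by m form a vector space of dimension 1 over k / m:
by essentiality they come from k / rad k, a product of fields in which only one
factor is killed by m. *)
Lemma socle_line m (j j' : J) : maximal_ideal m -> (forall c, m c -> c *: j = 0) ->
  (forall c, m c -> c *: j' = 0) -> j <> 0 -> exists a, j' = a *: j.
Proof.
move=> mm mj mj' j0; have [_ _ ek] := envJ.
have [c cE] := socle_in_range mm mj; have [c' cE'] := socle_in_range mm mj'.
have nmc : ~ m c.
  move=> mc; apply: j0; rewrite -cE; apply/ek => n nn.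
  have [//|nnc] := pselect (n c).
  have mn : m `<=` n.
    move=> b mb; have : e (b *: (c : k^o)) = 0 by rewrite linearZ /= cE mj.
    by move=> /ek/(_ n nn) nbc; apply: maximal_mul nn nbc nnc.
  have [sm _ maxm] := mm; have [sn nT _] := nn.
  by case: (maxm n sn mn) => // nm; rewrite nm in nnc *.
have [u mu] := maximal_inv mm nmc; exists (c' * u).
rewrite -cE -cE' -linearZ; apply/eqP; rewrite -subr_eq0 -linearB; apply/eqP.
have -> : (c' : k^o) - (c' * u) *: (c : k^o) = (1 - u * c) *: (c' : k^o).
  by rewrite /GRing.scale /= mulrBl mul1r -!mulrA [c' * _]mulrC mulrA.
by rewrite linearZ /= cE' mj'.
Qed.

(** An ideal minimal among those not inside m meets every other maximal ideal in
itself, hence gives an element of all maximal ideals but m. *)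
Lemma socle_nonzero m : maximal_ideal m -> exists2 j : J, j <> 0 & forall c, m c -> c *: j = 0.
Proof.
move=> mm; have [_ _ ek] := envJ; have [sm _ _] := mm.
have [||I [[sI [c Ic nmc]] minI]] := ck false fgk
  (F := [set I | submodule I /\ exists2 c, I c & ~ m c]).
- by exists setT; split=> //; exists 1 => //; apply: maximal_1.
- by move=> I [].
exists (e c).
  by move=> /ek/(_ m mm).
move=> b mb; rewrite -linearZ; apply/ek => n nn; have [sn nT maxn] := nn.
have [nm|nm] := pselect (n `<=` m).
  case: (maxn m sm nm) => [<-|mT]; first by rewrite /GRing.scale /= mulrC; apply: (submodZ _ sm mb).
  by case: mm => _ + _.
have /existsNP[d /not_implyP[nd nmd]] := nm.
suff Ic' : I `&` n = I by apply: (submodZ b sn); rewrite -Ic' in Ic; case: Ic.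
apply: minI; last by move=> x [].
split; first exact: submodule_setI.
exists (d * c); first by split; [apply: (submodZ d sI Ic) | rewrite mulrC; apply: (submodZ c sn nd)].
by move=> /(maximal_mul mm)/(_ nmc).
Qed.

(** J is a cogenerator: k v modulo U maps onto some k / m, which embeds in J. *)
Lemma separating_functional V (U : set V) v : submodule U -> ~ U v ->
  exists f : {linear V -> J}, (forall u, U u -> f u = 0) /\ f v <> 0.
Proof.
move=> sU nUv; pose I : set k^o := [set c | U (c *: v)].
have sI : submodule I.
  split; first by rewrite /I /= scale0r; apply: submod0.
  by move=> a c d Ic Id; rewrite /I /= scalerDl -scalerA; apply: (proj2 sU).
have [|m [mm Im]] := maximal_ideal_exists sI; first by rewrite /I /= scale1r.
have [j j0 mj] := socle_nonzero mm.
have [|f fP] := @extend_functional V [set x | exists u c, U u /\ x = (u + c *: v, c *: j)].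
  split; [split|].
  - by exists 0, 0; split; [apply: submod0 | rewrite !scale0r addr0].
  - move=> a _ _ [u [c [Uu ->]]] [w [d [Uw ->]]]; exists (a *: u + w), (a * c + d).
    split; first exact: (proj2 sU).
    by congr (_, _); rewrite ?scalerDl /= ?scalerDr ?scalerA // addrACA.
  - move=> x [u [c [Uu [E ->]]]]; apply/mj/Im; rewrite /I /=.
    have -> : c *: v = - u by apply/eqP; rewrite -addr_eq0 addrC -E.
    exact: submodN.
exists f; split=> [u Uu|]; first by apply: fP; exists u, 0; rewrite !scale0r addr0.
rewrite (fP v j) //; exists 0, 1; rewrite !scale1r add0r; split=> //; exact: submod0.
Qed.

(** V -> DDV is surjective.  If psi agrees with an evaluation on the functionals
killing N, then also on those killing a maximal submodule N' of N: functionals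
on the simple module N / N' take values in a line of J, by [socle_line]. *)
Lemma matlis_reflexive V (psi : {linear V -> J} -> J) : finitely_generated V ->
  (forall (c : k) (f g h : {linear V -> J}), (forall x, h x = c *: f x + g x) ->
     psi h = c *: psi f + psi g) ->
  exists v, forall f, psi f = f v.
Proof.
move=> fgV psiP.
have psi0 (f : {linear V -> J}) : (forall x, f x = 0) -> psi f = 0.
  move=> f0; have := psiP 1 f f f; rewrite !scale1r => E.
  have /eqP := E (fun x => etrans (f0 x) (esym (etrans (congr2 _ (etrans (scale1r _) (f0 x)) (f0 x)) (addr0 _)))).
  by rewrite -{1}[psi f]add0r (inj_eq (addIr _)) => /eqP.
pose P (N : set V) := exists v, forall f : {linear V -> J}, (forall x, N x -> f x = 0) -> psi f = f v.
have [||N [[sN [v vP]] minN]] := ck false fgV (F := [set N | submodule N /\ P N]).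
- exists setT; split=> //; exists 0 => f f0; rewrite linear0; apply: psi0 => x; exact: f0.
- by move=> N [].
have [[x Nx x0]|Nn0] := pselect (exists2 x, N x & x <> 0); last first.
  exists v => f; apply: vP => x Nx; have [->|] := pselect (x = 0); first by rewrite linear0.
  by move=> x0; case: Nn0; exists x.
have [||N' [[sN' N'N nN'] maxN']] := ck true fgV
  (F := [set N' | [/\ submodule N', N' `<=` N & N' <> N]]).
- exists [set 0]; split; first exact: submodule_set0.
    by move=> _ ->; apply: submod0.
  by move=> N0; rewrite -N0 in Nx.
- by move=> N' [].
have [s Ns nN's] : exists2 s, N s & ~ N' s.
  by apply: contrapT => no; apply: nN'; apply/seteqP; split=> // y Ny; apply: contrapT => ny; apply: no; exists y.
have N's (y : V) : N y -> ~ N' y -> forall z, N z -> exists n c, N' n /\ z = n + c *: y.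
  move=> Ny nN'y z Nz; have [E|nE] := pselect (sumset N' (line y) = N).
    by rewrite -E in Nz; case: Nz => n [_ [N'n [c ->] ->]]; exists n, c.
  case: nN'y; rewrite -(maxN' (sumset N' (line y))).
  - exact: sumset_r (line_mem y).
  - split=> //; first exact: submodule_sum_line.
    by move=> _ [n [_ [N'n [c ->] ->]]]; apply: submodD => //; [apply: N'N | apply: submodZ].
  - exact: sumset_l (submodule_line y).
pose m : set k^o := [set c | N' (c *: s)].
have sm : submodule m.
  split; first by rewrite /m /= scale0r; apply: submod0.
  by move=> a c d Ic Id; rewrite /m /= scalerDl -scalerA; apply: (proj2 sN').
have mm : maximal_ideal m.
  split=> //.
    by move=> mT; apply: nN's; have : m 1 by [rewrite mT]; rewrite /m /= scale1r.
  move=> U sU mU; have [Um|/existsNP[c /not_implyP[Uc nmc]]] := pselect (U `<=` m).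
    by left; apply/seteqP.
  right; apply/seteqP; split=> // z _.
  have [n [a [N'n sE]]] := N's (c *: s) (submodZ c sN Ns) nmc s Ns.
  have mac : m (1 - a * c).
    by rewrite /m /= scalerBl scale1r -scalerA {1}sE addrK.
  have U1 : U (1 : k).
    by rewrite -[X in U X](subrK (a * c)); apply: (@submodD _ _ U _ _ sU); [apply: mU | apply: (submodZ a sU)].
  by rewrite -[z]mulr1; apply: (submodZ z sU U1).
suff PN' : P N' by case: nN'; apply: minN.
pose psi' (f : {linear V -> J}) := psi f - f v.
have psi'Z (f g : {linear V -> J}) c : (forall x, N' x -> f x = 0) ->
    (forall x, N' x -> g x = 0) -> f s = c *: g s -> psi' f = c *: psi' g.
  move=> fN gN fs; pose h : {linear V -> J} := f \- c \*: g.
  have hN z : N z -> h z = 0.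
    move=> /(N's s Ns nN's)[n [a [N'n ->]]].
    have lE (u : {linear V -> J}) : u n = 0 -> u (n + a *: s) = a *: u s.
      by move=> un; rewrite linearD un add0r linearZ.
    by rewrite /= (lE f (fN n N'n)) (lE g (gN n N'n)) fs !scalerA mulrC subrr.
  have := vP h hN.
  rewrite (psiP (- c) g f h) => [|y /=]; last by rewrite scaleNr addrC.
  rewrite /= scaleNr => E; rewrite /psi' scalerBr.
  have -> : psi f = c *: psi g + (f v - c *: g v) by rewrite -E addrA subrr add0r.
  by rewrite -addrA; congr (_ + _); rewrite addrAC subrr add0r.
have [[g gN' gs]|no] := pselect (exists2 g : {linear V -> J}, forall x, N' x -> g x = 0 & g s <> 0); last first.
  exists v => f fN'; apply: vP => z /(N's s Ns nN's)[n [c [N'n ->]]].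
  rewrite linearD linearZ /= fN' // add0r; apply: contrapT => fs; apply: no; exists f => // fs0.
  by apply: fs; rewrite fs0 scaler0.
have mg c : m c -> c *: g s = 0 by move=> mc; rewrite -linearZ; apply: gN'.
have mpg c : m c -> c *: psi' g = 0.
  move=> mc; pose z : {linear V -> J} := \0.
  by rewrite -(psi'Z z g c) //= ?mg // /psi' /= subr0; apply: psi0.
have [a aE] := socle_line mm mg mpg gs.
exists (v + a *: s) => f fN'.
have mf c : m c -> c *: f s = 0 by move=> mc; rewrite -linearZ; apply: fN'.
have [c cE] := socle_line mm mg mf gs.
have := psi'Z f g c fN' gN' cE; rewrite aE scalerA mulrC -scalerA -cE /psi' => E.
by rewrite linearD linearZ /= -E addrC subrK.
Qed.

End Matlis.

(** * The duality D between right and left modules *)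

Section AntiIso.
(** Right and left modules over R are modules over two rings A and B with
mutually inverse anti-isomorphisms; with A and B interchangeable each statement
serves both sides. *)
Definition anti_iso (A B : nzRingType) (s : A -> B) (t : B -> A) :=
  [/\ cancel s t, cancel t s, forall x y, s (x + y) = s x + s y &
      forall x y, s (x * y) = s y * s x].

Variables (A B : nzRingType) (s : A -> B) (t : B -> A).
Hypothesis st : anti_iso s t.

Lemma anti_iso_sym : anti_iso t s.
Proof.
have [sK tK sD sM] := st; split=> // x y; apply: (can_inj sK).
  by rewrite sD !tK.
by rewrite sM !tK.
Qed.
Lemma anti_iso0 : s 0 = 0.
Proof. by have [_ _ sD _] := st; apply: (addrI (s 0)); rewrite -sD !addr0. Qed.
Lemma anti_iso1 : s 1 = 1.
Proof. by have [_ tK _ sM] := st; rewrite -[LHS]mulr1 -{1}(tK 1) -sM mulr1 tK. Qed.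
Lemma anti_iso_sum (I : Type) (r : seq I) (F : I -> A) : s (\sum_(i <- r) F i) = \sum_(i <- r) s (F i).
Proof. by have [_ _ sD _] := st; apply: (big_morph s sD anti_iso0). Qed.
End AntiIso.

Section DualPairing.
Variables (k : comNzRingType) (A B : nzRingType).
Variables (ioA : {rmorphism k -> A}) (ioB : {rmorphism k -> B}).
Variables (s : A -> B) (t : B -> A) (J : lmodType k).
Hypotheses (st : anti_iso s t) (sio : forall c, s (ioA c) = ioB c)
  (cenA : forall c a, ioA c * a = a * ioA c).

(** [d] identifies Z with the dual Hom_k(T, J) of T. *)
Definition dual_pairing (T : lmodType B) (Z : lmodType A) (d : Z -> T -> J) :=
  [/\ forall z c x y, d z (ioB c *: x + y) = c *: d z x + d z y,
      forall a z z' x, d (a *: z + z') x = d z (s a *: x) + d z' x,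
      forall z z', (forall x, d z x = d z' x) -> z = z' &
      forall f : {linear kmod ioB T -> J}, exists z, forall x, d z x = f x].

Lemma dual_module (T : lmodType B) : exists (Z : lmodType A) (d : Z -> T -> J), dual_pairing d.
Proof.
have [sK tK sD sM] := st.
have cenB c b : ioB c * b = b * ioB c.
  by rewrite -sio -(tK b) -!sM cenA.
have mul_lin a : linear (fun x : kmod ioB T => s a *: (x : T) : kmod ioB T).
  move=> c x y; rewrite scalerDr; congr (_ + _).
  by rewrite -[LHS]/(s a *: (ioB c *: (x : T))) scalerA -cenB -scalerA.
have [||||| Z [d [dP di ds]]] := @module_of_homs A k (kmod ioB T) J (fun a f => f \o mklin (mul_lin a)).
- by move=> a f g fg x; rewrite /= fg.
- by [].
- by move=> a b f x; rewrite /= sD scalerDl linearD.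
- by move=> a b f x; rewrite /= sM scalerA.
- by move=> f x; rewrite /= (anti_iso1 st) scale1r.
exists Z, d; split=> // z c x y; exact: (linearP (d z)).
Qed.

Hypotheses (ck : chain_ring k) (fB : fg_algebra ioB).
Variable e : {linear k^o -> J}.
Hypothesis envJ : injective_envelope_top e.
Variables (T : lmodType B) (Z : lmodType A) (d : Z -> T -> J).
Hypothesis dP : dual_pairing d.

Lemma dual_lin z : linear (d z : kmod ioB T -> J).
Proof. by move=> c x y; have [-> _ _ _] := dP. Qed.
Lemma dual0r z : d z 0 = 0.
Proof. exact: (linear0 (mklin (dual_lin z))). Qed.
Lemma dualDr z x y : d z (x + y) = d z x + d z y.
Proof. exact: (linearD (mklin (dual_lin z))). Qed.
Lemma dualBr z x y : d z (x - y) = d z x - d z y.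
Proof. exact: (linearB (mklin (dual_lin z))). Qed.
Lemma dual_sum z (I : Type) (r : seq I) (F : I -> T) :
  d z (\sum_(i <- r) F i) = \sum_(i <- r) d z (F i).
Proof. exact: (linear_sum (mklin (dual_lin z)) r xpredT F). Qed.
Lemma dualDl z z' x : d (z + z') x = d z x + d z' x.
Proof. by have [_ dr _ _] := dP; have := dr 1 z z' x; rewrite (anti_iso1 st) !scale1r. Qed.
Lemma dual0l x : d 0 x = 0.
Proof. by apply: (addrI (d 0 x)); rewrite -dualDl !addr0. Qed.
Lemma dualZ a z x : d (a *: z) x = d z (s a *: x).
Proof. by have [_ dr _ _] := dP; rewrite -[a *: z]addr0 dr dual0l addr0. Qed.
Lemma dual_linl x : linear (d^~ x : kmod ioA Z -> J).
Proof.
move=> c z z'; have [dl dr _ _] := dP.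
rewrite -[LHS]/(d (ioA c *: (z : Z) + z') x) dr sio; congr (_ + _).
by rewrite -[_ *: x]addr0 dl dual0r addr0.
Qed.

Lemma dual_separates x : (forall z, d z x = 0) -> x = 0.
Proof.
move=> dx; apply: contrapT => x0; have [_ _ _ ds] := dP.
have [f [_ fx]] := separating_functional ck envJ (@submodule_set0 _ (kmod ioB T)) x0.
by have [z zf] := ds f; apply: fx; rewrite -zf.
Qed.

(** Hom_k(B, J) is injective by adjunction, and a dual basis of T reduces to
this case. *)
Lemma dual_projective_injective : projective_module T -> finitely_generated T ->
  injective_module Z.
Proof.
move=> prT fgT X Y f h fi; have [dl dr di ds] := dP.
have [n [x [phi xP]]] := dual_basis prT fgT.
have /choice[G GP] (i : 'I_n) : exists g : {linear kmod ioA Y -> J}, forall y, g (f y) = d (h y) (x i).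
  have [|g gP] := extend_functional envJ (V := kmod ioA Y)
    (G := [set yj | exists y, yj = (f y, d (h y) (x i))]).
    split; [split|].
    - by exists 0; rewrite !linear0 dual0l.
    - move=> c _ _ [y ->] [y' ->]; exists (ioA c *: y + y').
      by rewrite !linearP; congr (_, _); exact: (esym (dual_linl (x i) c _ _)).
    - move=> j [y [fy ->]]; have -> : y = 0 by apply: fi; rewrite -fy linear0.
      by rewrite linear0 dual0l.
  by exists g => y; apply: gP; exists y.
have Hl (y : Y) : linear (fun u : kmod ioB T => \sum_i G i (t (phi i (u : T)) *: y) : J).
  move=> c u v; rewrite scaler_sumr -big_split /=; apply: eq_bigr => i _.
  rewrite -(linearP (G i)); congr (G i _).
  rewrite -[c *: u]/(ioB c *: (u : T)) (linearP (phi i)).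
  have [_ sK' tD tM] := anti_iso_sym st.
  rewrite tD scalerDl; congr (_ + _); rewrite tM -sio.
  have [sK _ _ _] := st; rewrite sK.
  by rewrite -cenA -scalerA.
have /choice[g gP] (y : Y) := ds (mklin (Hl y)).
have gl : linear g.
  move=> a u v; apply: di => z; rewrite dr !gP /= -big_split /=; apply: eq_bigr => i _.
  have [_ _ _ tM] := anti_iso_sym st; have [sK _ _ _] := st.
  by rewrite scalerDr linearD [phi i (s a *: z)]linearZ /= tM sK scalerA.
exists (mklin gl) => y; apply: di => u; rewrite gP /= {2}(xP u).
rewrite dual_sum; apply: eq_bigr => i _.
rewrite -linearZ GP [h _]linearZ /= dualZ.
by have [_ tK _ _] := st; rewrite tK.
Qed.

Hypothesis fgT : finitely_generated T.

Lemma dual_reflexive (psi : {linear kmod ioA Z -> J}) : exists x, forall z, psi z = d z x.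
Proof.
have [dl dr di ds] := dP.
have /choice[z zP] := ds.
have [|x xP] := @matlis_reflexive _ ck _ _ envJ _ (fun f => psi (z f)) (fg_kmod fB fgT).
  move=> c f g h hP; rewrite -linearP; congr (psi _); apply: di => x.
  by rewrite zP hP [RHS](dual_linl x) !zP.
exists x => y; rewrite -[RHS]/(mklin (dual_lin y) x) -xP; congr (psi _).
by apply: di => u; rewrite zP.
Qed.

(** The annihilator gives an order-reversing bijection between submodules of DT
and of T, which transfers chain conditions and direct decompositions. *)
Definition perp (U : set Z) : set T := [set x | forall z, U z -> d z x = 0].

Lemma perp_sub (U : set Z) : submodule U -> submodule (perp U).
Proof.
move=> sU; have [dl dr _ _] := dP.
split=> [z _|b u v pu pv z Uz]; first exact: dual0r.
rewrite dualDr pv // addr0; have [sK tK _ _] := st.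
by rewrite -(tK b) -dualZ; apply: pu; apply: submodZ.
Qed.

Lemma perp_mem (U : set Z) z : submodule U -> (forall x, perp U x -> d z x = 0) -> U z.
Proof.
move=> sU h; apply: contrapT => nUz.
have [f [fU fz]] := separating_functional ck envJ (submodule_kmod ioA sU) nUz.
have [x xP] := dual_reflexive f; apply: fz; rewrite xP; apply: h => y Uy.
by rewrite -xP fU.
Qed.

Lemma dual_acc : chain_cond true [set: Z].
Proof.
move=> F [U0 FU0] FP.
have cB : chain_cond false [set: T].
  by apply: (chain_cond_kmod (io := ioB)); apply: ck; apply: fg_kmod.
have [||P [[U FU <-] minU]] := cB [set perp U | U in F].
- by exists (perp U0), U0.
- by move=> _ [U FU <-]; split=> //; apply: perp_sub; case: (FP _ FU).
exists U; split=> // W FW UW.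
have E : perp W = perp U by apply: minU; [exists W | move=> x pW z /UW /pW].
apply/seteqP; split=> // z Wz.
by apply: perp_mem; [case: (FP _ FU) | move=> x; rewrite -E; apply].
Qed.

Lemma dual_fg : finitely_generated Z.
Proof.
have [n [v sp]] := acc_finite_span dual_acc (submodule_setT Z).
by apply/fgP; exists n, v.
Qed.

Lemma dual_nonzero : nonzero T -> nonzero Z.
Proof.
move=> [x x0]; apply: contrapT => nz; apply: x0; apply: dual_separates => z.
have -> : z = 0 by apply: contrapT => z0; apply: nz; exists z.
by rewrite dual0l.
Qed.

Lemma dual_indecomposable : indecomposable_module T -> indecomposable_module Z.
Proof.
move=> [nzT indT]; split; first exact: dual_nonzero.
move=> U V sU sV UV0 UVT.
have [_ _ di ds] := dP.
have full (W : set Z) : submodule W -> perp W = [set 0] -> W = setT.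
  move=> sW pW; apply/seteqP; split=> // z _; apply: perp_mem => // x.
  by rewrite pW => ->; rewrite dual0r.
have [||pU|pV] := indT _ _ (perp_sub sU) (perp_sub sV).
- apply/seteqP; split=> [x [pUx pVx]|_ ->]; last by split; apply: submod0; apply: perp_sub.
  apply: dual_separates => z; have [u [v [Uu Vv ->]]] := UVT z.
  by rewrite dualDl pUx // pVx // addr0.
- move=> x; apply: contrapT => nx.
  have ssum := submodule_sum (perp_sub sU) (perp_sub sV).
  have [|f [fs fx]] := separating_functional ck envJ (submodule_kmod ioB ssum) (v := x : kmod ioB T).
    by move=> [u [v [? ? ?]]]; apply: nx; exists u, v.
  have [z zf] := ds f.
  have z0 : (U `&` V) z.
    split; apply: perp_mem => // y py; rewrite zf; apply: fs.
      exact: (sumset_l (perp_sub sV)).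
    exact: (sumset_r (perp_sub sU)).
  by rewrite UV0 in z0; apply: fx; rewrite -zf z0 dual0l.
- by right; move: UV0; rewrite (full _ sU pU) setTI.
- by left; move: UV0; rewrite (full _ sV pV) setIT.
Qed.

End DualPairing.

Lemma dual_pairing_sym (k : comNzRingType) (A B : nzRingType)
  (ioA : {rmorphism k -> A}) (ioB : {rmorphism k -> B}) (s : A -> B) (t : B -> A)
  (J : lmodType k) (e : {linear k^o -> J}) (T : lmodType B) (Z : lmodType A) (d : Z -> T -> J) :
  anti_iso s t -> (forall c, s (ioA c) = ioB c) -> chain_ring k -> fg_algebra ioB ->
  injective_envelope_top e -> finitely_generated T ->
  dual_pairing ioB s d -> dual_pairing ioA t (fun x z => d z x).
Proof.
move=> st sio ck fB envJ fgT dP; split.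
- by move=> x c z z'; exact: (dual_linl sio dP x c z z').
- move=> b x x' z; have [sK tK _ _] := st.
  by rewrite (dualDr dP) (dualZ st dP) tK.
- move=> x y xy; apply/eqP; rewrite -subr_eq0; apply/eqP.
  apply: (dual_separates ck envJ dP) => z.
  by rewrite (dualBr dP) xy subrr.
- by move=> f; have [x xP] := dual_reflexive sio ck fB envJ dP fgT f; exists x.
Qed.

(** * The duality Hom(-, A) on finitely generated projectives *)

Section HomPairing.
Variables (A B : nzRingType) (s : A -> B) (t : B -> A).
Hypothesis st : anti_iso s t.

(** [ev] identifies H with Hom(P, A).  For P finitely generated projective the
notion is symmetric ([hom_pairing_sym]), so P is also the dual of H. *)
Definition hom_pairing (P : lmodType A) (H : lmodType B) (ev : H -> P -> A) :=
  [/\ forall h a x y, ev h (a *: x + y) = a * ev h x + ev h y,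
      forall b h h' x, ev (b *: h + h') x = ev h x * t b + ev h' x,
      forall h h', (forall x, ev h x = ev h' x) -> h = h' &
      forall f : {linear P -> A^o}, exists h, forall x, ev h x = f x].

Lemma hom_module (P : lmodType A) : exists (H : lmodType B) (ev : H -> P -> A), hom_pairing ev.
Proof.
have [sK tK sD sM] := st; have [_ _ tD tM] := anti_iso_sym st.
have mul_lin b (f : {linear P -> A^o}) : linear (fun x : P => (f x : A) * t b : A^o).
  by move=> a x y; rewrite linearP /GRing.scale /= mulrDl mulrA.
have [||||| H [ev [eP ei es]]] := @module_of_homs B A P A^o (fun b f => mklin (mul_lin b f)).
- by move=> b f g fg x; rewrite /= fg.
- by move=> b f g x; rewrite /= mulrDl.
- by move=> b c f x; rewrite /= tD mulrDr.
- by move=> b c f x; rewrite /= tM mulrA.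
- by move=> f x; rewrite /= (anti_iso1 (anti_iso_sym st)) mulr1.
exists H, (fun h => ev h : P -> A); split=> // h a x y; exact: (linearP (ev h)).
Qed.

Variables (P : lmodType A) (H : lmodType B) (ev : H -> P -> A).
Hypothesis evP : hom_pairing ev.

Lemma ev_lin h : linear (ev h : P -> A^o).
Proof. by have [el _ _ _] := evP; move=> a x y; rewrite el. Qed.
Definition evl h : {linear P -> A^o} := mklin (ev_lin h).
Lemma evDr h x y : ev h (x + y) = ev h x + ev h y.
Proof. exact: (linearD (evl h)). Qed.
Lemma evBr h x y : ev h (x - y) = ev h x - ev h y.
Proof. exact: (linearB (evl h)). Qed.
Lemma ev0r h : ev h 0 = 0.
Proof. exact: (linear0 (evl h)). Qed.
Lemma evZr h a x : ev h (a *: x) = a * ev h x.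
Proof. by have [el _ _ _] := evP; rewrite -[a *: x]addr0 el ev0r addr0. Qed.
Lemma ev_sumr h (I : Type) (r : seq I) (F : I -> P) :
  ev h (\sum_(i <- r) F i) = \sum_(i <- r) ev h (F i).
Proof. exact: (linear_sum (evl h) r xpredT F). Qed.
Lemma ev_linl x : linear (fun h => s (ev h x) : B^o).
Proof.
have [_ el _ _] := evP; have [sK tK sD sM] := st.
by move=> b h h'; rewrite el sD sM tK.
Qed.
Lemma evDl h h' x : ev (h + h') x = ev h x + ev h' x.
Proof. by have [_ er _ _] := evP; have := er 1 h h' x; rewrite scale1r (anti_iso1 (anti_iso_sym st)) mulr1. Qed.
Lemma ev0l x : ev 0 x = 0.
Proof. by apply: (addrI (ev 0 x)); rewrite -evDl !addr0. Qed.
Lemma evZl b h x : ev (b *: h) x = ev h x * t b.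
Proof. by have [_ er _ _] := evP; rewrite -[b *: h]addr0 er ev0l addr0. Qed.
Lemma ev_suml (I : Type) (r : seq I) (F : I -> H) x :
  ev (\sum_(i <- r) F i) x = \sum_(i <- r) ev (F i) x.
Proof. by apply: (big_morph (ev^~ x)) => [h h'|]; [exact: evDl | exact: ev0l]. Qed.
Lemma evBl h h' x : ev (h - h') x = ev h x - ev h' x.
Proof. by apply: (addIr (ev h' x)); rewrite -evDl !subrK. Qed.

Hypotheses (prP : projective_module P) (fgP0 : finitely_generated P).

Lemma pairing_bases : exists n (x : 'I_n -> P) (h : 'I_n -> H),
  (forall y, y = \sum_i ev (h i) y *: x i) /\ (forall g, g = \sum_i s (ev g (x i)) *: h i).
Proof.
have [_ el ei es] := evP; have [sK tK sD sM] := st.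
have [n [x [phi xP]]] := dual_basis prP fgP0.
have /choice[h hP] (i : 'I_n) := es (phi i).
exists n, x, h; split=> [y|g]; first by rewrite {1}(xP y); apply: eq_bigr => i _; rewrite hP.
apply: ei => y; rewrite {1}(xP y) ev_sumr.
by rewrite ev_suml; apply: eq_bigr => i _; rewrite evZr evZl sK hP.
Qed.

Lemma hom_pairing_fg : projective_module H /\ finitely_generated H.
Proof.
have [n [x [h [_ hP]]]] := pairing_bases.
exact: (@dual_basis_projective _ _ _ h (fun i => mklin (ev_linl (x i))) hP).
Qed.

Lemma ev_separates x y : (forall h, ev h x = ev h y) -> x = y.
Proof.
move=> E; have [n [u [h [uP _]]]] := pairing_bases.
by rewrite (uP x) (uP y); apply: eq_bigr => i _; rewrite E.
Qed.

Lemma ev_represent (f : {linear H -> B^o}) : exists x, forall h, s (ev h x) = f h.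
Proof.
have [_ tK _ sM] := st.
have [n [u [h [_ hP]]]] := pairing_bases.
exists (\sum_i t (f (h i)) *: u i) => g.
rewrite ev_sumr (anti_iso_sum st) {2}(hP g) linear_sum; apply: eq_bigr => i _.
by rewrite evZr sM tK [in RHS]linearZ.
Qed.
End HomPairing.

Lemma hom_pairing_sym (A B : nzRingType) (s : A -> B) (t : B -> A) (st : anti_iso s t)
  (P : lmodType A) (H : lmodType B) (ev : H -> P -> A) :
  hom_pairing t ev -> projective_module P -> finitely_generated P ->
  hom_pairing s (fun x h => s (ev h x)).
Proof.
move=> evP prP fgP0; have [sK _ sD sM] := st; split.
- by move=> x b h h'; exact: (ev_linl st evP x b h h').
- by move=> a x y h; have [el _ _ _] := evP; rewrite el sD sM.
- move=> x y xy; apply: (ev_separates st evP prP fgP0) => h; exact: (can_inj sK).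
- by move=> f; have [x xP] := ev_represent st evP prP fgP0 f; exists x.
Qed.

Section Adjoint.
Variables (A B : nzRingType) (s : A -> B) (t : B -> A).
Hypothesis st : anti_iso s t.
Variables (P Q : lmodType A) (P' Q' : lmodType B) (ev : P' -> P -> A) (ew : Q' -> Q -> A).
Hypotheses (evP : hom_pairing t ev) (ewP : hom_pairing t ew).

Lemma adjointE (f : {linear P -> Q}) : exists f' : {linear Q' -> P'},
  forall h x, ev (f' h) x = ew h (f x).
Proof.
have [el er ei es] := evP; have [wl wr wi ws] := ewP.
have [|||f' f'P] := @lin_of_graph B Q' P' (fun h g => forall x, ev g x = ew h (f x)).
- by move=> h; have [g gP] := es (evl ewP h \o f : {linear P -> A^o}); exists g.
- move=> g gP; apply: ei => x; rewrite gP.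
  by rewrite (ev0l st ewP) (ev0l st evP).
- by move=> a g g' h h' gP hP x; rewrite er wr gP hP.
by exists f'.
Qed.
End Adjoint.

(** Reflexivity of P and Q makes transposition of maps bijective. *)
Lemma adjoint_back (A B : nzRingType) (s : A -> B) (t : B -> A) (st : anti_iso s t)
  (P Q : lmodType A) (P' Q' : lmodType B) (ev : P' -> P -> A) (ew : Q' -> Q -> A) :
  hom_pairing t ev -> projective_module P -> finitely_generated P ->
  hom_pairing t ew -> projective_module Q -> finitely_generated Q ->
  forall (g : {linear Q' -> P'}), exists f : {linear P -> Q},
  forall h x, ev (g h) x = ew h (f x).
Proof.
move=> evP prP fgP0 ewP prQ fgQ g.
have syv := hom_pairing_sym st evP prP fgP0; have syw := hom_pairing_sym st ewP prQ fgQ.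
have [f fP] := adjointE (anti_iso_sym st) syw syv g; exists f => h x.
by have [sK _ _ _] := st; apply: (can_inj sK); rewrite fP.
Qed.

(** For finitely generated X over a hereditary ring: X has no projective
summand. *)
Definition no_forms (A : nzRingType) (X : lmodType A) := hom_vanishes X A^o.

Lemma no_forms_projective (A : nzRingType) (X P : lmodType A) (f : {linear X -> P}) :
  no_forms X -> projective_module P -> finitely_generated P -> forall x, f x = 0.
Proof.
move=> nX prP fgP0 x; have [n [u [phi uP]]] := dual_basis prP fgP0.
rewrite (uP (f x)) big1 // => i _.
by have /= -> := nX (phi i \o f : {linear X -> A^o}) x; rewrite scale0r.
Qed.

(** The image of a form is an ideal, hence projective, hence a summand of X. *)
Lemma indecomposable_no_forms (A : nzRingType) (X : lmodType A) : ideals_projective A ->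
  indecomposable_module X -> ~ projective_module X -> no_forms X.
Proof.
move=> her [[x0 nx0] indX] nprX f x; apply: contrapT => fx.
have [I [i [ii iP]]] := submodule_module (submodule_im f (submodule_setT X)).
have [|q qP] := factor_mono (f := f) ii; first by move=> y; apply/iP; exists y.
have qo : onto q.
  by move=> w; have /iP[y _ E] : exists w', i w' = i w; [exists w | exists y; apply: ii; rewrite qP].
have prI := her _ i ii.
have [r rP] := projective_split prI qo.
have [||q0|r0] := indX _ _ (submodule_ker q) (submodule_im r (submodule_setT I)).
- apply/seteqP; split=> [y [/= qy [w _ wy]]|_ ->].
    by rewrite -wy; rewrite -wy rP in qy; rewrite qy linear0.
  by split; [rewrite /= linear0 | exists 0; rewrite ?linear0].
- move=> y; exists (y - r (q y)), (r (q y)); split.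
  + by rewrite /= linearB rP subrr.
  + by exists (q y).
  + by rewrite subrK.
- apply: nprX; apply: (retract_projective (f := q) (g := r)) => // y.
  have : [set y | q y = 0] (r (q y) - y) by rewrite /= linearB rP subrr.
  by rewrite q0 => /= /eqP; rewrite subr_eq0 => /eqP.
- apply: fx; rewrite -qP.
  have : [set y | exists2 x, setT x & r x = y] (r (q x)) by exists (q x).
  by rewrite r0 /= => rq; rewrite -(rP (q x)) rq !linear0.
Qed.

(** * The transpose Tr *)

Section Transpose.
Variables (A B : nzRingType) (s : A -> B) (t : B -> A).
Hypothesis st : anti_iso s t.

(** Presentations of X and of T = Tr X that are dual to each other.  The
symmetry [transpose_sym] exchanges X and T, so that Tr Tr X = X. *)
Definition transpose_pairing (X : lmodType A) (T : lmodType B)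
   (P1 P0 : lmodType A) (H1 H0 : lmodType B)
   (p1 : {linear P1 -> P0}) (p0 : {linear P0 -> X})
   (ev1 : H1 -> P1 -> A) (ev0 : H0 -> P0 -> A)
   (q1 : {linear H0 -> H1}) (q0 : {linear H1 -> T}) :=
  [/\ presentation p1 p0, presentation q1 q0, hom_pairing t ev1, hom_pairing t ev0 &
      forall h x, ev1 (q1 h) x = ev0 h (p1 x)].

(** The dual map H0 -> H1 is injective exactly because X has no forms. *)
Lemma transpose_exists (X : lmodType A) : ideals_projective A -> chain_ring A ->
  finitely_generated X -> no_forms X ->
  exists (T : lmodType B) (P1 P0 : lmodType A) (H1 H0 : lmodType B)
   (p1 : {linear P1 -> P0}) (p0 : {linear P0 -> X})
   (ev1 : H1 -> P1 -> A) (ev0 : H0 -> P0 -> A)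
   (q1 : {linear H0 -> H1}) (q0 : {linear H1 -> T}),
   transpose_pairing p1 p0 ev1 ev0 q1 q0.
Proof.
move=> her cA fgX nX.
have [P1 [P0 [p1 [p0 [pp _]]]]] := min_presentation her cA fgX.
have [prP1 prP0 fg1 fg0 [ip op ex]] := pp.
have [H1 [ev1 e1P]] := hom_module st P1; have [H0 [ev0 e0P]] := hom_module st P0.
have [q1 q1P] := adjointE st e1P e0P p1.
have [T [q0 [q0o q0P]]] := quotient_module (submodule_im q1 (submodule_setT H0)).
have [prH1 fgH1] := hom_pairing_fg st e1P prP1 fg1.
have [prH0 fgH0] := hom_pairing_fg st e0P prP0 fg0.
exists T, P1, P0, H1, H0, p1, p0, ev1, ev0, q1, q0; split=> //; split=> //; split=> //.
- apply: inj_ker => h qh; have [_ _ ei _] := e0P; apply: ei => x.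
  have [|g gP] := factor_epi (p := p0) (f := evl e0P h) op.
    by move=> v /ex[y <-] /=; rewrite -q1P qh (ev0l st e1P).
  by rewrite (ev0l st e0P) -[ev0 h x]/(evl e0P h x) -gP; apply: nX.
- by move=> h; rewrite q0P; split=> [[y _ <-]|[y <-]]; exists y.
Qed.

Variables (X : lmodType A) (T : lmodType B)
   (P1 P0 : lmodType A) (H1 H0 : lmodType B)
   (p1 : {linear P1 -> P0}) (p0 : {linear P0 -> X})
   (ev1 : H1 -> P1 -> A) (ev0 : H0 -> P0 -> A)
   (q1 : {linear H0 -> H1}) (q0 : {linear H1 -> T}).
Hypothesis trP : transpose_pairing p1 p0 ev1 ev0 q1 q0.

(** An endomorphism of a presentation that induces 0 on X is null-homotopic; the
dual homotopy shows that the dual endomorphism induces 0 on T. *)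
Lemma transpose_null (e1 : {linear P1 -> P1}) (e0 : {linear P0 -> P0}) (g1 : {linear H1 -> H1}) :
  (forall x, p1 (e1 x) = e0 (p1 x)) -> (forall h x, ev1 (g1 h) x = ev1 h (e1 x)) ->
  (forall x, p0 (e0 x) = 0) -> forall h, q0 (g1 h) = 0.
Proof.
have [[pr1 pr0 _ _ [i1 o0 ex]] [_ _ _ _ [_ _ qex]] e1P e0P adj] := trP.
move=> pe ge pe0 h.
have [K [j [ji jP]]] := submodule_module (submodule_ker p0).
have [|c cP] := factor_mono (f := e0) i1; first by move=> x; apply/ex; apply: pe0.
have [c' c'P] := adjointE st e0P e1P c.
apply/qex; exists (c' h); have [_ _ ei _] := e1P; apply: ei => x.
by rewrite adj c'P ge; congr (ev1 h _); apply: i1; rewrite cP pe.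
Qed.

End Transpose.

Section TransposeIndecomposable.
Variables (A B : nzRingType) (s : A -> B) (t : B -> A).
Hypothesis st : anti_iso s t.
Variables (X : lmodType A) (T : lmodType B)
   (P1 P0 : lmodType A) (H1 H0 : lmodType B)
   (p1 : {linear P1 -> P0}) (p0 : {linear P0 -> X})
   (ev1 : H1 -> P1 -> A) (ev0 : H0 -> P0 -> A)
   (q1 : {linear H0 -> H1}) (q0 : {linear H1 -> T}).
Hypothesis trP : transpose_pairing t p1 p0 ev1 ev0 q1 q0.

Lemma transpose_sym : transpose_pairing s q1 q0 (fun x h => s (ev0 h x))
  (fun x h => s (ev1 h x)) p1 p0.
Proof.
have [pp qq e1P e0P adj] := trP; have [pr1 pr0 fg1 fg0 _] := pp.
split=> //; try exact: (hom_pairing_sym st).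
by move=> x h; rewrite adj.
Qed.

Lemma transpose_nonzero : nonzero X -> nonzero T.
Proof.
move=> [x x0]; apply: contrapT => T0; apply: x0.
have [[_ _ _ _ [_ po _]] _ _ _ _] := trP.
have T0' y : q0 y = 0 by apply: contrapT => ny; apply: T0; exists (q0 y).
have [y <-] := po x.
exact: (@transpose_null _ _ _ _ (anti_iso_sym st) _ _ _ _ _ _ _ _ _ _ _ _ transpose_sym
   idfun idfun idfun).
Qed.

(** The projection eps of T along a decomposition lifts to the presentation and
dualises to an endomorphism e of X.  The lift is idempotent up to homotopy,
hence so is its dual, and e is idempotent because X has no forms.  So e is 0 or
the identity, and then so is eps by [transpose_null]. *)
Lemma transpose_indecomposable : indecomposable_module X -> indecomposable_module T.
Proof.
move=> [nzX indX]; split; first exact: transpose_nonzero.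
have [[pr1 pr0 fg1 fg0 [i1 o0 pex]] [prH0 prH1 _ _ [qi qo qex]] e1P e0P adj] := trP.
move=> U V sU sV UV0 UVT.
have UVe x : U x -> V x -> x = 0 by move=> Ux Vx; have : (U `&` V) x by []; rewrite UV0.
have [|||eps epsP] := @lin_of_graph B T T (fun x u => U u /\ V (x - u)).
- by move=> x; have [u [v [Uu Vv ->]]] := UVT x; exists u; rewrite addrAC subrr add0r.
- by move=> u [Uu]; rewrite sub0r => /(submodN sV); rewrite opprK; apply: UVe.
- move=> a x x' u u' [Uu Vu] [Uu' Vu']; split; first exact: (proj2 sU).
  by rewrite opprD addrACA -scalerBr; apply: (proj2 sV).
have epsU u : U u -> eps u = u.
  move=> Uu; have [Ue Ve] := epsP u; apply/eqP; rewrite eq_sym -subr_eq0; apply/eqP.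
  by apply: UVe => //; apply: submodB.
have [g1 g1P] := prH1 _ _ q0 (eps \o q0 : {linear H1 -> T}) qo.
have [|g0 g0P] := factor_mono (f := g1 \o q1 : {linear H0 -> H1}) qi.
  by move=> x; apply/qex; rewrite /= g1P /=; rewrite (qex (q1 x)).2 ?linear0 //; exists x.
have [e1 e1E] := adjoint_back st e1P pr1 fg1 e1P pr1 fg1 g1.
have [e0 e0E] := adjoint_back st e0P pr0 fg0 e0P pr0 fg0 g0.
have pe x : p1 (e1 x) = e0 (p1 x).
  apply: (ev_separates st e0P pr0 fg0) => h.
  by rewrite -adj -e1E -[g1 (q1 h)]/((g1 \o q1) h) -g0P adj e0E.
have [|e eP] := factor_epi (p := p0) (f := p0 \o e0 : {linear P0 -> X}) o0.
  by move=> v /pex[y <-]; rewrite /= -pe; apply/pex; exists (e1 y).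
have eps2 x : eps (eps x) = eps x by apply: epsU; case: (epsP x).
(* sg is the homotopy between the square of g1 and g1; S below is its dual *)
have [|sg sgP] := factor_mono (f := (g1 \o g1) \- g1 : {linear H1 -> H1}) qi.
  by move=> h; apply/qex; rewrite /= linearB !g1P /= g1P /= eps2 subrr.
have [S SE] := adjoint_back st e0P pr0 fg0 e1P pr1 fg1 sg.
have Se x : S (p1 x) = e1 (e1 x) - e1 x.
  apply: (ev_separates st e1P pr1 fg1) => h.
  by rewrite -SE -adj sgP /= (evBl st e1P) (evBr e1P) !e1E.
have nX : no_forms X.
  move=> f x; have [y <-] := o0 x.
  have [_ _ _ e0s] := e0P.
  have [h hP] := e0s (f \o p0 : {linear P0 -> A^o}).
  have -> : f (p0 y) = ev0 h y by rewrite hP.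
  suff -> : h = 0 by rewrite (ev0l st e0P).
  apply: qi; rewrite linear0; have [_ _ ei _] := e1P; apply: ei => z.
  rewrite adj hP (ev0l st e1P) /=.
  by rewrite (_ : p0 (p1 z) = 0) ?linear0 //; apply/pex; exists z.
have e2 x : e (e x) = e x.
  have [y <-] := o0 x; rewrite !eP /= ?eP /=.
  pose D : {linear P0 -> P0} := (e0 \o e0) \- e0 \- (p1 \o S).
  have [|D' D'P] := factor_epi (p := p0) (f := D) o0.
    by move=> v /pex[z <-]; rewrite /= Se linearB !pe opprB addrA subrK subrr.
  have : D y = 0 by rewrite -D'P; apply: no_forms_projective.
  move=> /= Dy; have : p0 (e0 (e0 y) - e0 y - p1 (S y)) = 0 by rewrite Dy linear0.
  rewrite !linearB (_ : p0 (p1 (S y)) = 0) ?subr0; last by apply/pex; exists (S y).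
  by move=> /eqP; rewrite subr_eq0 => /eqP.
have [||||im0|ke0] := indX [set x | e x = x] [set x | e x = 0].
- split; first by rewrite /= linear0.
  by move=> a x y /= ex ey; rewrite linearP ex ey.
- exact: submodule_ker.
- apply/seteqP; split=> [x [/= -> //]|_ ->]; by rewrite /= linear0.
- move=> x; exists (e x), (x - e x); split; rewrite /= ?e2 ?linearB ?e2 ?subrr //.
  by rewrite addrC subrK.
- left; apply/seteqP; split=> [u Uu|_ ->]; last exact: submod0.
  have [h uh] := qo u.
  have pe0 x : p0 (e0 x) = 0.
    have : [set x | e x = x] (e (p0 x)) by apply: e2.
    by rewrite im0 -[LHS]/((p0 \o e0) x) -eP.
  by rewrite /= -(epsU u Uu) -uh -[eps _]/((eps \o q0) h) -g1P (transpose_null st trP pe e1E pe0).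
- right; apply/seteqP; split=> [v Vv|_ ->]; last exact: submod0.
  have [h vh] := qo v.
  have epsV : eps v = 0.
    have [Ue Ve] := epsP v; apply: UVe => //.
    by have := submodB sV Vv Ve; rewrite opprB addrCA subrr addr0.
  have e1' x : e x = x.
    have : [set x | e x = 0] (x - e x) by rewrite /= linearB e2 subrr.
    by rewrite ke0 => /= /eqP; rewrite subr_eq0 => /eqP <-.
  have := @transpose_null _ _ _ _ st _ _ _ _ _ _ _ _ _ _ _ _ trP
    (e1 \- idfun) (e0 \- idfun) (g1 \- idfun).
  move=> /= /(_ _ _ _ h); rewrite linearB g1P /= vh epsV sub0r => E.
  apply/eqP; rewrite -oppr_eq0 E // => [x|h' x|x].
  + by rewrite linearB pe.
  + by rewrite (evBl st e1P) (evBr e1P) e1E.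
  + by rewrite linearB -[p0 (e0 x)]/((p0 \o e0) x) -eP e1' subrr.
Qed.
End TransposeIndecomposable.

(** * The two sides of an artin algebra *)

Section ConverseAlgebra.
Variables (k : comNzRingType) (R : algType k).
Definition in_calg (c : k) : R^c := (c%:A : R).
Fact in_calg_zmod : zmod_morphism in_calg.
Proof. by move=> c d; rewrite /in_calg scalerBl. Qed.
Fact in_calg_monoid : monoid_morphism in_calg.
Proof.
by split=> [|c d]; rewrite /in_calg ?scale1r // -[RHS]/((d%:A : R) * c%:A) mulr_algl scalerA mulrC.
Qed.
HB.instance Definition _ := GRing.isZmodMorphism.Build k R^c in_calg in_calg_zmod.
HB.instance Definition _ := GRing.isMonoidMorphism.Build k R^c in_calg in_calg_monoid.
Definition ioA : {rmorphism k -> R^c} := in_calg.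
Definition ioB : {rmorphism k -> R} := in_alg R.

(** The identities between R and its converse, as anti-isomorphisms. *)
Definition toR (a : R^c) : R := a.
Definition toC (r : R) : R^c := r.
Lemma anti_idA : anti_iso toR toC. Proof. by []. Qed.
Lemma anti_idB : anti_iso toC toR. Proof. by []. Qed.
Lemma central_A c (a : R^c) : ioA c * a = a * ioA c.
Proof. by rewrite -[LHS]/((a : R) * c%:A) -[RHS]/((c%:A : R) * a) mulr_algl mulr_algr. Qed.
Lemma central_B c (a : R) : ioB c * a = a * ioB c.
Proof. by rewrite /= mulr_algl mulr_algr. Qed.
Lemma kcomb_linear c (V W : lmodType R^c) (f g : {linear V -> W}) :
  linear (fun y => in_calg c *: f y + g y).
Proof.
move=> b y z; rewrite !linearP !scalerDr !scalerA (central_A c b) -!addrA; congr (_ + _).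
by rewrite addrCA.
Qed.
Lemma fg_algebra_B : artin_algebra R -> fg_algebra ioB.
Proof.
move=> [_ [n [g gP]]]; exists n, g => a; have [c ->] := gP a; exists c.
by apply: eq_bigr => i _; rewrite /= mulr_algl.
Qed.
Lemma fg_algebra_A : artin_algebra R -> fg_algebra ioA.
Proof.
move=> [_ [n [g gP]]]; exists n, g => a; have [c ->] := gP a; exists c.
by apply: eq_bigr => i _; rewrite -[RHS]/((g i : R) * (c i)%:A) mulr_algr.
Qed.
End ConverseAlgebra.

(** * Auslander-Reiten formulas *)

Section TauFormulas.
Variables (k : comNzRingType) (R : algType k).
Notation A := (R^c).
Notation ioA := (ioA R).
Notation ioB := (ioB R).
Hypothesis ck : chain_ring k.
Variables (Y P1 P0 : lmodType A) (p1 : {linear P1 -> P0}) (p0 : {linear P0 -> Y}).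
Hypothesis pres : presentation p1 p0.
Variables (T : lmodType R) (tr : {linear P1 -> R^c^o} -> T).
Hypotheses
  (trP : forall (r : R) (f g h : {linear P1 -> R^c^o}),
     (forall x, (h x : R) = r * (f x : R) + (g x : R)) -> tr h = r *: tr f + tr g)
  (tro : onto tr)
  (trk : forall f, tr f = 0 <-> exists g : {linear P0 -> R^c^o}, forall x, f x = g (p1 x)).
Variables (J : lmodType k) (e : {linear k^o -> J}).
Hypothesis envJ : injective_envelope_top e.
Variables (Z : lmodType A) (d : Z -> T -> J).
Hypothesis dP : dual_pairing ioB (@toR k R) d.
Let st := anti_idA R.

Lemma dual_scale c z u : d (in_calg R c *: z) u = c *: d z u.
Proof.
have [dl _ _ _] := dP; rewrite (dualZ st dP).
by have := dl z c u 0; rewrite (dual0r dP) !addr0.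
Qed.

Lemma tr_comb n (a : 'I_n -> R) (phi : 'I_n -> {linear P1 -> R^c^o}) (f : {linear P1 -> R^c^o}) :
  (forall y, (f y : R) = \sum_i a i * (phi i y : R)) -> tr f = \sum_i a i *: tr (phi i).
Proof.
elim: n a phi f => [|n IH] a phi f fP.
  rewrite big_ord0; apply/trk; exists \0 => y /=.
  by have := fP y; rewrite big_ord0.
have gl : linear (fun y => \sum_(i < n) a (lift ord0 i) * (phi (lift ord0 i) y : R) : R^c^o).
  move=> b x y; rewrite scaler_sumr -big_split /=; apply: eq_bigr => i _.
  rewrite linearP /= mulrDr; congr (_ + _).
  by rewrite /GRing.scale /=; apply: (mulrA (a (lift ord0 i)) (phi (lift ord0 i) x : R) (b : R)).
rewrite big_ord_recl -(IH (a \o lift ord0) (phi \o lift ord0) (mklin gl)) //.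
by apply: trP => y; rewrite fP big_ord_recl.
Qed.

Section HomsToTau.
Variable M : lmodType A.

Lemma rank1_linear (m : M) (P : lmodType A) (phi : {linear P -> A^o}) :
  linear (fun x => (phi x : A) *: m).
Proof. by move=> a x y; rewrite linearP scalerDl -scalerA. Qed.
Definition rank1 m (P : lmodType A) (phi : {linear P -> A^o}) : {linear P -> M} :=
  mklin (rank1_linear m phi).

(** The functional on Hom(P1, M) attached to h : M -> tau Y = DTr Y: under
Hom(P1, M) = M (x) Hom(P1, A) it sends m (x) phi to h(m)(tr phi)
([Phi_rank1]).  It kills the maps that extend to P0, so h is a functional on
Ext^1(Y, M); [Phi_onto] shows that every functional arises in this way. *)
Definition Phi n (x : 'I_n -> P1) (phi : 'I_n -> {linear P1 -> A^o})
  (h : {linear M -> Z}) (f : {linear P1 -> M}) : J :=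
  \sum_i d (h (f (x i))) (tr (phi i)).

Variables (n : nat) (x : 'I_n -> P1) (phi : 'I_n -> {linear P1 -> A^o}).
Hypothesis xP : forall y, y = \sum_i (phi i y : A) *: x i.

Lemma Phi_rank1 h m f : Phi x phi h (rank1 m f) = d (h m) (tr f).
Proof.
rewrite (@tr_comb _ (fun i => f (x i)) phi).
  rewrite (dual_sum dP); apply: eq_bigr => i _.
  by rewrite /= linearZ (dualZ st dP).
by move=> y; rewrite {1}(xP y) linear_sum; apply: eq_bigr => i _; rewrite linearZ.
Qed.

Lemma Phi_sum h m (I : 'I_m -> {linear P1 -> M}) (f : {linear P1 -> M}) : (forall y, f y = \sum_i I i y) ->
  Phi x phi h f = \sum_i Phi x phi h (I i).
Proof.
move=> fP; rewrite /Phi exchange_big /=; apply: eq_bigr => i _.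
rewrite fP linear_sum; apply: (big_morph (d^~ (tr (phi i)))) => [z z'|].
  exact: (dualDl st dP).
exact: (dual0l st dP).
Qed.

(** Write G as a sum of maps of rank 1 through a dual basis of P0; each
restricts to P1 as a map of rank 1 whose form is a boundary, killed by tr. *)
Lemma Phi_ext h (G : {linear P0 -> M}) : Phi x phi h (G \o p1) = 0.
Proof.
have [_ pr0 _ fg0 _] := pres; have [m [z [ga zP]]] := dual_basis pr0 fg0.
rewrite (@Phi_sum h m (fun a => rank1 (G (z a)) (ga a \o p1 : {linear P1 -> A^o}))).
  rewrite big1 // => a _; rewrite Phi_rank1.
  by rewrite (trk _).2 ?(dual0r dP) //; exists (ga a).
by move=> y /=; rewrite {1}(zP (p1 y)) linear_sum; apply: eq_bigr => a _; rewrite linearZ.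
Qed.

(** All maps P1 -> M, an ambient k-module for the functionals on Hom(P1, M). *)
Definition funmod : lmodType k := dprod (fun _ : P1 => kmod ioA M).

(** h(m) is determined by h(m)(tr phi) = Psi(m (x) phi). *)
Lemma Phi_onto (Psi : {linear funmod -> J}) :
  (forall G : {linear P0 -> M}, Psi (G \o p1 : P1 -> M) = 0) ->
  exists h, forall f : {linear P1 -> M}, Phi x phi h f = Psi (f : P1 -> M).
Proof.
move=> PsiG; have [_ dr di ds] := dP.
have func m : exists g : {linear kmod ioB T -> J}, forall f, g (tr f) = Psi (rank1 m f : P1 -> M).
  have [] := @lin_of_graph k (kmod ioB T) J (fun t j => exists2 f, tr f = t & j = Psi (rank1 m f : P1 -> M)).
  - by move=> u; have [f <-] := tro u; exists (Psi (rank1 m f : P1 -> M)), f.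
  - move=> j [f /trk[g gP] ->]; rewrite -(PsiG (rank1 m g)); congr (Psi _).
    by apply/funext => y; rewrite /= gP.
  - move=> c u v j j' [f <- ->] [g <- ->].
    have hl : linear (fun y => (c%:A : R) * (f y : R) + (g y : R) : A^o).
      move=> b y z; rewrite !linearP /= mulrDr scalerDr addrACA; congr (_ + _ + _).
      by rewrite /GRing.scale /=; apply: (mulrA (c%:A : R) (f y : R) (b : R)).
    exists (mklin hl); first by rewrite (trP (r := c%:A) (f := f) (g := g)).
    rewrite -linearP; congr (Psi _); apply/funext => y /=.
    rewrite [in RHS]scalerDl; congr (_ + _); apply/esym.
    rewrite -[RHS]/((c%:A : A) *: ((f y : A) *: m)) scalerA; congr (_ *: m).
    by rewrite -[RHS]/((f y : R) * (c%:A : R)) mulr_algl mulr_algr.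
  move=> g gP; exists g => f; have [f' ff' ->] := gP (tr f).
  apply/eqP; rewrite -subr_eq0 -linearB.
  have fl : linear (fun y => (f' y : A^o) - f y).
    by move=> b y z /=; rewrite [f' (_ + _)]linearP [f (_ + _)]linearP opprD addrACA scalerBr.
  have : tr (mklin fl) = 0.
    rewrite (trP (r := -1) (f := f) (g := f')); first by rewrite ff' scaleN1r addNr.
    by move=> y; rewrite mulN1r addrC.
  move=> /trk[G GP]; rewrite -(PsiG (rank1 m G)); apply/eqP; congr (Psi _).
  apply/funext => y; rewrite /= -GP /= scalerBl //.
have /choice[h hP] m : exists z, forall f, d z (tr f) = Psi (rank1 m f : P1 -> M).
  by have [g gP] := func m; have [z zP] := ds g; exists z => f; rewrite zP.
have hl : linear h.
  move=> a m m'; apply: di => u; have [f <-] := tro u.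
  have gl : linear (fun y => (toR a) * (f y : R) : A^o).
    move=> b y z; rewrite linearP /= mulrDr; congr (_ + _).
    by rewrite /GRing.scale /=; apply: (mulrA (toR a) (f y : R) (b : R)).
  have gE : tr (mklin gl) = toR a *: tr f.
    by rewrite (@tr_comb 1 (fun=> toR a) (fun=> f)) ?big_ord1 // => y; rewrite big_ord1.
  rewrite dr -gE !hP -linearD; congr (Psi _); apply/funext => y /=.
  by rewrite scalerDr scalerA.
exists (mklin hl) => f.
have -> : (f : P1 -> M) = \sum_i (rank1 (f (x i)) (phi i) : funmod).
  apply/funext => y; rewrite (big_morph (fun g : funmod => g y) (id1 := 0) (op1 := +%R)) //.
  by rewrite {1}(xP y) linear_sum; apply: eq_bigr => i _; rewrite linearZ.
by rewrite linear_sum; apply: eq_bigr => i _; rewrite /= hP.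
Qed.
End HomsToTau.

(** If every map P1 -> M extends to P0, then so do the maps of rank 1, and the
functional attached to h vanishes on them. *)
Lemma hom_tau_zero M : ext_vanishes Y M -> hom_vanishes M Z.
Proof.
move=> eYM h m; have [_ _ di _] := dP; have [pr1 _ fg1 _ se] := pres.
have [n [x [phi xP]]] := dual_basis pr1 fg1.
apply: di => u; have [f <-] := tro u; rewrite (dual0l st dP) -(Phi_rank1 xP).
have [G GP] := eYM _ _ _ _ se (rank1 m f).
rewrite -(Phi_ext xP h G) /Phi; apply: eq_bigr => i _; congr (d (h _) _).
by rewrite -GP.
Qed.

Lemma nonextendable_functional (M : lmodType A) (f : {linear P1 -> M}) n (x : 'I_n -> P1)
   (phi : 'I_n -> {linear P1 -> A^o}) :
  (forall y, y = \sum_i (phi i y : A) *: x i) ->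
  ~ (exists G : {linear P0 -> M}, forall y, G (p1 y) = f y) ->
  exists h : {linear M -> Z}, Phi x phi h f <> 0.
Proof.
move=> xP nG; pose U : set (funmod M) := [set g | exists G : {linear P0 -> M}, g = (G \o p1 : P1 -> M)].
have sU : submodule U.
  split; first by exists \0.
  move=> c _ _ [G ->] [G' ->].
  by exists (mklin (kcomb_linear c G G')).
have [|Psi [PsiU Psif]] := separating_functional ck envJ sU (v := (f : P1 -> M) : funmod M).
  by move=> [G fG]; apply: nG; exists G => y; rewrite fG.
have [G|h hP] := Phi_onto xP (Psi := Psi); first by apply: PsiU; exists G.
by exists h; rewrite hP.
Qed.

Lemma ext_zero_of_hom_tau (M : lmodType A) : hom_vanishes M Z -> ext_vanishes Y M.
Proof.
move=> h0; have [pr1 pr0 fg1 _ se] := pres.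
have [n [x [phi xP]]] := dual_basis pr1 fg1.
apply: (ext_vanishesP pr0 se) => f; apply: contrapT => nG.
have [h] := nonextendable_functional xP nG; apply; rewrite /Phi big1 // => i _.
by rewrite h0 (dual0l st dP).
Qed.

(** A homomorphism f : L -> tau Y is a functional on Hom(P1, L), and it extends
to Q when this functional extends to Hom(P1, Q) and kills the maps coming from
P0.  The obstruction is a map u : P0 -> Q whose restriction to P1 lies in L; it
induces a map Y -> X, which is zero, so u itself lies in L. *)
Lemma ext_tau_zero (X : lmodType A) : hom_vanishes Y X -> ext_vanishes X Z.
Proof.
move=> g0 L Q i q [ii qo qex] f; have [pr1 pr0 fg1 _ [_ p0o pex]] := pres.
have [n [x [phi xP]]] := dual_basis pr1 fg1.
pose G : set (funmod Q * J)%type := [set vj | exists (g : {linear P1 -> L}) (u : {linear P0 -> Q}),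
  vj = ((fun y => i (g y) + u (p1 y)), Phi x phi f g)].
have landing (g : {linear P1 -> L}) (u : {linear P0 -> Q}) :
    (forall y, i (g y) + u (p1 y) = 0) -> exists w : {linear P0 -> L}, forall y, g y = - w (p1 y).
  move=> gu; have qi l : q (i l) = 0 by apply/qex; exists l.
  have [|c cP] := factor_epi (p := p0) (f := q \o u : {linear P0 -> X}) p0o.
    move=> v /pex[y <-] /=; have /eqP := gu y; rewrite addrC addr_eq0 => /eqP ->.
    by rewrite linearN qi oppr0.
  have [|w wP] := factor_mono (f := u) ii.
    by move=> v; apply/qex; rewrite -[q _]/((q \o u) v) -cP g0.
  exists w => y; apply: ii; rewrite linearN wP; apply/eqP; rewrite -addr_eq0; apply/eqP; exact: gu.
have [|Psi PsiP] := extend_functional envJ (V := funmod Q) (G := G).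
  split; [split|].
  - exists \0, \0; congr (_, _).
      by apply/funext => y; rewrite /= linear0 addr0.
    by rewrite /Phi big1 // => l _; rewrite linear0 (dual0l st dP).
  - move=> c _ _ [g [u ->]] [g' [u' ->]].
    exists (mklin (kcomb_linear c g g')), (mklin (kcomb_linear c u u')); congr (_, _).
      by apply/funext => y; rewrite /= linearP addrACA -scalerDr.
    rewrite /= /Phi scaler_sumr -big_split /=; apply: eq_bigr => l _.
    rewrite /= [in RHS]linearP; rewrite (dualDl st dP); congr (_ + _); apply/esym; exact: dual_scale.
  - move=> j [g [u [gu ->]]].
    have [|w wP] := landing g u; first by move=> y; rewrite -[RHS]/((0 : funmod Q) y) gu.
    have := Phi_ext xP f (\- w : {linear P0 -> L}); rewrite /Phi => E; rewrite -[RHS]E.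
    by apply: eq_bigr => l _; rewrite wP.
have [u|F FP] := Phi_onto xP (Psi := Psi).
  apply: PsiP; exists \0, u; congr (_, _).
    by apply/funext => y; rewrite /= linear0 add0r.
  by rewrite /Phi big1 // => l _; rewrite linear0 (dual0l st dP).
exists F => l; have [_ _ di _] := dP; apply: di => a; have [g <-] := tro a.
rewrite -(Phi_rank1 xP f) -(Phi_rank1 xP F) FP; apply: PsiP; exists (rank1 l g), \0.
congr (_, _); apply/funext => y; by rewrite /= addr0 linearZ.
Qed.

(** g lifts to a map of presentations (u, v).  If v : P1 -> L did not extend to
P0, a functional would detect it; but the corresponding L -> tau Y extends to
Q, where v extends as u.  So v extends by w, and u - i w factors through
Y -> Q, which is zero; hence g = 0. *)
Lemma hom_zero_of_ext_tau (X L Q : lmodType A) (i : {linear L -> Q}) (q : {linear Q -> X}) :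
  no_forms Y -> presentation i q -> ext_vanishes X Z -> hom_vanishes Y X.
Proof.
move=> nY pq eXZ g y; have [pr1 pr0 fg1 _ [p1i p0o pex]] := pres.
have [n [x [phi xP]]] := dual_basis pr1 fg1.
have [_ prQ _ fgQ seq] := pq; have [ii qo qex] := seq.
have [u uP] := pr0 _ _ q (g \o p0 : {linear P0 -> X}) qo.
have [|v vP] := factor_mono (f := u \o p1 : {linear P1 -> Q}) ii.
  by move=> z; apply/qex; rewrite uP /= (_ : p0 _ = 0) ?linear0 //; apply/pex; exists z.
have [w wP] : exists w : {linear P0 -> L}, forall z, w (p1 z) = v z.
  apply: contrapT => nw; have [f fv] := nonextendable_functional xP nw; apply: fv.
  have [F FP] := eXZ _ _ _ _ seq f.
  rewrite -(Phi_ext xP F u) /Phi; apply: eq_bigr => l _; congr (d _ _).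
  by rewrite -FP vP.
have [|c cP] := factor_epi (p := p0) (f := u \- (i \o w) : {linear P0 -> Q}) p0o.
  by move=> z /pex[z' <-]; rewrite /= wP vP subrr.
have [z <-] := p0o y.
have : u z - i (w z) = 0 by rewrite -[LHS]/((u \- (i \o w)) z) -cP; apply: no_forms_projective.
move=> /eqP; rewrite subr_eq0 => /eqP uz; rewrite -[LHS]/((g \o p0) z) -uP uz.
by apply/qex; exists (w z).
Qed.

End TauFormulas.

(** * The translate DTr and its inverse *)

Section Iso.
Variable A : nzRingType.
Lemma iso_inv (X Y : lmodType A) : isomorphic X Y ->
  exists (f : {linear X -> Y}) (g : {linear Y -> X}), cancel f g /\ cancel g f.
Proof.
move=> [f [g fK gK]]; exists f.
have gl : linear g by move=> a u v; rewrite -{1}(gK u) -{1}(gK v) -linearP fK.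
by exists (mklin gl).
Qed.
Lemma iso_refl (X : lmodType A) : isomorphic X X.
Proof. by exists idfun; exists id. Qed.
End Iso.

Section DTr.
Variables (k : comNzRingType) (R : algType k).
Hypotheses (artR : artin_algebra R) (herR : hereditary R).
Notation A := (R^c).
Implicit Types X Y Z M P Q D : lmodType A.

Let ck : chain_ring k. Proof. by apply: chain_ring_k; case: artR. Qed.
Let fA : fg_algebra (ioA R). Proof. exact: fg_algebra_A. Qed.
Let fB : fg_algebra (ioB R). Proof. exact: fg_algebra_B. Qed.
Let cA : chain_ring A.
Proof. by apply: (chain_ring_alg (io := ioA R)) => //; case: artR. Qed.
Let cB : chain_ring R.
Proof. by apply: (chain_ring_alg (io := ioB R)) => //; case: artR. Qed.
Let herA : ideals_projective A. Proof. by case: herR. Qed.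
Let herB : ideals_projective R. Proof. by case: herR. Qed.

Lemma comparison (X P1 P0 Q1 Q0 : lmodType A) (p1 : {linear P1 -> P0}) (p0 : {linear P0 -> X})
  (q1 : {linear Q1 -> Q0}) (q0 : {linear Q0 -> X}) :
  presentation p1 p0 -> presentation q1 q0 ->
  exists (a0 : {linear P0 -> Q0}) (a1 : {linear P1 -> Q1}),
    (forall x, q0 (a0 x) = p0 x) /\ forall x, q1 (a1 x) = a0 (p1 x).
Proof.
move=> [_ pr0 _ _ [_ _ pex]] [_ _ _ _ [qi qo qex]].
have [a0 a0P] := pr0 _ _ q0 p0 qo.
have [|a1 a1P] := factor_mono (f := a0 \o p1 : {linear P1 -> Q0}) qi.
  by move=> x; apply/qex; rewrite /= a0P; apply/pex; exists x.
by exists a0, a1.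
Qed.

Lemma null_homotopy (X P1 P0 Q1 Q0 : lmodType A) (p1 : {linear P1 -> P0}) (p0 : {linear P0 -> X})
  (q1 : {linear Q1 -> Q0}) (q0 : {linear Q0 -> X})
  (a0 : {linear P0 -> Q0}) (a1 : {linear P1 -> Q1}) (b0 : {linear Q0 -> P0}) (b1 : {linear Q1 -> P1}) :
  presentation p1 p0 ->
  (forall x, q0 (a0 x) = p0 x) -> (forall x, q1 (a1 x) = a0 (p1 x)) ->
  (forall x, p0 (b0 x) = q0 x) -> (forall x, p1 (b1 x) = b0 (q1 x)) ->
  exists c : {linear P0 -> P1}, forall x, b1 (a1 x) = x + c (p1 x).
Proof.
move=> [_ _ _ _ [pi po pex]] a0P a1P b0P b1P.
have [|c cP] := factor_mono (f := (b0 \o a0) \- idfun : {linear P0 -> P0}) pi.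
  by move=> x; apply/pex; rewrite /= linearB b0P a0P subrr.
exists c => x; apply: pi; rewrite linearD cP /= b1P a1P.
by rewrite addrC subrK.
Qed.

(** Tr does not depend on the presentation: two presentations are homotopy
equivalent, so the cokernel can be computed from the minimal one. *)
Lemma transpose_of_pairing X (T : lmodType R) (P1 P0 : lmodType A) (H1 H0 : lmodType R)
   (p1 : {linear P1 -> P0}) (p0 : {linear P0 -> X})
   (ev1 : H1 -> P1 -> A) (ev0 : H0 -> P0 -> A)
   (q1 : {linear H0 -> H1}) (q0 : {linear H1 -> T}) :
  finitely_generated X ->
  transpose_pairing (@toC k R) p1 p0 ev1 ev0 q1 q0 -> is_transpose X T.
Proof.
move=> fgX [pp qq e1P e0P adj]; pose st := anti_idA R.
have [M1 [M0 [m1 [m0 [mm sup]]]]] := min_presentation herA cA fgX.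
have [a0 [a1 [a0P a1P]]] := comparison pp mm.
have [b0 [b1 [b0P b1P]]] := comparison mm pp.
have [c cP] := null_homotopy pp a0P a1P b0P b1P.
have [c' c'P] := null_homotopy mm b0P b1P a0P a1P.
have [_ _ e1i e1s] := e1P; have [_ _ _ e0s] := e0P.
have [_ _ _ _ [_ qo qex]] := qq; have [mr1 mr0 _ _ [mi mo mex]] := mm.
have /choice[rp rpP] (f : {linear M1 -> A^o}) := e1s (f \o a1 : {linear P1 -> A^o}).
exists M1, M0, m1, m0, (fun f => q0 (rp f)); split.
- split=> //; split=> //; move=> U sU UT; apply/seteqP; split=> // x _.
  have [u [y [Uu /= my ->]]] := UT x.
  by have -> : y = 0 by [apply: mi; rewrite my linear0]; rewrite addr0.
- move=> r f g h hP; rewrite -linearP; congr (q0 _); apply: e1i => x.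
  have [_ -> _ _] := e1P; rewrite !rpP; exact: hP.
- move=> t; have [h <-] := qo t.
  exists (evl e1P h \o b1 : {linear M1 -> A^o}).
  have [h0 h0P] := e0s (evl e1P h \o c : {linear P0 -> A^o}).
  have -> : rp (evl e1P h \o b1) = h + q1 h0.
    apply: e1i => x; rewrite rpP /= cP (evDr e1P) (evDl st e1P) adj h0P //.
  by rewrite linearD (qex (q1 h0)).2 ?addr0 //; exists h0.
- move=> f; rewrite qex; split=> [[h hE]|[g gP]].
    have fa x : f (a1 x) = ev0 h (p1 x) by rewrite -adj hE rpP.
    have gl : linear (fun y => (evl e0P h (b0 y) : A^o) - f (c' y)).
      by move=> b y z; rewrite [b0 _]linearP [c' _]linearP [evl _ _ _]linearP [f _]linearP opprD addrACA scalerBr.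
    exists (mklin gl) => x; rewrite /= -b1P -fa c'P linearD addrK //.
  have [h hP] := e0s (g \o a0 : {linear P0 -> A^o}).
  exists h; apply: e1i => x; rewrite adj hP rpP /= gP a1P //.
Qed.

Lemma is_dualP (T : lmodType R) Z (J : lmodType k) (e : {linear k^o -> J}) (d : Z -> T -> J) :
  injective_envelope_top e -> dual_pairing (ioB R) (@toR k R) d -> is_dual T Z.
Proof.
move=> envJ [dl dr di ds]; exists J, e, d; split=> //.
- by move=> y y' E; apply: di => x; rewrite E.
- move=> f fl; have fl' : linear (f : kmod (ioB R) T -> J) by move=> c x y; apply: fl.
  by have [y yP] := ds (mklin fl'); exists y; apply/funext.
Qed.

Lemma DTr_exists X : indecomposable_fg X -> ~ projective_module X ->
  exists Z, indecomposable_fg Z /\ is_DTr X Z.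
Proof.
move=> [indX fgX] npX.
have nX := indecomposable_no_forms herA indX npX.
have [T [P1 [P0 [H1 [H0 [p1 [p0 [ev1 [ev0 [q1 [q0 trP]]]]]]]]]]] :=
  transpose_exists (anti_idA R) herA cA fgX nX.
have indT := transpose_indecomposable (anti_idA R) trP indX.
have [_ [_ _ _ fgH1 [_ qo _]] _ _ _] := trP.
have fgT := fg_onto qo fgH1.
have [J [e envJ]] := injective_envelope_exists k.
have [Z [d dP]] := dual_module J (anti_idA R) (fun c => erefl : toR (ioA R c) = ioB R c) (@central_A k R) T.
exists Z; split; last first.
  by exists T; [apply: transpose_of_pairing trP | exact: is_dualP envJ dP].
have sioA c : toR (ioA R c) = ioB R c by [].
split; first exact: (dual_indecomposable (anti_idA R) sioA ck fB envJ dP fgT indT).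
exact: (dual_fg (anti_idA R) sioA ck fB envJ dP fgT).
Qed.

(** Apply the construction of Tr to the left module T = DX.  T is not
projective, since otherwise X = DT would be injective. *)
Lemma TrD_exists X : indecomposable_fg X -> ~ injective_module X ->
  exists Y, indecomposable_fg Y /\ is_DTr Y X.
Proof.
move=> [indX fgX] niX.
have [J [e envJ]] := injective_envelope_exists k.
have sioB c : toC (ioB R c) = ioA R c by [].
have sioA c : toR (ioA R c) = ioB R c by [].
have [T [d dP]] := dual_module J (anti_idB R) sioB (@central_B k R) X.
have indT := dual_indecomposable (anti_idB R) sioB ck fA envJ dP fgX indX.
have fgT := dual_fg (anti_idB R) sioB ck fA envJ dP fgX.
have dP' := dual_pairing_sym (anti_idB R) sioB ck fA envJ fgX dP.
have npT : ~ projective_module T.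
  move=> prT; apply: niX.
  exact: (dual_projective_injective (anti_idA R) sioA (@central_A k R) envJ dP' prT fgT).
have nT := indecomposable_no_forms herB indT npT.
have [Y [P1 [P0 [H1 [H0 [p1 [p0 [ev1 [ev0 [q1 [q0 trP]]]]]]]]]]] :=
  transpose_exists (anti_idB R) herB cB fgT nT.
have indY := transpose_indecomposable (anti_idB R) trP indT.
have [_ [_ _ _ fgH1 [_ qo _]] _ _ _] := trP.
have fgY := fg_onto qo fgH1.
exists Y; split=> //; exists T; last exact: is_dualP envJ dP'.
exact: transpose_of_pairing (transpose_sym (anti_idB R) trP).
Qed.

(** The data hidden in [is_DTr], with the minimal presentation weakened to a
finitely generated one. *)
Definition ar_data Y Z (P1 P0 : lmodType A) (p1 : {linear P1 -> P0}) (p0 : {linear P0 -> Y})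
    (T : lmodType R) (tr : {linear P1 -> A^o} -> T) (J : lmodType k) (e : {linear k^o -> J})
    (d : Z -> T -> J) :=
  [/\ presentation p1 p0,
      forall (r : R) (f g h : {linear P1 -> A^o}),
        (forall x, (h x : R) = r * (f x : R) + (g x : R)) -> tr h = r *: tr f + tr g,
      onto tr,
      forall f, tr f = 0 <-> exists g : {linear P0 -> A^o}, forall x, f x = g (p1 x) &
      injective_envelope_top e /\ dual_pairing (ioB R) (@toR k R) d].

Lemma is_DTr_data Y Z : finitely_generated Y -> is_DTr Y Z ->
  exists (P1 P0 : lmodType A) (p1 : {linear P1 -> P0}) (p0 : {linear P0 -> Y})
    (T : lmodType R) (tr : {linear P1 -> A^o} -> T) (J : lmodType k) (e : {linear k^o -> J})
    (d : Z -> T -> J),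
  @ar_data Y Z P1 P0 p1 p0 T tr J e d.
Proof.
move=> fgY [T [P1 [P0 [p1 [p0 [tr [mp trP tro trk]]]]]] [J [e [d [envJ dl dr di ds]]]]].
exists P1, P0, p1, p0, T, tr, J, e, d; split=> //.
  exact: (presentation_fg herA cA fgY mp).
split=> //; split=> //.
- by move=> z z' zz'; apply: di; apply/funext.
- move=> f; have [|z zP] := ds f; last by exists z => x; rewrite zP.
  by move=> c x y; rewrite -linearP.
Qed.

Lemma DTr_fg Y Z : finitely_generated Y -> is_DTr Y Z -> finitely_generated Z.
Proof.
move=> fgY /(is_DTr_data fgY)[P1 [P0 [p1 [p0 [T [tr [J [e [d [pp trP tro trk [envJ dP]]]]]]]]]]].
have [pr1 _ fg1 _ _] := pp.
have [n [x [phi xP]]] := dual_basis pr1 fg1.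
have sioA c : toR (ioA R c) = ioB R c by [].
apply: (dual_fg (anti_idA R) sioA ck fB envJ dP).
apply/fgP; exists n, (fun i => tr (phi i)) => u; split=> // _.
have [f <-] := tro u; exists (fun i => f (x i) : R).
apply: (tr_comb trP trk) => y.
by rewrite {1}(xP y) linear_sum; apply: eq_bigr => i _; rewrite linearZ.
Qed.

(** The next four statements restate the formulas of the previous section for
Z = tau Y. *)
Lemma hom_DTr_zero Y Z M : finitely_generated Y -> is_DTr Y Z ->
  ext_vanishes Y M -> hom_vanishes M Z.
Proof.
move=> fgY /(is_DTr_data fgY)[P1 [P0 [p1 [p0 [T [tr [J [e [d [pp trP tro trk [envJ dP]]]]]]]]]]].
exact: (hom_tau_zero pp trP tro trk dP).
Qed.

Lemma ext_zero_of_hom_DTr Y Z M : finitely_generated Y -> is_DTr Y Z ->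
  hom_vanishes M Z -> ext_vanishes Y M.
Proof.
move=> fgY /(is_DTr_data fgY)[P1 [P0 [p1 [p0 [T [tr [J [e [d [pp trP tro trk [envJ dP]]]]]]]]]]].
exact: (ext_zero_of_hom_tau ck pp trP tro trk envJ dP).
Qed.

Lemma ext_DTr_zero Y Z X : finitely_generated Y -> is_DTr Y Z ->
  hom_vanishes Y X -> ext_vanishes X Z.
Proof.
move=> fgY /(is_DTr_data fgY)[P1 [P0 [p1 [p0 [T [tr [J [e [d [pp trP tro trk [envJ dP]]]]]]]]]]].
exact: (ext_tau_zero pp trP tro trk envJ dP).
Qed.

Lemma hom_zero_of_ext_DTr Y Z X : finitely_generated Y -> finitely_generated X -> is_DTr Y Z ->
  no_forms Y -> ext_vanishes X Z -> hom_vanishes Y X.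
Proof.
move=> fgY fgX /(is_DTr_data fgY)[P1 [P0 [p1 [p0 [T [tr [J [e [d [pp trP tro trk [envJ dP]]]]]]]]]]] nY eXZ.
have [L [Q [i [q [pq _]]]]] := min_presentation herA cA fgX.
exact: (hom_zero_of_ext_tau ck pp trP tro trk envJ dP nY pq eXZ).
Qed.

Lemma ext1_zero_vanishes X Y : ext1_zero X Y -> ext_vanishes X Y.
Proof.
move=> [K [P [i [p [prP se E]]]]]; apply: (ext_vanishesP prP se) => f.
have : (@homs k R K Y) f by exists f.
by rewrite -E => -[g gE]; exists g => x; rewrite gE.
Qed.

Lemma vanishes_ext1_zero X Y : finitely_generated X -> ext_vanishes X Y -> ext1_zero X Y.
Proof.
move=> fgX eXY; have [K [P [i [p [pp _]]]]] := min_presentation herA cA fgX.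
have [_ prP _ _ se] := pp; exists K, P, i, p; split=> //.
apply/seteqP; split=> f [g ->]; first by exists (g \o i).
by have [h hP] := eXY _ _ _ _ se g; exists h; apply/funext => x; rewrite /= hP.
Qed.

Lemma DTr_iso Y Y' Z : isomorphic Y' Y -> is_DTr Y Z -> is_DTr Y' Z.
Proof.
move=> /iso_inv[f [g [fK gK]]] [T [P1 [P0 [p1 [p0 [tr [[pr1 pr0 po ex [s0 s1]] ? ? ?]]]]]] dT].
exists T => //; exists P1, P0, p1, (g \o p0 : {linear P0 -> Y'}), tr; split=> //.
have kerE : [set x | (g \o p0) x = 0] = [set x | p0 x = 0].
  by apply/seteqP; split=> x /= h; [rewrite -(gK (p0 x)) h linear0 | rewrite h linear0].
split=> //.
- by move=> y; have [x xE] := po (f y); exists x; rewrite /= xE fK.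
- by move=> x; rewrite -ex; move/seteqP: kerE => [h1 h2]; split; [exact: h1 | exact: h2].
- by rewrite kerE.
Qed.

Lemma DTr_iter_rcons n E Y Z : is_DTr_iter n E Y -> is_DTr Y Z -> is_DTr_iter n.+1 E Z.
Proof.
elim: n E => [|n IH] E /= => [EY YZ|[E' EE' h] YZ].
  by exists Z; [exact: DTr_iso EY YZ | exact: iso_refl].
by exists E' => //; apply: IH h YZ.
Qed.

Lemma projective_preprojective X : indecomposable_fg X -> projective_module X -> preprojective X.
Proof. by move=> iX prX; exists 0, X; split=> //; apply: iso_refl. Qed.

(** * Maps between regular, preprojective and preinjective modules *)

(** Induction on the number of translations: with X1 = tau X and Z = tau Y,
Hom(X1, Z) = 0 gives Ext^1(Y, X1) = 0, and this gives Hom(X, Y) = 0. *)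
Lemma hom_preprojective_zero n X Y P : 
  indecomposable_fg X -> ~ preprojective X -> finitely_generated Y ->
  indecomposable_fg P -> projective_module P -> is_DTr_iter n Y P ->
  hom_vanishes X Y.
Proof.
elim: n X Y => [|n IH] X Y iX npX fgY iP prP /=.
  move=> /iso_inv[u [v [uK vK]]] f x.
  have nX : no_forms X.
    apply: indecomposable_no_forms => //; first by case: iX.
    by move=> prX; apply/npX/projective_preprojective.
  rewrite -[f x]uK -[u (f x)]/((u \o f) x) (no_forms_projective _ nX prP) ?linear0 //.
  by case: iP.
move=> [Z YZ ZP]; have fgZ := DTr_fg fgY YZ.
have nprX : ~ projective_module X.
  by move=> prX; apply/npX/projective_preprojective.
have [X1 [iX1 XX1]] := DTr_exists iX nprX.
have npX1 : ~ preprojective X1.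
  by move=> [m [P' [? ? ?]]]; apply: npX; exists m.+1, P'; split=> //; exists X1.
have h0 := IH _ _ iX1 npX1 fgZ iP prP ZP.
have eYX1 := ext_zero_of_hom_DTr fgY YZ h0.
apply: (hom_zero_of_ext_DTr _ fgY XX1 _ eYX1); first by case: iX.
by apply: indecomposable_no_forms => //; case: iX.
Qed.

Lemma preprojective_hom_zero X Y : indecomposable_fg X -> ~ preprojective X ->
  finitely_generated Y -> preprojective Y -> hom_vanishes X Y.
Proof. by move=> iX npX fgY [n [P [iP prP YP]]]; apply: hom_preprojective_zero YP. Qed.

Lemma TrD_not_preinjective X : indecomposable_fg X -> ~ preinjective X ->
  exists Y, [/\ indecomposable_fg Y, ~ preinjective Y & is_DTr Y X].
Proof.
move=> iX npX; have niX : ~ injective_module X.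
  by move=> inX; apply: npX; exists 0, X; split=> //; apply: iso_refl.
have [Y [iY YX]] := TrD_exists iX niX; exists Y; split=> // -[n [E [iE inE EY]]].
by apply: npX; exists n.+1, E; split=> //; apply: DTr_iter_rcons YX.
Qed.

(** The vanishing of Ext^1(-, E) on indecomposables that are not preinjective
passes from E to tau E: such an X is tau Y with Y of the same kind, so
Ext^1(Y, E) = 0 gives Hom(E, X) = 0, and hence Ext^1(X, tau E) = 0. *)
Lemma preinjective_ext_zero X Q : indecomposable_fg X -> ~ preinjective X ->
  preinjective Q -> ext_vanishes X Q.
Proof.
move=> iX npX [n [E [[_ fgE] inE EQ]]].
pose G E := finitely_generated E /\ forall X, indecomposable_fg X -> ~ preinjective X -> ext_vanishes X E.
have GE : G E.
  by split=> // X' _ _ K P i p [ii _ _] f; have [g gP] := inE _ _ i f ii; exists g.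
suff : forall n E, G E -> is_DTr_iter n E Q -> ext_vanishes X Q by move=> /(_ n E GE EQ).
elim=> {n E fgE inE GE EQ} [|n IH] E [fgE eE] /=.
  move=> /iso_inv[u [v [uK vK]]] K P i p se f.
  have [g gP] := eE X iX npX K P i p se (v \o f : {linear K -> E}).
  by exists (u \o g : {linear P -> Q}) => x /=; rewrite gP /= vK.
move=> [Z EZ ZQ]; apply: (IH Z) => //; split; first exact: DTr_fg EZ.
move=> X' iX' npX'; have [Y [iY npY YX']] := TrD_not_preinjective iX' npX'.
apply: (ext_DTr_zero fgE EZ); apply: (hom_DTr_zero _ YX'); first by case: iY.
exact: eE.
Qed.

Lemma preinjective_divisible Q : preinjective Q -> divisible Q.
Proof.
move=> pQ X [iX _ npX]; apply: vanishes_ext1_zero; first by case: iX.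
exact: preinjective_ext_zero.
Qed.

(** X is tau Y with Y regular, so Ext^1(Y, D) = 0 gives Hom(D, X) = 0.  If Y were
preprojective, then Ext^1(Y, X) = 0 and Hom(X, X) = 0. *)
Lemma divisible_hom_zero D X : divisible D -> indecomposable_regular X ->
  hom_vanishes D X.
Proof.
move=> divD [iX nppX npiX].
have [Y [iY npiY YX]] := TrD_not_preinjective iX npiX.
have fgY : finitely_generated Y by case: iY.
have XX0 : ~ ext_vanishes Y X.
  move=> eYX; have [[[x nx] _] _] := iX; apply: nx.
  exact: (hom_DTr_zero fgY YX eYX idfun x).
have nppY : ~ preprojective Y.
  move=> [[|n] [P [iP prP]]] /=.
    move=> /iso_inv[u [v [uK vK]]]; apply: XX0.
    have prY := retract_projective uK prP.
    move=> K Q i p [ii po pex] f.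
    have [s sP] := projective_split prY po.
    have rl : linear (fun q => q - s (p q)).
      by move=> a y z; rewrite [p _]linearP [s _]linearP opprD addrACA scalerBr.
    have [|r rP] := factor_mono (f := mklin rl) ii.
      by move=> q; apply/pex; rewrite /= linearB sP subrr.
    exists (f \o r : {linear Q -> X}) => y /=; congr (f _); apply: ii; rewrite rP /=.
    have -> : p (i y) = 0 by apply/pex; exists y.
    by rewrite !linear0 addr0.
  move=> [Z YZ ZP]; apply: XX0; apply: (ext_zero_of_hom_DTr fgY YZ).
  exact: (hom_preprojective_zero iX nppX (DTr_fg fgY YZ) iP prP ZP).
by apply: (hom_DTr_zero fgY YX); apply: ext1_zero_vanishes; apply: divD.
Qed.

End DTr.

(** * Infinite direct sums *)

Section DirectSum.
Variables (A : nzRingType) (I : Type) (X : I -> lmodType A).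
Implicit Types (z : dsum X) (i : I).

Lemma dsum_valP_lin i : linear (fun z => dsum_val z i).
Proof. by move=> a u v. Qed.
Definition dproj i : {linear dsum X -> X i} := mklin (dsum_valP_lin i).

Lemma dsum_ext z z' : (forall i, dproj i z = dproj i z') -> z = z'.
Proof. by move=> h; apply: val_inj; apply: functional_extensionality_dep => i; apply: h. Qed.

Lemma dsum_build (f : dprod X) (s : seq {classic I}) :
  (forall i, (i : {classic I}) \notin s -> f i = 0) -> exists z, forall i, dproj i z = f i.
Proof.
move=> fs; have fin : f \in @finsupp A I X.
  apply/asboolP; apply: (@sub_finite_set _ _ [set` s]); last exact: finite_seq.
  move=> i /= fi; apply: contrapT => /negP ni; apply: fi; exact: fs.
by exists (DSum fin).
Qed.

Lemma dsum_supp z : exists s : seq {classic I}, uniq s /\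
  forall i, (i : {classic I}) \notin s -> dproj i z = 0.
Proof.
have /asboolP fin := dsum_valP z.
have /finite_seqP[s sE] := (fin : finite_set ([set i | dsum_val z i <> 0] : set {classic I})).
exists (undup s); split; first exact: undup_uniq.
move=> i; rewrite mem_undup => ni; apply: contrapT => nz.
have : [set` s] i by rewrite -sE.
by move=> /= si; rewrite si in ni.
Qed.

Lemma dsum_inj i : exists u : {linear X i -> dsum X},
  (forall x, dproj i (u x) = x) /\ forall i' x, i' <> i -> dproj i' (u x) = 0.
Proof.
have [||| u uP] := @lin_of_graph A (X i) (dsum X)
  (fun x z => dproj i z = x /\ forall i', i' <> i -> dproj i' z = 0).
- move=> x; pose f : dprod X := fun i' => if pselect (i = i') is left e then eq_rect i X x i' e else 0.
  have [|z zP] := @dsum_build f [:: i].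
    move=> i'; rewrite inE => /eqP ni; rewrite /f; case: pselect => // e.
    by case: ni.
  exists z; rewrite zP /f; split.
    by case: pselect => // e; rewrite (Prop_irrelevance e erefl).
  move=> i' ni; rewrite zP /f; case: pselect => // e; case: (ni (esym e)).
- move=> z [zi z0]; apply: dsum_ext => i'; rewrite linear0.
  by have [->|/z0 ->] := pselect (i' = i).
- move=> a x x' z z' [zi z0] [zi' z0']; split; first by rewrite linearP zi zi'.
  by move=> i' ni; rewrite linearP z0 // z0' // scaler0 addr0.
by exists u; split=> [x|i' x]; have [u1 u2] := uP x; [exact: u1 | exact: u2].
Qed.

Definition dinj i := projT1 (cid (dsum_inj i)).
Lemma dinjK i x : dproj i (dinj i x) = x.
Proof. by have [uP _] := projT2 (cid (dsum_inj i)); apply: uP. Qed.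
Lemma dinj0 i i' x : i' <> i -> dproj i' (dinj i x) = 0.
Proof. by have [_ uP] := projT2 (cid (dsum_inj i)); apply: uP. Qed.

Lemma dsum_decomp z (s : seq {classic I}) : uniq s ->
  (forall i, (i : {classic I}) \notin s -> dproj i z = 0) ->
  z = \sum_(i <- s) dinj i (dproj i z).
Proof.
move=> us zs; apply: dsum_ext => i; rewrite linear_sum.
have [si|ni] := boolP ((i : {classic I}) \in s).
  rewrite (bigD1_seq (i : {classic I})) //= -[X in X + _]/(dproj i (dinj i (dproj i z))) dinjK.
  rewrite big1 ?addr0 // => i' ni; apply: (@dinj0 i' i) => E; by rewrite E eqxx in ni.
rewrite big_seq big1 ?zs // => i' si; apply: (@dinj0 i' i) => E.
by rewrite E si in ni.
Qed.

Lemma dsum_hom0 (M : lmodType A) (h : {linear dsum X -> M}) :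
  (forall i x, h (dinj i x) = 0) -> forall z, h z = 0.
Proof.
move=> h0 z; have [s [us sP]] := dsum_supp z.
by rewrite (dsum_decomp us sP) linear_sum big1.
Qed.

Lemma dsum_copair (M : lmodType A) (g : forall i, {linear X i -> M}) :
  exists F : {linear dsum X -> M}, forall i x, F (dinj i x) = g i x.
Proof.
have widen z (s s' : seq {classic I}) : uniq s -> uniq s' -> {subset s <= s'} ->
    (forall i, (i : {classic I}) \notin s -> dproj i z = 0) ->
    \sum_(i <- s) g i (dproj i z) = \sum_(i <- s') g i (dproj i z).
  move=> us us' ss' zs; rewrite [RHS](bigID (mem s)) /= [X in _ + X]big1 ?addr0; last first.
    by move=> i ni; rewrite -[dsum_val z i]/(dproj i z) zs ?linear0.
  rewrite -[RHS]big_filter; apply: perm_big; apply: uniq_perm => //; first exact: filter_uniq.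
  move=> i; rewrite mem_filter; case si : (i \in s) => //=.
  by rewrite ss'.
have [|||F FP] := @lin_of_graph A (dsum X) M (fun z m => exists s : seq {classic I},
   [/\ uniq s, forall i, (i : {classic I}) \notin s -> dproj i z = 0 &
       m = \sum_(i <- s) g i (dproj i z)]).
- by move=> z; have [s [us sP]] := dsum_supp z; exists (\sum_(i <- s) g i (dproj i z)), s.
- by move=> m [s [_ _ ->]]; rewrite big1 // => i _; rewrite [dproj _ _]linear0 linear0.
- move=> a z z' m m' [s [us zs ->]] [s' [us' zs' ->]]; exists (undup (s ++ s')); split.
  + exact: undup_uniq.
  + move=> i; rewrite mem_undup mem_cat negb_or => /andP[si si'].
    by rewrite linearP zs // zs' // scaler0 addr0.
  + rewrite (widen z s (undup (s ++ s'))) ?undup_uniq //; last by move=> i si; rewrite mem_undup mem_cat si.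
    rewrite (widen z' s' (undup (s ++ s'))) ?undup_uniq //; last by move=> i si; rewrite mem_undup mem_cat si orbT.
    rewrite scaler_sumr -big_split /=; apply: eq_bigr => i _.
    by rewrite -linearP.
exists F => i x; have [s [us sP ->]] := FP (dinj i x).
have [si|ni] := boolP ((i : {classic I}) \in s); last first.
  have x0 : x = 0 by rewrite -(dinjK x) sP.
  by rewrite x0 [RHS]linear0 big1 // => j _; rewrite !linear0.
rewrite (bigD1_seq (i : {classic I})) //= -[dsum_val _ i]/(dproj i (dinj i x)) dinjK.
rewrite big1 ?addr0 // => j nj.
by rewrite -[dsum_val _ j]/(dproj j (dinj i x)) dinj0 ?linear0 // => E; rewrite E eqxx in nj.
Qed.

Lemma dsum_trunc (s : seq {classic I}) : exists t : {linear dsum X -> dsum X},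
  (forall z i, (i : {classic I}) \in s -> dproj i (t z) = dproj i z) /\
  (forall z i, (i : {classic I}) \notin s -> dproj i (t z) = 0).
Proof.
have [|||t tP] := @lin_of_graph A (dsum X) (dsum X) (fun z w =>
  forall i, dproj i w = if (i : {classic I}) \in s then dproj i z else 0).
- move=> z; have [|w wP] := @dsum_build (fun i => if (i : {classic I}) \in s then dproj i z else 0) s.
    by move=> i /negbTE ->.
  by exists w.
- by move=> w wP; apply: dsum_ext => i; rewrite wP linear0; case: ifP.
- move=> a z z' w w' wP wP' i; rewrite !linearP wP wP'.
  by case: ifP => // _; rewrite scaler0 addr0.
by exists t; split=> z i si; rewrite tP ?si ?(negbTE si).
Qed.

Definition fg_set (V : lmodType A) (U : set V) := exists n (v : 'I_n -> V), spans U v.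

Lemma fg_set_sum (V : lmodType A) (U U' : set V) :
  fg_set U -> fg_set U' -> fg_set (sumset U U').
Proof.
move=> [n [v vP]] [m [w wP]]; exists (n + m)%N.
exists (fun l : 'I_(n + m) => match fintype.split l with inl j => v j | inr j => w j end) => x.
have E c : lincomb (fun l : 'I_(n + m) => match fintype.split l with inl j => v j | inr j => w j end) c
    = lincomb v (c \o @lshift n m) + lincomb w (c \o @rshift n m).
  rewrite /lincomb big_split_ord /=; congr (_ + _); apply: eq_bigr => l _.
    by rewrite (unsplitK (inl l)).
  by rewrite (unsplitK (inr l)).
split=> [[_ [_ [/vP[c ->] /wP[d ->] ->]]]|[c ->]].
  exists (fun l : 'I_(n + m) => match fintype.split l with inl j => c j | inr j => d j end).
  rewrite E; congr (_ + _); apply: eq_bigr => l _ /=.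
    by rewrite (unsplitK (inl l)).
  by rewrite (unsplitK (inr l)).
rewrite E; do 2!eexists; split; last by [].
  by apply/vP; exists (c \o @lshift n m).
by apply/wP; exists (c \o @rshift n m).
Qed.

Lemma fg_set_module (V : lmodType A) (U : set V) : fg_set U ->
  exists (W : lmodType A) (i : {linear W -> V}), [/\ finitely_generated W, injective i &
    forall v, U v <-> exists w, i w = v].
Proof.
move=> [n [u uP]]; have [W [i [ii iP]]] := submodule_module (submodule_spans uP).
exists W, i; split=> //; apply/fgP.
have /choice[w wP] (l : 'I_n) : exists w, i w = u l by apply/iP; exact: spans_mem uP.
exists n, w => x; split=> // _; have /uP[c E] : U (i x) by apply/iP; exists x.
exists c; apply: ii; rewrite linear_lincomb E; apply: eq_bigr => l _.
by rewrite /= wP.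
Qed.

(** The image under f of the finite subsum indexed by s. *)
Lemma dsum_trunc_fg (s : seq {classic I}) (V : lmodType A) (f : {linear dsum X -> V}) :
  uniq s -> (forall i, finitely_generated (X i)) ->
  fg_set [set y | exists z, (forall i, (i : {classic I}) \notin s -> dproj i z = 0) /\ f z = y].
Proof.
move=> + fgX; elim: s => [_|i s IH].
  exists 0%N, (fun=> 0) => x; rewrite /lincomb; split=> [[z [z0 <-]]|[c ->]].
    exists (fun=> 0); rewrite big_ord0 (_ : z = 0) ?linear0 //.
    by apply: dsum_ext => i; rewrite linear0; apply: z0.
  by rewrite big_ord0; exists 0; split=> [i _|]; rewrite linear0.
move=> /andP[si us].
have fgi : fg_set [set y | exists2 x, setT x & (f \o dinj i) x = y].
  have /fgP[n [v vP]] := fgX i; exists n, ((f \o dinj i : {linear X i -> V}) \o v).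
  exact: (spans_onto (f \o dinj i : {linear X i -> V}) vP).
have := fg_set_sum fgi (IH us); congr fg_set; apply/seteqP; split=> y.
  move=> [_ [_ [[x _ <-] [z [zs <-]] ->]]]; exists (dinj i x + z); split=> [j|]; last by rewrite linearD.
  rewrite inE negb_or => /andP[/eqP ji js]; rewrite linearD zs // addr0.
  by apply: dinj0.
move=> [z [zs <-]]; exists (f (dinj i (dproj i z))), (f (z - dinj i (dproj i z))); split.
- by exists (dproj i z).
- exists (z - dinj i (dproj i z)); split=> // j js; rewrite linearB.
  have [->|ji] := pselect (j = i); first by rewrite dinjK subrr.
  rewrite dinj0 // subr0 zs // inE negb_or js andbT; exact/eqP.
- by rewrite -linearD addrC subrK.
Qed.

End DirectSum.

(** * Decomposition into indecomposables *)

Section Decompose.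
Variable A : nzRingType.

(** A candidate direct summand of V, with its inclusion and its projection. *)
Definition component (V : lmodType A) : Type :=
  {W : lmodType A & ({linear W -> V} * {linear V -> W})%type}.
Definition cmod V (c : component V) : lmodType A := projT1 c.
Definition cin V (c : component V) : {linear cmod c -> V} := (projT2 c).1.
Definition cout V (c : component V) : {linear V -> cmod c} := (projT2 c).2.

Definition decomposes V n (c : 'I_n -> component V) :=
  [/\ forall j, indecomposable_module (cmod (c j)), forall j w, cout (c j) (cin (c j) w) = w &
      forall v, v = \sum_j cin (c j) (cout (c j) v)].

Definition decomposable V := exists n (c : 'I_n -> component V), decomposes c.

Lemma decomposable_sum (V U U' : lmodType A) (a : {linear U -> V}) (b : {linear V -> U})
   (a' : {linear U' -> V}) (b' : {linear V -> U'}) :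
  cancel a b -> cancel a' b' -> (forall v, v = a (b v) + a' (b' v)) ->
  decomposable U -> decomposable U' -> decomposable V.
Proof.
move=> ab ab' vE [n [c [c1 c2 c3]]] [n' [c' [c1' c2' c3']]].
pose up (d : component U) : component V :=
  existT _ (cmod d) (a \o cin d : {linear _ -> _}, cout d \o b : {linear _ -> _}).
pose up' (d : component U') : component V :=
  existT _ (cmod d) (a' \o cin d : {linear _ -> _}, cout d \o b' : {linear _ -> _}).
exists (n + n')%N, (fun i => match fintype.split i with inl j => up (c j) | inr j => up' (c' j) end).
split=> [i|i w|v].
- by case: fintype.split => j; [apply: c1 | apply: c1'].
- by case: fintype.split w => j w; rewrite /cin /cout /=; [rewrite ab; apply: c2 | rewrite ab'; apply: c2'].
- rewrite big_split_ord /= {1}(vE v) {1}(c3 (b v)) {1}(c3' (b' v)) !linear_sum; congr (_ + _).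
    by apply: eq_bigr => i _; rewrite (unsplitK (inl i)).
  by apply: eq_bigr => i _; rewrite (unsplitK (inr i)).
Qed.

(** A minimal submodule without a decomposition splits into two proper ones,
which have decompositions. *)
Lemma dcc_decomposable (V : lmodType A) : chain_cond false [set: V] -> decomposable V.
Proof.
move=> dcc; apply: contrapT => nV.
have [||U [[W [i [ii iP nW]]] minU]] := dcc [set U | exists (W : lmodType A) (i : {linear W -> V}),
    [/\ injective i, forall v, U v <-> exists w, i w = v & ~ decomposable W]].
- exists setT, V, idfun; split=> // v; split=> // _; by exists v.
- move=> U [W [i [_ iP _]]]; split=> //; split; first by apply/iP; exists 0; rewrite linear0.
  by move=> a u v /iP[x <-] /iP[y <-]; apply/iP; exists (a *: x + y); rewrite linearP.
apply: nW; have [W0|nzW] := pselect (forall w : W, w = 0).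
  exists 0%N, (fun j : 'I_0 => False_rect _ (notF (ltn_ord j))); split=> [[]//|[]//|v].
  by rewrite big_ord0.
have nz : nonzero W by apply: contrapT => no; apply: nzW => w; apply: contrapT => w0; apply: no; exists w.
have [iW|niW] := pselect (indecomposable_module W).
  exists 1%N, (fun=> existT _ W (idfun : {linear W -> W}, idfun : {linear W -> W})); split=> // v.
  by rewrite big_ord1.
have [U1 [U2 [sU1 sU2 U120 U12T]]] : exists U1 U2 : set W, [/\ submodule U1, submodule U2,
    U1 `&` U2 = [set 0], (forall x, exists u v, [/\ U1 u, U2 v & x = u + v]) &
    ~ (U1 = [set 0] \/ U2 = [set 0])].
  apply: contrapT => no; apply: niW; split=> // U1 U2 s1 s2 i12 s12.
  by apply: contrapT => n12; apply: no; exists U1, U2.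
move=> /not_orP[U10 U20].
have UI x : U1 x -> U2 x -> x = 0 by move=> h1 h2; have : (U1 `&` U2) x by []; rewrite U120.
have small (U' U'' : set W) : submodule U' -> submodule U'' -> U'' <> [set 0] ->
    (forall x, U' x -> U'' x -> x = 0) ->
    exists (W' : lmodType A) (j : {linear W' -> W}), [/\ injective j, forall v, U' v <-> exists w, j w = v & decomposable W'].
  move=> s' s'' n'' i0; have [W' [j [ji jP]]] := submodule_module s'.
  exists W', j; split=> //; apply: contrapT => nd; apply: n''.
  have E : [set y | exists2 x, U' x & i x = y] = U.
    apply: minU.
      exists W', (i \o j : {linear W' -> V}); split=> // [x y /= /ii /ji //|v].
      by split=> [[x /jP[w <-] <-]|[w <-]]; [exists w | exists (j w) => //; apply/jP; exists w].
    by move=> _ [x _ <-]; apply/iP; exists x.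
  apply/seteqP; split=> [x Ux|_ ->]; last exact: submod0.
  have : U (i x) by apply/iP; exists x.
  by rewrite -E => -[y U'y /ii yx]; apply: i0 => //; rewrite -yx.
have [W1 [j1 [j1i j1P d1]]] := small U1 U2 sU1 sU2 U20 UI.
have [W2 [j2 [j2i j2P d2]]] := small U2 U1 sU2 sU1 U10 (fun x h2 h1 => UI x h1 h2).
have proj (W1' W2' : lmodType A) (k1 : {linear W1' -> W}) (k2 : {linear W2' -> W}) (V1 V2 : set W) :
    injective k1 -> (forall v, V1 v <-> exists w, k1 w = v) -> (forall v, V2 v <-> exists w, k2 w = v) ->
    submodule V2 -> (forall x, V1 x -> V2 x -> x = 0) ->
    (forall x, exists u v, [/\ V1 u, V2 v & x = u + v]) ->
    exists b : {linear W -> W1'}, forall x, V2 (x - k1 (b x)).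
  move=> k1i k1P k2P sV2 V0 VT.
  apply: (@lin_of_graph A W W1' (fun x w => V2 (x - k1 w))).
  - move=> x; have [u [v [/k1P[w <-] Vv ->]]] := VT x; exists w.
    by rewrite addrAC subrr add0r.
  - move=> w; rewrite sub0r => /(submodN sV2); rewrite opprK => Vw.
    by apply: k1i; rewrite linear0; apply: V0 => //; apply/k1P; exists w.
  - move=> a x x' w w' Vw Vw'; rewrite linearP opprD addrACA -scalerBr.
    exact: (proj2 sV2).
have [b1 b1P] := proj _ _ j1 j2 U1 U2 j1i j1P j2P sU2 UI U12T.
have [|b2 b2P] := proj _ _ j2 j1 U2 U1 j2i j2P j1P sU1 (fun x h2 h1 => UI x h1 h2).
  by move=> x; have [u [v [Uu Uv ->]]] := U12T x; exists v, u; rewrite addrC.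
have U1j w : U1 (j1 w) by apply/j1P; exists w.
have U2j w : U2 (j2 w) by apply/j2P; exists w.
apply: (decomposable_sum (a := j1) (b := b1) (a' := j2) (b' := b2)) => //.
- move=> w; apply: j1i; apply/eqP; rewrite eq_sym -subr_eq0; apply/eqP.
  by apply: UI => //; apply: submodB.
- move=> w; apply: j2i; apply/eqP; rewrite eq_sym -subr_eq0; apply/eqP.
  by apply: UI => //; apply: submodB.
- move=> v; apply/eqP; rewrite -subr_eq0; apply/eqP; apply: UI.
    by rewrite opprD addrCA addrC; apply: (submodB sU1) => //; rewrite addrC; exact: b2P.
  by rewrite opprD addrA; apply: (submodB sU2).
Qed.
End Decompose.

(** * Tensor products as modules over k *)

Section TensorModule.
Variables (k : comNzRingType) (R : algType k).
Notation A := (R^c).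
Variables (M : lmodType A) (Q : lmodType R).

Lemma tensor_map (M' : lmodType A) (f : {linear M -> M'}) (s t : seq (M * Q)) :
  tensor_eq s t -> tensor_eq [seq (f x.1, x.2) | x <- s] [seq (f x.1, x.2) | x <- t].
Proof.
elim=> {s t} /=.
- by move=> s; apply: tensor_refl.
- by move=> s t _; apply: tensor_sym.
- by move=> s t u _ h1 _ h2; apply: tensor_trans h1 h2.
- by move=> s s' t t' _ h1 _ h2; rewrite !map_cat; apply: tensor_cat.
- by move=> s t; rewrite !map_cat; apply: tensor_comm.
- by move=> q; rewrite linear0; apply: tensor_zero.
- by move=> m m' q; rewrite linearD; apply: tensor_addl.
- by move=> m q q'; apply: tensor_addr.
- by move=> m r q; rewrite linearZ; apply: tensor_bal.
Qed.

Let smul_lin (c : k) : linear (fun m : M => in_calg R c *: m).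
Proof. by move=> a u v; rewrite scalerDr !scalerA (central_A c a). Qed.
Let smul c : {linear M -> M} := mklin (smul_lin c).
Let sc c (s : seq (M * Q)) := [seq (smul c x.1, x.2) | x <- s].

Lemma tensor_module : exists (W : lmodType k) (tau : M -> Q -> W),
  [/\ forall s t, tensor_eq s t <-> \sum_(x <- s) tau x.1 x.2 = \sum_(x <- t) tau x.1 x.2,
      (forall m m' q, tau (m + m') q = tau m q + tau m' q) /\
      (forall c m q, tau (in_calg R c *: m) q = c *: tau m q),
      forall m q q', tau m (q + q') = tau m q + tau m q' &
      forall m (r : R) q, tau ((r : A) *: m) q = tau m (r *: q)].
Proof.
pose opp (s : seq (M * Q)) := [seq (- x.1, x.2) | x <- s].
have scE c s : sc c s = [seq (in_calg R c *: x.1, x.2) | x <- s] by [].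
have addN s : tensor_eq (opp s ++ s) [::].
  elim: s => [|[m q] s IH] /=; first exact: tensor_refl.
  have h1 : tensor_eq ((- m, q) :: opp s ++ (m, q) :: s) ([:: (- m, q)] ++ (([:: (m, q)] ++ s) ++ opp s)).
    apply: (tensor_cat (s := [:: (- m, q)])); [exact: tensor_refl | exact: tensor_comm].
  apply: tensor_trans h1 _.
  have -> : [:: (- m, q)] ++ ([:: (m, q)] ++ s) ++ opp s = [:: (- m, q); (m, q)] ++ (s ++ opp s) by [].
  have h2 : tensor_eq [:: (- m, q); (m, q)] [::].
    apply: tensor_trans (tensor_zero _ q); rewrite -(addNr m).
    exact: tensor_sym (tensor_addl _ _ _).
  apply: (tensor_cat h2); apply: tensor_trans IH; exact: tensor_comm.
have [||||||||||||| W [p [po pE pD pZ]]] := @module_of_setoid k (seq (M * Q)) (@tensor_eq R M Q)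
  [::] (fun s t => s ++ t) opp sc.
- exact: tensor_refl.
- exact: tensor_sym.
- exact: tensor_trans.
- by move=> s s' t t' h h' /=; exact: tensor_cat h h'.
- by move=> c s s' h; apply: (tensor_map (smul c) h).
- by move=> s t u; rewrite catA; apply: tensor_refl.
- exact: tensor_comm.
- by move=> s; apply: tensor_refl.
- exact: addN.
- move=> a b s; rewrite /sc -map_comp.
  rewrite (_ : map _ _ = map (fun x => (smul (a * b) x.1, x.2)) s); first exact: tensor_refl.
  by apply: eq_map => -[m q] /=; rewrite scalerA -(rmorphM (ioA R)).
- move=> s; rewrite /sc (_ : map _ _ = s); first exact: tensor_refl.
  by rewrite -[RHS]map_id; apply: eq_map => -[m q] /=; rewrite -[in_calg R 1]/(ioA R 1) rmorph1 scale1r.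
- by move=> a s t; rewrite /sc map_cat; apply: tensor_refl.
- move=> a b s; elim: s => [|[m q] s IH] /=; first exact: tensor_refl.
  have h1 : tensor_eq ([:: (smul a m, q)] ++ (sc a s ++ ([:: (smul b m, q)] ++ sc b s)))
     ([:: (smul a m, q); (smul b m, q)] ++ (sc a s ++ sc b s)).
    apply: (@tensor_cat R M Q [:: (smul a m, q)] [:: (smul a m, q)]); first exact: tensor_refl.
    have := tensor_cat (tensor_comm (sc a s) [:: (smul b m, q)]) (tensor_refl (sc b s)).
    by rewrite -!catA.
  apply: tensor_trans _ (tensor_sym h1).
  apply: (@tensor_cat R M Q [:: (smul (a + b) m, q)]) => //.
  have -> : smul (a + b) m = smul a m + smul b m.
    by rewrite /= -scalerDl -(rmorphD (ioA R)).
  exact: tensor_addl.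
have p0 : p [::] = 0 by apply: (addrI (p [::])); rewrite -pD addr0.
pose tau m q := p [:: (m, q)].
have pS s : p s = \sum_(x <- s) tau x.1 x.2.
  elim: s => [|[m q] s IH]; first by rewrite big_nil.
  by rewrite big_cons -IH -pD.
exists W, tau; split.
- by move=> s t; rewrite -!pS pE.
- split=> [m m' q|c m q]; last by rewrite /tau -pZ.
  by rewrite /tau -pD; apply/pE; exact: tensor_addl.
- move=> m q q'; rewrite /tau -pD; apply/pE; exact: tensor_addr.
- move=> m r q; apply/pE; exact: tensor_bal.
Qed.

(** An equality in M (x) Q already holds in U (x) Q for some finitely generated
U; it is stated through the balanced maps that would factor through U (x) Q. *)
Lemma tensor_eq_support (J : zmodType) (s t : seq (M * Q)) : tensor_eq s t ->
  exists s' : seq M, forall (U : set M) (b : M -> Q -> J), submodule U ->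
    (forall x, x \in s' -> U x) ->
    (forall x y q, U x -> U y -> b (x + y) q = b x q + b y q) ->
    (forall x q q', U x -> b x (q + q') = b x q + b x q') ->
    (forall x (r : R) q, U x -> b ((r : A) *: x) q = b x (r *: q)) ->
    \sum_(x <- s) b x.1 x.2 = \sum_(x <- t) b x.1 x.2.
Proof.
elim=> {s t}.
- by move=> s; exists [::].
- by move=> s t _ [s' h]; exists s' => U b *; apply/esym/(h U b).
- move=> s t u _ [s1 h1] _ [s2 h2]; exists (s1 ++ s2) => U b sU sub b1 b2 b3.
  by rewrite (h1 U) ?(h2 U) // => x xs; apply: sub; rewrite mem_cat xs ?orbT.
- move=> s s' t t' _ [s1 h1] _ [s2 h2]; exists (s1 ++ s2) => U b sU sub b1 b2 b3.
  by rewrite !big_cat /= (h1 U) ?(h2 U) // => x xs; apply: sub; rewrite mem_cat xs ?orbT.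
- by move=> s t; exists [::] => U b *; rewrite !big_cat /= addrC.
- move=> q; exists [::] => U b sU _ b1 _ _; rewrite big_seq1 big_nil /=.
  have U0 := submod0 sU; by apply: (addrI (b 0 q)); rewrite -b1 // !addr0.
- move=> m m' q; exists [:: m; m'] => U b sU sub b1 _ _; rewrite !big_cons !big_nil !addr0 /=.
  by apply: b1; apply: sub; rewrite !inE eqxx ?orbT.
- move=> m q q'; exists [:: m] => U b sU sub _ b2 _; rewrite !big_cons !big_nil !addr0 /=.
  by apply: b2; apply: sub; rewrite inE.
- move=> m r q; exists [:: m] => U b sU sub _ _ b3; rewrite !big_seq1 /=.
  by apply: b3; apply: sub; rewrite inE.
Qed.
End TensorModule.

(** * Finitely presented modules are Mittag-Leffler *)

Section FpMittagLeffler.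
Variables (k : comNzRingType) (R : algType k).
Notation A := (R^c).
Variables (M : lmodType A).
Variables (n : nat) (x : 'I_n -> M) (b : nat) (ka : 'I_b -> 'rV[A]_n).
Hypotheses (xP : spans setT x) (kaP : spans [set y | comb x y = 0] ka).

Let coef (m : M) : 'I_n -> A := projT1 (cid ((xP m).1 I)).
Let coefP m : m = lincomb x (coef m).
Proof. exact: (projT2 (cid ((xP m).1 I))). Qed.

Section OneQ.
Variable Q : lmodType R.
(** A tensor becomes a sum of x_j (x) q_j; [coord] computes the q_j from chosen
coefficients, so it is additive in q but not in m.  Its class modulo [relators]
is well defined, which identifies M (x) Q with the cokernel of the map
from Q^b to Q^n given by [ka]. *)
Definition coord (s : seq (M * Q)) (j : 'I_n) : Q := \sum_(y <- s) toR (coef y.1 j) *: y.2.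
Definition relators (u : 'I_n -> Q) := exists r : 'I_b -> Q,
  forall j, u j = \sum_a toR (ka a 0 j) *: r a.

Lemma relators_syzygy (c : 'I_n -> A) q : lincomb x c = 0 ->
  relators (fun j => toR (c j) *: q).
Proof.
move=> c0; have /kaP[l lE] : [set y | comb x y = 0] (\row_j c j) by exact: (etrans (combE x c) c0).
exists (fun a => toR (l a) *: q) => j.
have -> : c j = \sum_a l a * ka a 0 j.
  have := congr1 (fun y : 'rV[A]_n => y 0 j) lE; rewrite /= mxE => ->.
  by rewrite summxE; apply: eq_bigr => a _; rewrite mxE.
rewrite -(_ : \sum_a (toR (ka a 0 j) * toR (l a)) = toR (\sum_a l a * ka a 0 j)); last first.
  by apply: esym; exact: (anti_iso_sum (anti_idA R) _ (fun a => l a * ka a 0 j)).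
by rewrite scaler_suml; apply: eq_bigr => a _; rewrite scalerA.
Qed.

Lemma relatorsD u v : relators u -> relators v -> relators (fun j => u j + v j).
Proof.
move=> [r rP] [r' rP']; exists (fun a => r a + r' a) => j.
by rewrite rP rP' -big_split /=; apply: eq_bigr => a _; rewrite scalerDr.
Qed.
Lemma relatorsN u : relators u -> relators (fun j => - u j).
Proof.
move=> [r rP]; exists (fun a => - r a) => j.
by rewrite rP -sumrN; apply: eq_bigr => a _; rewrite scalerN.
Qed.
Lemma relators_ext u v : relators u -> u =1 v -> relators v.
Proof. by move=> [r rP] uv; exists r => j; rewrite -uv. Qed.

Lemma coord_relators (s t : seq (M * Q)) : tensor_eq s t ->
  relators (fun j => coord s j - coord t j).
Proof.
elim=> {s t}.
- by move=> s; exists (fun=> 0) => j; rewrite subrr big1 // => a _; rewrite scaler0.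
- by move=> s t _ /relatorsN h; apply: relators_ext h _ => j; rewrite opprB.
- move=> s t u _ h1 _ h2; apply: relators_ext (relatorsD h1 h2) _ => j /=.
  by rewrite addrA subrK.
- move=> s s' t t' _ h1 _ h2; apply: relators_ext (relatorsD h1 h2) _ => j /=.
  by rewrite /coord !big_cat /= opprD addrACA.
- move=> s t; exists (fun=> 0) => j; rewrite /coord !big_cat /= [X in _ - X]addrC subrr.
  by rewrite big1 // => a _; rewrite scaler0.
- move=> q; apply: relators_ext (relators_syzygy q (esym (coefP 0))) _ => j.
  by rewrite /coord big_seq1 big_nil subr0.
- move=> m m' q.
  have h : lincomb x (fun j => coef (m + m') j - coef m j - coef m' j) = 0.
    rewrite /lincomb; under eq_bigr do rewrite !scalerBl.
    by rewrite !sumrB -!/(lincomb x _) -!coefP addrAC addrK subrr.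
  apply: relators_ext (relators_syzygy q h) _ => j.
  rewrite /coord !big_cons !big_nil !addr0 /= opprD addrA -!scaleNr -!scalerDl //.
- move=> m q q'; exists (fun=> 0) => j; rewrite /coord !big_cons !big_nil !addr0 /= -scalerDr subrr.
  by rewrite big1 // => a _; rewrite scaler0.
- move=> m r q.
  have h : lincomb x (fun j => coef ((r : A) *: m) j - (r : A) * coef m j) = 0.
    rewrite /lincomb; under eq_bigr do rewrite scalerBl -scalerA.
    by rewrite sumrB -scaler_sumr -!/(lincomb x _) -!coefP subrr.
  apply: relators_ext (relators_syzygy q h) _ => j.
  rewrite /coord !big_seq1 /= scalerA -scaleNr -scalerDl //.
Qed.

Lemma coord_tensor (s t : seq (M * Q)) : relators (fun j => coord s j - coord t j) -> tensor_eq s t.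
Proof.
have [W [tau [tE [tDl _] tr tb]]] := tensor_module M Q.
have t0l q : tau 0 q = 0 by apply: (addrI (tau 0 q)); rewrite -tDl !addr0.
have t0r m : tau m 0 = 0 by apply: (addrI (tau m 0)); rewrite -tr !addr0.
have tsl (I : Type) (r : seq I) (F : I -> M) q : tau (\sum_(i <- r) F i) q = \sum_(i <- r) tau (F i) q.
  by apply: (big_morph (tau^~ q)) => [u v|]; [exact: tDl | exact: t0l].
have tsr (I : Type) (r : seq I) (F : I -> Q) m : tau m (\sum_(i <- r) F i) = \sum_(i <- r) tau m (F i).
  by apply: (big_morph (tau m)) => [u v|]; [exact: tr | exact: t0r].
have tB m q q' : tau m (q - q') = tau m q - tau m q'.
  by apply: (addIr (tau m q')); rewrite -tr !subrK.
have canon u : \sum_(y <- u) tau y.1 y.2 = \sum_j tau (x j) (coord u j).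
  transitivity (\sum_(y <- u) \sum_j tau (x j) (toR (coef y.1 j) *: y.2)).
    apply: eq_bigr => y _; rewrite {1}(coefP y.1) /lincomb tsl; apply: eq_bigr => j _.
    exact: tb.
  by rewrite exchange_big /=; apply: eq_bigr => j _; rewrite tsr.
move=> [r rP]; apply/tE; rewrite !canon; apply/eqP; rewrite -subr_eq0 -sumrB; apply/eqP.
under eq_bigr do rewrite -tB rP tsr.
rewrite exchange_big big1 // => a _.
transitivity (tau (\sum_j (ka a 0 j) *: x j) (r a)).
  by rewrite tsl; apply: eq_bigr => j _; rewrite -tb.
have := spans_mem a kaP; rewrite /= => ka0.
by rewrite -[X in tau X _]/(comb x (ka a)) /= ka0 t0l.
Qed.
End OneQ.

(** The relations over the factors of a product assemble to a relation over the
product, because the number b of relators is finite. *)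
Lemma fp_mittag_leffler : mittag_leffler M.
Proof.
move=> I Q s t h; apply: coord_tensor.
have cE (u : seq (M * dprod Q)) i j : coord [seq (y.1, y.2 i) | y <- u] j = coord u j i.
  rewrite /coord big_map; apply: esym.
  by apply: (big_morph (fun f : dprod Q => f i) (id1 := 0) (op1 := +%R)).
have hi i : exists r : 'I_b -> Q i, forall j,
    (coord s j - coord t j : dprod Q) i = \sum_a toR (ka a 0 j) *: r a.
  have [r rP] := coord_relators (h i); exists r => j; rewrite -rP !cE //.
exists (fun a i => projT1 (cid (hi i)) a) => j.
apply: functional_extensionality_dep => i; rewrite (projT2 (cid (hi i)) j).
by apply: esym; apply: (big_morph (fun f : dprod Q => f i) (id1 := 0) (op1 := +%R)).
Qed.
End FpMittagLeffler.

(** * Mittag-Leffler modules and splittings over artin algebras *)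

Section Splitting.
Variables (k : comNzRingType) (R : algType k).
Notation A := (R^c).
Hypotheses (ck : chain_ring k) (fA : fg_algebra (ioA R)).
Variables (J : lmodType k) (e : {linear k^o -> J}).
Hypothesis envJ : injective_envelope_top e.
Let sioB c : toC (ioB R c) = ioA R c. Proof. by []. Qed.
Let st := anti_idB R.

(** A homomorphism from M to V = DQ is a functional on M (x) Q.  The values on
the m_i prescribe it on the span of the m_i (x) Q, consistently by assumption,
and J is injective. *)
Lemma tensor_detects_extension (M V : lmodType A) (Q : lmodType R) (d : Q -> V -> J)
   n (m : 'I_n -> M) (v : 'I_n -> V) :
  finitely_generated V -> dual_pairing (ioA R) (@toC k R) d ->
  (forall q : 'I_n -> Q, tensor_eq [seq (m i, q i) | i <- enum 'I_n] [::] ->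
     \sum_i d (q i) (v i) = 0) ->
  exists h : {linear M -> V}, forall i, h (m i) = v i.
Proof.
move=> fgV dP hq.
have [W [tau [tE [tDl tl] tr tb]]] := tensor_module M Q.
have tZ c x q : tau x ((c%:A : R) *: q) = c *: tau x q by rewrite -tb; exact: tl.
have tP c x q q' : tau x (ioB R c *: q + q') = c *: tau x q + tau x q' by rewrite tr -tZ.
have dc c q u : d (ioB R c *: q) u = c *: d q u.
  have [dl _ _ _] := dP; rewrite (dualZ st dP).
  by have := dl q c u 0; rewrite (dual0r dP) !addr0.
have [|f fP] := extend_functional envJ (V := W) (G := [set wj | exists q : 'I_n -> Q,
   wj = (\sum_i tau (m i) (q i), \sum_i d (q i) (v i))]).
  split; [split|].
  - exists (fun=> 0); congr (_, _); rewrite big1 // => i _; last by rewrite (dual0l st dP).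
    by apply: (addrI (tau (m i) 0)); rewrite -tr !addr0.
  - move=> c _ _ [q ->] [q' ->]; exists (fun i => ioB R c *: q i + q' i); congr (_, _).
      by rewrite /= scaler_sumr -big_split /=; apply: eq_bigr => i _; rewrite tP.
    rewrite /= scaler_sumr -big_split /=; apply: eq_bigr => i _.
    by rewrite (dualDl st dP) -dc.
  - move=> j [q [q0 ->]]; apply: hq; apply/tE.
    by rewrite big_map big_nil /= big_enum /= -q0.
have psil x : linear (fun q : kmod (ioB R) Q => f (tau x q)).
  by move=> c q q'; rewrite -linearP; congr (f _); apply: tP.
have /choice[h hP] x : exists u, forall q, f (tau x q) = d q u.
  exact: (dual_reflexive sioB ck fA envJ dP fgV (mklin (psil x))).
have sep u u' : (forall q, d q u = d q u') -> u = u'.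
  move=> E; apply/eqP; rewrite -subr_eq0; apply/eqP; apply: (dual_separates ck envJ dP) => q.
  by rewrite (dualBr dP) E subrr.
have hl : linear h.
  move=> a x y; apply: sep => q; rewrite -hP (dualDr dP) -[a]/(toC (toR a)) -(dualZ st dP) -!hP.
  by rewrite tDl linearD -tb.
exists (mklin hl) => i; apply: sep => q; rewrite /= -hP.
apply: fP; exists (fun j => if j == i then q else 0); congr (_, _).
  rewrite (bigD1 i) //= eqxx big1 ?addr0 // => j /negbTE ->.
  by apply: (addrI (tau (m j) 0)); rewrite -tr !addr0.
rewrite (bigD1 i) //= eqxx big1 ?addr0 // => j /negbTE ->.
exact: (dual0l st dP).
Qed.

(** The left modules Q fed to the Mittag-Leffler condition: those dual to finitely
generated submodules of M. *)
Record dual_model (M : lmodType A) := DualModel {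
  model_module : lmodType A;
  model_in : {linear model_module -> M};
  model_dual : lmodType R;
  model_pairing : model_dual -> model_module -> J;
  model_inj : injective model_in;
  model_fg : finitely_generated model_module;
  model_dualP : dual_pairing (ioA R) (@toC k R) model_pairing }.

(** If no U in C works, each has a tuple q^U over DU whose tensor with s vanishes
in M (x) DU but not under the evaluation on U.  By the Mittag-Leffler property
the product tensor vanishes in M (x) \prod DU, hence already over some U in C,
which contradicts the choice of q^U. *)
Lemma mittag_leffler_splits (M : lmodType A) (C : set (set M)) :
  mittag_leffler M ->
  (forall U, C U -> submodule U /\ fg_set U) ->
  (forall s : seq M, exists U, C U /\ forall y, y \in s -> U y) ->
  forall s : seq M, exists U, C U /\ exists h : {linear M -> M},
    (forall y, U (h y)) /\ forall y, y \in s -> h y = y.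
Proof.
move=> mlM CP Ccof s; apply: contrapT => nos.
pose I := {U : set M | C U}.
have data (i : I) : exists D : dual_model M, forall y, sval i y <-> exists w, model_in D w = y.
  have [_ fgU] := CP _ (svalP i).
  have [V [j [fgV ji jP]]] := fg_set_module fgU.
  have [Q [d dP]] := dual_module J st sioB (@central_B k R) V.
  by exists (DualModel ji fgV dP).
have [D jP] := choice data.
pose V i := model_module (D i); pose j i : {linear V i -> M} := model_in (D i).
pose Q i := model_dual (D i); pose d i : Q i -> V i -> J := @model_pairing _ (D i).
pose n := size s; pose m (l : 'I_n) := tnth (in_tuple s) l.
have ms l : m l \in s by exact: mem_tnth.
(* where U does not contain s, take q = 0 *)
have bad i : exists q : 'I_n -> Q i,
    tensor_eq [seq (m l, q l) | l <- enum 'I_n] [::] /\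
    ((forall l, sval i (m l)) -> forall v : 'I_n -> V i, (forall l, j i (v l) = m l) ->
      \sum_l d i (q l) (v l) <> 0).
  have ji : injective (j i) := @model_inj _ (D i).
  have dP : dual_pairing (ioA R) (@toC k R) (d i) := @model_dualP _ (D i).
  have [im|nim] := pselect (forall l, sval i (m l)); last first.
    exists (fun=> 0); split=> //.
    elim: (enum 'I_n) => [|l r IH] /=; first exact: tensor_refl.
    apply: (@tensor_cat R M (Q i) [:: (m l, 0)] [::]) => //.
    have := tensor_bal (m l) 0 (0 : Q i); rewrite scale0r scaler0 => h.
    by apply: tensor_trans (tensor_sym h) (tensor_zero _ _).
  have /choice[v vP] l : exists w, j i w = m l by apply/jP.
  apply: contrapT => no; apply: nos; exists (sval i); split; first exact: (svalP i).
  have [|h hP] := tensor_detects_extension (m := m) (v := v) (model_fg (D i)) dP.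
    move=> q qt; apply: contrapT => qn; apply: no; exists q; split=> // _ v' v'P.
    rewrite (eq_bigr (fun l => d i (q l) (v l))) // => l _; congr (d i _ _).
    by apply: ji; rewrite v'P vP.
  exists (j i \o h : {linear M -> M}); split=> [y|y ys].
    by apply/jP; exists (h y).
  have /tnthP[l ->] : y \in in_tuple s by [].
  by rewrite /= -[tnth _ _]/(m l) hP vP.
pose q l : dprod Q := fun i => projT1 (cid (bad i)) l.
have tq : tensor_eq [seq (m l, q l) | l <- enum 'I_n] [::].
  apply: mlM => i /=; rewrite -map_comp.
  by have [h _] := projT2 (cid (bad i)).
have [s' supp] := tensor_eq_support J tq.
have [U [CU Us]] := Ccof (s' ++ s).
pose i : I := exist _ U CU; have ji : injective (j i) := @model_inj _ (D i).
have dP : dual_pairing (ioA R) (@toC k R) (d i) := @model_dualP _ (D i).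
have [_ bi] := projT2 (cid (bad i)).
have Um l : U (m l) by apply: Us; rewrite mem_cat ms orbT.
have /choice[v vP] l : exists w, j i w = m l by apply/jP; exact: Um.
apply: (bi Um v vP).
(* 0 is a default value outside U *)
have inv y : exists w, U y -> j i w = y.
  have [/jP[w wE]|nU] := pselect (sval i y); first by exists w.
  by exists 0 => /nU.
have [g gP] := choice inv.
have [sU _] := CP _ CU.
have E := supp U (fun y (f : dprod Q) => d i (f i) (g y)) sU.
rewrite big_map big_nil /= big_enum /= in E; rewrite -[RHS]E.
- apply: eq_bigr => l _; congr (d i _ _); apply: ji.
  by rewrite vP gP.
- by move=> y ys; apply: Us; rewrite mem_cat ys.
- move=> y z f Uy Uz; rewrite -(dualDr dP); congr (d i _ _); apply: ji.
  by rewrite linearD !gP //; apply: submodD.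
- by move=> y f f' _; rewrite -(dualDl st dP).
- move=> y r f Uy; rewrite -[(r *: f) i]/(r *: f i) (dualZ st dP); congr (d i _ _); apply: ji.
  by rewrite linearZ !gP //; exact: (submodZ _ sU Uy).
Qed.

End Splitting.

(** * Torsion reduced modules and regular images *)

Section RegularImages.
Variables (k : comNzRingType) (R : algType k).
Hypotheses (artR : artin_algebra R) (herR : hereditary R).
Notation A := (R^c).
Implicit Types M V : lmodType A.

Let ck : chain_ring k. Proof. by apply: chain_ring_k; case: artR. Qed.
Let cA : chain_ring A.
Proof. by apply: (chain_ring_alg (io := ioA R)); [case: artR | exact: fg_algebra_A]. Qed.

Lemma fg_mittag_leffler V : finitely_generated V -> mittag_leffler V.
Proof.
move=> fgV; have /fgP[n [x xP]] := fgV.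
have fgn : finitely_generated 'rV[A]_n by exists n, idfun => y; exists y.
have sk : submodule [set y | comb x y = 0] by exact: submodule_ker.
have [b [ka kaP]] := acc_finite_span (chain_condS (K' := setT) (fun _ _ => I) (cA true fgn)) sk.
exact: fp_mittag_leffler xP kaP.
Qed.

Lemma supports_cover (I : Type) (X : I -> lmodType A) M (g : M -> dsum X) (s : seq M) :
  exists t : seq {classic I}, uniq t /\
  forall y, y \in s -> forall i, (i : {classic I}) \notin t -> dproj X i (g y) = 0.
Proof.
elim: s => [|y s [t [_ tP]]]; first by exists [::].
have [t' [_ t'P]] := dsum_supp (g y).
exists (undup (t' ++ t)); split=> [|z]; first exact: undup_uniq.
rewrite inE => /orP[/eqP ->|zs] i; rewrite mem_undup mem_cat negb_or => /andP[it' it].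
  exact: t'P.
exact: tP.
Qed.

(** Near every finite subset, the identity of M factors through a finitely
generated module; over an artin algebra this implies both Mittag-Leffler
conditions. *)
Definition locally_fg M := forall s : seq M,
  exists (W : lmodType A) (a : {linear W -> M}) (b : {linear M -> W}),
    finitely_generated W /\ {in s, forall y, a (b y) = y}.

Lemma locally_split_fg (I : Type) (X : I -> lmodType A) M (f : {linear dsum X -> M}) :
  (forall i, finitely_generated (X i)) -> locally_split_epi f ->
  locally_fg M.
Proof.
move=> fgX fs s; have [g gP] := fs s.
have [t [ut tP]] := supports_cover g s.
have [tr [tr1 tr2]] := dsum_trunc X t.
have [W [i [fgW ii iP]]] := fg_set_module (dsum_trunc_fg (idfun : {linear dsum X -> dsum X}) ut fgX).
have [|c cP] := factor_mono (f := tr) ii.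
  by move=> z; apply/iP; exists (tr z); split=> // l; apply: tr2.
exists W, (f \o i : {linear W -> M}), (c \o g : {linear M -> W}); split=> // y ys /=.
rewrite cP -[RHS](gP y ys); congr (f _); apply: dsum_ext => l.
have [lt|nl] := boolP ((l : {classic I}) \in t); first exact: tr1.
by rewrite tr2 // tP.
Qed.

Lemma locally_split_onto M V (f : {linear V -> M}) : locally_split_epi f -> onto f.
Proof. by move=> fs y; have [g gP] := fs [:: y]; exists (g y); apply: gP; rewrite inE. Qed.

(** A divisible submodule is invisible to every coordinate of a local splitting. *)
Lemma locally_split_reduced (I : Type) (X : I -> lmodType A) M (f : {linear dsum X -> M}) :
  (forall i, indecomposable_regular (X i)) -> locally_split_epi f -> reduced M.
Proof.
move=> rX fs D i ii divD [x nx]; apply: nx.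
have [g gP] := fs [:: i x].
have g0 : g (i x) = 0.
  apply: dsum_ext => l; rewrite linear0.
  exact: (divisible_hom_zero artR herR divD (rX l) (dproj X l \o (g \o i) : {linear D -> X l}) x).
by apply: ii; rewrite linear0 -(gP (i x)) ?inE // g0 linear0.
Qed.

Lemma locally_fg_strict M : locally_fg M -> strict_mittag_leffler M.
Proof.
move=> loc Y p [po pP] s; have [W [a [b [fgW ab]]]] := loc s.
have [l lP] := pP W a (fg_presented cA fgW).
by exists (l \o b : {linear M -> Y}) => y ys /=; rewrite lP ab.
Qed.

Lemma locally_fg_mittag_leffler M : locally_fg M -> mittag_leffler M.
Proof.
move=> loc I Q s t h.
have [W [a [b [fgW ab]]]] := loc ([seq x.1 | x <- s] ++ [seq x.1 | x <- t]).
have E (u : seq (M * dprod Q)) : {subset [seq x.1 | x <- u] <= [seq x.1 | x <- s] ++ [seq x.1 | x <- t]} ->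
    [seq (a x.1, x.2) | x <- [seq (b x.1, x.2) | x <- u]] = u.
  move=> us; rewrite -map_comp -[RHS]map_id; apply/eq_in_map => -[m q] mu /=.
  by rewrite ab //; apply: us; apply/mapP; exists (m, q).
rewrite -(E s); last by move=> y ys; rewrite mem_cat ys.
rewrite -(E t); last by move=> y ys; rewrite mem_cat ys orbT.
apply: tensor_map; apply: (fg_mittag_leffler fgW) => i.
have := tensor_map b (h i); rewrite -!map_comp; exact.
Qed.

(** V is the image of a finite subsum; its summands are images of regular
modules and submodules of M, which excludes the preprojective and the
preinjective ones. *)
Lemma regular_cover M : torsion M -> reduced M -> forall s : seq M,
  exists V (j : {linear V -> M}) n (c : 'I_n -> component V),
  [/\ injective j /\ finitely_generated V, forall y, y \in s -> exists v, j v = y, decomposes c &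
      forall l, indecomposable_regular (cmod (c l))].
Proof.
move=> [I [X [f [rX fo]]]] redM s.
have fgX i : finitely_generated (X i) by case: (rX i) => -[].
have /choice[g gP] := fo.
have [t [ut tP]] := supports_cover g s.
have [tr [tr1 tr2]] := dsum_trunc X t.
have [V [j [fgV ji jP]]] := fg_set_module (dsum_trunc_fg f ut fgX).
have [|r rP] := factor_mono (f := f \o tr : {linear dsum X -> M}) ji.
  by move=> z; apply/jP; exists (tr z); split=> // l; apply: tr2.
have trK z : (forall i, (i : {classic I}) \notin t -> dproj X i z = 0) -> tr z = z.
  move=> z0; apply: dsum_ext => l.
  have [lt|nl] := boolP ((l : {classic I}) \in t); first exact: tr1.
  by rewrite tr2 // z0.
have ro : onto r.
  move=> v; have /jP[z [zt zv]] : exists w, j w = j v by exists v.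
  by exists z; apply: ji; rewrite rP /= trK.
have [n [c cP]] := dcc_decomposable (cA false fgV).
exists V, j, n, c; split=> //.
  move=> y ys; apply/jP; exists (g y); split=> // i it; exact: tP.
move=> l; have [c1 c2 _] := cP.
have [nz _] := c1 l.
have oo : onto (cout (c l)) by move=> w; exists (cin (c l) w).
have ifg : indecomposable_fg (cmod (c l)) by split; [exact: c1 | exact: fg_onto oo fgV].
split=> //.
- move=> pp; have [w nw] := nz; apply: nw.
  have [v <-] := oo w; have [z <-] := ro v.
  apply: (dsum_hom0 (h := cout (c l) \o r : {linear dsum X -> cmod (c l)})) => i x.
  have [iX nppX _] := rX i.
  exact: (preprojective_hom_zero artR herR iX nppX (ifg.2) pp
    ((cout (c l) \o r) \o dinj X i : {linear X i -> cmod (c l)}) x).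
- move=> pp; apply: (redM (cmod (c l)) (j \o cin (c l) : {linear cmod (c l) -> M})) => //.
    by move=> x y /= /ji E; rewrite -(c2 l x) E c2.
  exact: preinjective_divisible pp.
Qed.

(** The family of all indecomposable regular submodules of M, indexed by their
underlying sets. *)
Lemma regular_family M : torsion M -> reduced M ->
  exists (I : Type) (X : I -> lmodType A) (F : {linear dsum X -> M}),
  (forall i, indecomposable_regular (X i)) /\
  forall s : seq M, exists V (j : {linear V -> M}) (sg : {linear V -> dsum X}),
  [/\ injective j, finitely_generated V, forall y, y \in s -> exists v, j v = y &
      forall v, F (sg v) = j v].
Proof.
move=> tM rM.
pose I := {U : set M | exists (W : lmodType A) (i : {linear W -> M}),
  [/\ injective i, forall v, U v <-> exists w, i w = v & indecomposable_regular W]}.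
pose X (u : I) : lmodType A := projT1 (cid (proj2_sig u)).
pose io (u : I) : {linear X u -> M} := projT1 (cid (projT2 (cid (proj2_sig u)))).
have ioP u : [/\ injective (io u), forall v, sval u v <-> exists w, io u w = v & indecomposable_regular (X u)].
  exact: (projT2 (cid (projT2 (cid (proj2_sig u))))).
have [F FP] := dsum_copair io.
exists I, X, F; split=> [u|s]; first by case: (ioP u).
have [V [j [n [c [[ji fgV] js cP cr]]]]] := regular_cover tM rM s.
have [c1 c2 c3] := cP.
have ex_th (l : 'I_n) : exists ut : {u : I & {linear cmod (c l) -> X u}},
    forall w, io (projT1 ut) (projT2 ut w) = j (cin (c l) w).
  pose U : set M := [set y | exists w, j (cin (c l) w) = y].
  have UP : exists (W : lmodType A) (i : {linear W -> M}),
    [/\ injective i, forall v, U v <-> exists w, i w = v & indecomposable_regular W].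
    exists (cmod (c l)), (j \o cin (c l) : {linear _ -> _}); split=> //.
    by move=> x y /= /ji E; rewrite -(c2 l x) E c2.
  pose u : I := exist _ U UP; have [ii iP _] := ioP u.
  have [|q qP] := factor_mono (f := j \o cin (c l) : {linear cmod (c l) -> M}) ii.
    by move=> w; apply/iP; exists w.
  by exists (existT _ u q).
pose th l := projT1 (cid (ex_th l)).
have thP l w : io (projT1 (th l)) (projT2 (th l) w) = j (cin (c l) w) := projT2 (cid (ex_th l)) w.
have sl : linear (fun v => \sum_l dinj X (projT1 (th l)) (projT2 (th l) (cout (c l) v))).
  move=> a u v; rewrite scaler_sumr -big_split /=; apply: eq_bigr => l _.
  by rewrite !linearP.
exists V, j, (mklin sl); split=> // v.
rewrite [in RHS](c3 v) /= !linear_sum; apply: eq_bigr => l _ /=.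
by rewrite FP thP.
Qed.

Lemma strict_regular_image M : torsion M -> reduced M -> strict_mittag_leffler M ->
  exists (I : Type) (X : I -> lmodType A) (f : {linear dsum X -> M}),
    (forall i, indecomposable_regular (X i)) /\ locally_split_epi f.
Proof.
move=> tM rM sM; have [I [X [F [rX cov]]]] := regular_family tM rM.
exists I, X, F; split=> //; apply: sM; split.
  move=> y; have [V [j [sg [_ _ js sgP]]]] := cov [:: y].
  by have [|v <-] := js y; [rewrite inE | exists (sg v)].
move=> N h [m [n [_ [p [po _]]]]].
have [V [j [sg [ji _ js sgP]]]] := cov [seq h (p (delta_mx 0 i)) | i <- enum 'I_n].
have [|q qP] := factor_mono (f := h) ji; last by exists (sg \o q : {linear N -> dsum X}) => x /=; rewrite sgP.
move=> x; have [y <-] := po x; rewrite (row_comb y) !linear_lincomb.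
have /choice[v vP] (i : 'I_n) : exists v, j v = h (p (delta_mx 0 i)).
  by apply: js; apply/mapP; exists i; rewrite ?mem_enum.
exists (lincomb v (y 0)); rewrite linear_lincomb; apply: eq_bigr => i _.
by rewrite /= vP.
Qed.

Lemma mittag_leffler_regular_image M : torsion M -> reduced M -> mittag_leffler M ->
  exists (I : Type) (X : I -> lmodType A) (f : {linear dsum X -> M}),
    (forall i, indecomposable_regular (X i)) /\ locally_split_epi f.
Proof.
move=> tM rM mM; have [I [X [F [rX cov]]]] := regular_family tM rM.
exists I, X, F; split=> // s.
have [J [e envJ]] := injective_envelope_exists k.
pose C : set (set M) := [set U | fg_set U /\ exists V (j : {linear V -> M}) (sg : {linear V -> dsum X}),
  [/\ injective j, forall y, U y <-> exists v, j v = y & forall v, F (sg v) = j v]].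
have [||U [[_ [V [j [sg [ji jP sgP]]]]] [h [hU hs]]]] :=
  @mittag_leffler_splits k R ck (fg_algebra_A artR) J e envJ M C mM _ _ s.
- by move=> U [[n [u uP]] _]; split; [exact: submodule_spans uP | exists n, u].
- move=> s'; have [V [j [sg [ji fgV js sgP]]]] := cov s'.
  exists [set y | exists2 x, setT x & j x = y]; split; last first.
    by move=> y /js[v <-]; exists v.
  split; last by exists V, j, sg; split=> // y; split=> [[v _ <-]|[v <-]]; exists v.
  have /fgP[n [v vP]] := fgV; exists n, (j \o v); exact: (spans_onto j vP).
have [|q qP] := factor_mono (f := h) ji; first by move=> x; apply/jP.
by exists (sg \o q : {linear M -> dsum X}) => y ys /=; rewrite sgP qP hs.
Qed.
End RegularImages.

Theorem proposition23 (k : comNzRingType) (R : algType k)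
    (artR : artin_algebra R) (herR : hereditary R)
    (indR : indecomposable_ring R) (tameR : tame R) (M : lmodType R^c) :
  let regular_image :=
    exists (I : Type) (X : I -> lmodType R^c) (f : {linear dsum X -> M}),
      (forall i, indecomposable_regular (X i)) /\ locally_split_epi f in
  ([/\ torsion M, reduced M & mittag_leffler M] <-> regular_image) /\
  ([/\ torsion M, reduced M & strict_mittag_leffler M] <-> regular_image).
Proof.
move=> RI; have back : RI -> [/\ torsion M, reduced M, mittag_leffler M & strict_mittag_leffler M].
  move=> [I [X [f [rX fs]]]].
  have fgX i : finitely_generated (X i) by case: (rX i) => -[].
  have loc := locally_split_fg fgX fs; split.
  - by exists I, X, f; split=> //; apply: locally_split_onto.
  - exact: locally_split_reduced rX fs.
  - exact: locally_fg_mittag_leffler.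
  - exact: locally_fg_strict.
split; split.
- by move=> [tM rM mM]; apply: mittag_leffler_regular_image.
- by move=> /back[].
- by move=> [tM rM mM]; apply: strict_regular_image.
- by move=> /back[].
Qed.
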